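(* Let $n\geq 3$ and let $(M,g)$ be a Riemannian $n$-manifold with positive definite curvature operator, with curvature tensor $R_{abcd}$. Let $C^{*}_{abcd}$ and $P^{*}_{ab}$ be the Weyl and Schouten tensors of $R^{*}_{ab}{}^{cd}=\ln(R_{ab}{}^{cd})$. Then $M$ admits a local isometric immersion in $\mathbb{R}^{n+1}$ if and only if: when $n=3$, $(e^{P^{*}})_{a[b;c]}=0$; and when $n>3$, $C^{*}_{abcd}=0$.
   Context: All manifolds, metrics and functions are smooth. '';'' is covariant differentiation with respect to the Levi-Civita connection of $g$, and $T_{a[b;c]}=\frac12(T_{ab;c}-T_{ac;b})$. $(M,g)$ admits a local isometric immersion in $\mathbb{R}^{m}$ if every point has an open neighbourhood on which there are scalar fields $u^{(1)},\dots,u^{(m)}$ with $\sum_{\tau} u^{(\tau)}_{;a}u^{(\tau)}_{;b}=g_{ab}$. Curvature sign convention: the unit round sphere has $R_{abcd}=g_{ac}g_{bd}-g_{ad}g_{bc}$. Any tensor $T_{abcd}$ antisymmetric in $ab$ and in $cd$ and satisfying $T_{abcd}=T_{cdab}$ is regarded as a self-adjoint operator on $2$-forms by $\omega_{ab}\mapsto \frac12 T_{ab}{}^{cd}\omega_{cd}$ (so $g_{ac}g_{bd}-g_{ad}g_{bc}$ is the identity operator), and conversely. The curvature operator is the operator associated with $R_{abcd}$. When it is positive definite, $R^{*}_{ab}{}^{cd}=\ln(R_{ab}{}^{cd})$ is its (pointwise) operator logarithm, regarded again as a tensor $R^{*}_{abcd}$. Put $R^{*}_{ij}=R^{*\,k}{}_{ikj}$,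 $\rho^{*}=R^{*\,a}{}_{a}$. The Schouten tensor of $R^{*}$ is $$P^{*}_{ab}=\frac{1}{n-2}\left(R^{*}_{ab}-\frac{\rho^{*}}{2(n-1)}g_{ab}\right),$$ and the Weyl tensor of $R^{*}$ is $$C^{*}_{abcd}=R^{*}_{abcd}-\left(g_{ac}P^{*}_{bd}+P^{*}_{ac}g_{bd}-P^{*}_{ad}g_{bc}-g_{ad}P^{*}_{bc}\right).$$ $e^{P^{*}}$ is the exponential of the endomorphism $P^{*}_{a}{}^{b}$, with its index lowered by $g$, giving a symmetric tensor $(e^{P^{*}})_{ab}$. *)

(* Defs.v *)
From HB Require Import structures.
From mathcomp Require Import all_boot all_order all_algebra.
From mathcomp Require Import all_classical all_reals all_analysis.
Set Implicit Arguments.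
Unset Strict Implicit.
Unset Printing Implicit Defensive.
Import Order.TTheory GRing.Theory Num.Theory.
Import numFieldNormedType.Exports.
Local Open Scope classical_set_scope.
Local Open Scope ring_scope.

Definition partial (R : realType) n (i : 'I_n) (f : 'rV[R]_n -> R) :
  'rV[R]_n -> R := fun x => 'D_(delta_mx 0 i) f x.

(** C^infinity on [U] (used for open [U] only): every iterated partial
    derivative, of order 0 included, is differentiable at every point of [U]. *)
Definition smooth_on (R : realType) n (U : set 'rV[R]_n) (f : 'rV[R]_n -> R) :=
  forall (s : seq 'I_n) (x : 'rV[R]_n),
    U x -> differentiable (foldr (@partial R n) f s) x.

(** [chart_map] and [chart_inv] are total functions; only their values on
    [chart_dom] and [chart_im] are meaningful. *)
Record chart (R : realType) (n : nat) (M : topologicalType) := Chart {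
  chart_dom : set M;
  chart_im : set 'rV[R]_n;
  chart_map : M -> 'rV[R]_n;
  chart_inv : 'rV[R]_n -> M;
  chart_dom_open : open chart_dom;
  chart_im_open : open chart_im;
  chart_map_im : forall p, chart_dom p -> chart_im (chart_map p);
  chart_inv_dom : forall x, chart_im x -> chart_dom (chart_inv x);
  chart_mapK : forall p, chart_dom p -> chart_inv (chart_map p) = p;
  chart_invK : forall x, chart_im x -> chart_map (chart_inv x) = x;
  chart_map_cont : forall p, chart_dom p -> {for p, continuous chart_map};
  chart_inv_cont : forall x, chart_im x -> {for x, continuous chart_inv}
}.

Definition transition (R : realType) n (M : topologicalType)
    (c d : chart R n M) : 'rV[R]_n -> 'rV[R]_n :=
  fun x => chart_map d (chart_inv c x).

Definition overlap (R : realType) n (M : topologicalType)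
    (c d : chart R n M) : set 'rV[R]_n :=
  chart_im c `&` chart_inv c @^-1` chart_dom d.

Record manifold (R : realType) (n : nat) := Manifold {
  carrier :> topologicalType;
  manifold_hausdorff : hausdorff_space carrier;
  manifold_second_countable : @second_countable carrier;
  atlas_index : Type;
  atlas : atlas_index -> chart R n carrier;
  atlas_cover : forall p : carrier, exists i, chart_dom (atlas i) p;
  atlas_compat : forall i j k,
    smooth_on (overlap (atlas i) (atlas j))
      (fun x => transition (atlas i) (atlas j) x 0 k)
}.

(** A smooth scalar field on the open set [W]; the values outside [W] of the
    total function [u] are irrelevant. *)
Definition smooth_field (R : realType) n (M : manifold R n) (W : set M)
    (u : M -> R) :=
  forall i : atlas_index M,
    smooth_on (chart_im (atlas i) `&` chart_inv (atlas i) @^-1` W)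
      (u \o chart_inv (atlas i)).

(** The metric is given by its component matrices [g_ab] in the charts of the
    atlas, related on overlaps by the transformation law of covariant
    2-tensors. *)
Record metric (R : realType) n (M : manifold R n) := Metric {
  metric_comp :> atlas_index M -> 'rV[R]_n -> 'M[R]_n;
  metric_sym : forall i x, chart_im (atlas i) x ->
    (metric_comp i x)^T = metric_comp i x;
  metric_posdef : forall i x, chart_im (atlas i) x ->
    forall v : 'rV[R]_n, v != 0 -> 0 < (v *m metric_comp i x *m v^T) 0 0;
  metric_smooth : forall i a b,
    smooth_on (chart_im (atlas i)) (fun x => metric_comp i x a b);
  metric_transf : forall i j x, overlap (atlas i) (atlas j) x ->
    let y := transition (atlas i) (atlas j) in
    forall a b, metric_comp i x a b =
      \sum_c \sum_d partial a (fun z => y z 0 c) x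
                    * partial b (fun z => y z 0 d) x
                    * metric_comp j (y x) c d
}.

(** Since [u] is scalar, [u_{;a}] is the partial derivative. *)
Definition local_isometric_immersion (R : realType) n (M : manifold R n)
    (g : metric M) (m : nat) :=
  forall p : M, exists W : set M, [/\ open W, W p &
    exists u : 'I_m -> M -> R,
      (forall t, smooth_field W (u t)) /\
      forall (i : atlas_index M) x,
        chart_im (atlas i) x -> W (chart_inv (atlas i) x) ->
        forall a b,
          \sum_t partial a (u t \o chart_inv (atlas i)) x
                 * partial b (u t \o chart_inv (atlas i)) x = g i x a b].

Section Chartwise.
Variables (R : realType) (n : nat).
Implicit Types (g : 'rV[R]_n -> 'M[R]_n) (x : 'rV[R]_n).

(** [christoffel g c a b x] is Gamma^c_{ab}. *)
Definition christoffel g (c a b : 'I_n) : 'rV[R]_n -> R := fun x =>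
  2^-1 * \sum_d invmx (g x) c d *
    (partial a (fun y => g y d b) x + partial b (fun y => g y a d) x
     - partial d (fun y => g y a b) x).

(** [riemann_up g a b c d x] is R^a_{bcd}. *)
Definition riemann_up g (a b c d : 'I_n) : 'rV[R]_n -> R := fun x =>
  partial c (christoffel g a d b) x - partial d (christoffel g a c b) x
  + \sum_e (christoffel g a c e x * christoffel g e d b x
            - christoffel g a d e x * christoffel g e c b x).

(** R_{abcd}, with the sign for which the unit sphere has
    R_{abcd} = g_ac g_bd - g_ad g_bc. *)
Definition riemann g x : 'I_n -> 'I_n -> 'I_n -> 'I_n -> R :=
  fun a b c d => \sum_e g x a e * riemann_up g e b c d x.

(** [cov2 g T a b c x] is T_{ab;c}. *)
Definition cov2 g (T : 'rV[R]_n -> 'M[R]_n) (a b c : 'I_n) :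
    'rV[R]_n -> R := fun x =>
  partial c (fun y => T y a b) x
  - \sum_d christoffel g d c a x * T x d b
  - \sum_d christoffel g d c b x * T x a d.

(** [cov2_alt g T a b c x] is T_{a[b;c]}. *)
Definition cov2_alt g (T : 'rV[R]_n -> 'M[R]_n) (a b c : 'I_n) :
    'rV[R]_n -> R := fun x =>
  2^-1 * (cov2 g T a b c x - cov2 g T a c b x).

End Chartwise.

(** Here [g] is the matrix of the metric at a single point. *)
Section Pointwise.
Variables (R : realType) (n : nat).
Implicit Types (g : 'M[R]_n) (T L : 'I_n -> 'I_n -> 'I_n -> 'I_n -> R).

Definition two_form (w : 'M[R]_n) := w^T = - w.

(** w^{ab} *)
Definition raise2 g (w : 'M[R]_n) : 'M[R]_n :=
  \matrix_(a, b) \sum_c \sum_d invmx g a c * invmx g b d * w c d.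

(** The operator w_ab |-> 1/2 T_ab^cd w_cd on 2-forms. *)
Definition op_of g T (w : 'M[R]_n) : 'M[R]_n :=
  \matrix_(a, b) (2^-1 * \sum_c \sum_d T a b c d * raise2 g w c d).

(** The inner product on 2-forms, 1/2 v_ab w^ab. *)
Definition form_dot g (v w : 'M[R]_n) : R :=
  2^-1 * \sum_a \sum_b v a b * raise2 g w a b.

(** The tensors identified with self-adjoint operators on 2-forms. *)
Definition operator_tensor T :=
  [/\ forall a b c d, T b a c d = - T a b c d,
      forall a b c d, T a b d c = - T a b c d
    & forall a b c d, T c d a b = T a b c d].

Definition op_posdef g T :=
  forall w, two_form w -> w != 0 -> 0 < form_dot g w (op_of g T w).

(** Functional calculus: [L] acts as multiplication by [ln k] on the
    [k]-eigenspace of [T].  When [T] is self-adjoint and positive definite the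
    eigenspaces span the 2-forms, so there is exactly one such [L]. *)
Definition is_op_log g T L :=
  operator_tensor L /\
  forall (w : 'M[R]_n) (k : R), two_form w ->
    op_of g T w = k *: w -> op_of g L w = ln k *: w.

(** The default value 0 only serves when no logarithm exists. *)
Definition op_log g T : 'I_n -> 'I_n -> 'I_n -> 'I_n -> R :=
  xget (fun _ _ _ _ => 0) [set L | is_op_log g T L].

(** T_ij = T^k_{ikj} *)
Definition ricci g T : 'M[R]_n :=
  \matrix_(i, j) \sum_k \sum_l invmx g k l * T l i k j.

Definition scalar g T : R := \sum_a \sum_b invmx g a b * ricci g T a b.

Definition schouten g T : 'M[R]_n :=
  (n%:R - 2)^-1 *: (ricci g T - (scalar g T / (2 * (n%:R - 1))) *: g).

Definition weyl g T (a b c d : 'I_n) : R :=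
  let P := schouten g T in
  T a b c d - (g a c * P b d + P a c * g b d - P a d * g b c - g a d * P b c).

Definition mexp (A : 'M[R]_n) : 'M[R]_n :=
  limn (series (fun k : nat => (k`!%:R)^-1 *: (A ^+ k))).

(** (e^P)_ab: exponential of P_a^b = P_ac g^cb, with the index lowered. *)
Definition exp_lower g (P : 'M[R]_n) : 'M[R]_n := mexp (P *m invmx g) *m g.

End Pointwise.

Section Riemannian.
Variables (R : realType) (n : nat) (M : manifold R n) (g : metric M).

Definition positive_curvature_operator :=
  forall i x, chart_im (atlas i) x -> op_posdef (g i x) (riemann (g i) x).

Definition Rstar (i : atlas_index M) (x : 'rV[R]_n) :=
  op_log (g i x) (riemann (g i) x).

Definition Pstar (i : atlas_index M) (x : 'rV[R]_n) : 'M[R]_n :=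
  schouten (g i x) (Rstar i x).

Definition Cstar (i : atlas_index M) (x : 'rV[R]_n) :=
  weyl (g i x) (Rstar i x).

Definition expPstar (i : atlas_index M) (x : 'rV[R]_n) : 'M[R]_n :=
  exp_lower (g i x) (Pstar i x).

End Riemannian.

(* Main.v *)
Require Import Defs.
From HB Require Import structures.
From mathcomp Require Import all_boot all_order all_algebra.
From mathcomp Require Import all_classical all_reals all_analysis.
From mathcomp Require Import ring lra.
Set Implicit Arguments.
Unset Strict Implicit.
Unset Printing Implicit Defensive.
Import Order.TTheory GRing.Theory Num.Theory.
Import numFieldNormedType.Exports.
Local Open Scope classical_set_scope.
Local Open Scope ring_scope.

(** The curvature condition of the theorem is the pair of equations of Gauss
    and Codazzi, with the second fundamental form eliminated by a logarithm.

    Let h be the second fundamental form of an immersion in R^(n+1).  The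
    Gauss equation R_abcd = h_ac h_bd - h_ad h_bc says that the curvature
    operator is the exterior square of h: in a g-orthonormal frame e_i that
    diagonalizes h, with eigenvalues d_i, it multiplies e_i /\ e_j by d_i d_j.
    If these products are positive, all the d_i have the same sign
    ([gauss_definite]), and h is positive definite for one of the two unit
    normals.  As ln (d_i d_j) = ln d_i + ln d_j, the logarithm of the curvature
    operator is then the Kulkarni-Nomizu product of g with ln h, which means
    that its Weyl tensor is 0 and its Schouten tensor is ln h
    ([op_log_gauss]).  Exponentiating the same identity, C* = 0 implies that
    h = exp P* solves the Gauss equation ([gauss_of_weyl_eq0]).

    What remains is the Codazzi equation h_a[b;c] = 0 for h = exp P*.  When
    n = 3 the Weyl tensor of any curvature-like tensor is 0 ([weyl_dim3]), so
    the Gauss equation costs nothing and the Codazzi equation is the condition.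
    When n > 3 it follows from the Gauss equation: substituting h in the second
    Bianchi identity gives a linear system for h_a[b;c], which has only the
    solution 0 because h is invertible ([codazzi_algebra],
    [codazzi_of_gauss]).

    An immersion gives a solution h of both equations by differentiating
    df.df = g twice ([gauss_codazzi_of_local_immersion]).  Conversely, a
    solution gives an immersion in a neighbourhood of every point
    ([local_immersion_exists], the theorem of Bonnet): the position, the
    tangent frame and the unit normal solve a linear total differential system,
    whose integrability conditions are the symmetry of the Christoffel symbols
    and of h and the equations of Gauss and Codazzi.  Such a system is solved
    along the rays issued from the base point ([flat_system_solvable]), and the
    scalar products of the frame are the prescribed ones because they satisfy
    a homogeneous linear system too ([parallel_gram]).  The coefficients of
    the system must be smooth; for exp P* this follows from the fact that a
    positive definite h is an algebraic function of its exterior square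
    ([smooth_of_gauss]). *)

(** * Partial derivatives and smooth functions *)

Lemma is_diff_of_eps (R : realType) (V W : normedModType R) (f : V -> W) (df : {linear V -> W}) (x : V) :
  continuous df ->
  (forall e : R, 0 < e -> \forall h \near 0, `|f (h + x) - f x - df h| <= e * `|h|) ->
  is_diff x f df.
Proof.
move=> dc H.
have e : f \o shift x = cst (f x) + df +o_ 0 id.
  apply/eqaddoP => _/posnumP[e]; near=> h => /=.
  rewrite opprD addrA; near: h; exact: H.
have dE := diff_unique dc e.
have dd : differentiable f x by apply/diff_locallyP; rewrite dE.
exact: DiffDef dd dE.
Unshelve. all: by end_near. Qed.

(** Differentiability is local, so the values of a chart expression outside the
    image of the chart do not matter. *)
Lemma near_differentiable (R : realType) (V W : normedModType R) (f g : V -> W) (x : V) :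
  (\near x, f x = g x) -> differentiable f x -> differentiable g x.
Proof.
move=> fg df; have dc := diff_continuous df.
suff : is_diff x g ('d f x) by move=> [].
apply: is_diff_of_eps => // e e0.
have [_ /eqaddoP /(_ _ e0) H] := (diff_locallyP _ _).1 df.
near=> h.
have -> : g (h + x) = f (h + x).
  near: h; have /nbhs0P := fg; apply: filterS => h /=; by rewrite addrC.
rewrite -(nbhs_singleton fg).
have : `|(f \o shift x - (cst (f x) + 'd f x)) h| <= e * `|h| by near: h.
by rewrite /= opprD addrA.
Unshelve. all: by end_near. Qed.

Section Partial.
Variables (R : realType) (n : nat).
Implicit Types (f g : 'rV[R]_n -> R) (U : set 'rV[R]_n) (x : 'rV[R]_n).

Lemma near_partial i f g x :
  (\near x, f x = g x) -> partial i f x = partial i g x.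
Proof. exact: near_eq_derive. Qed.

Lemma partial_cst i (a : R) x : partial i (fun=> a) x = 0.
Proof. exact: derive_cst. Qed.

Lemma partialD i f g x : differentiable f x -> differentiable g x ->
  partial i (fun y => f y + g y) x = partial i f x + partial i g x.
Proof. by move=> df dg; apply: deriveD; apply: diff_derivable. Qed.

Lemma partialM i f g x : differentiable f x -> differentiable g x ->
  partial i (fun y => f y * g y) x = partial i f x * g x + f x * partial i g x.
Proof.
move=> df dg; rewrite /partial deriveM; [|exact: diff_derivable..].
by rewrite addrC /GRing.scale /= [g x * _]mulrC.
Qed.

Lemma partialN i f x : differentiable f x ->
  partial i (fun y => - f y) x = - partial i f x.
Proof. by move=> df; apply: deriveN; apply: diff_derivable. Qed.

Lemma partialB i f g x : differentiable f x -> differentiable g x ->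
  partial i (fun y => f y - g y) x = partial i f x - partial i g x.
Proof. by move=> df dg; apply: deriveB; apply: diff_derivable. Qed.

Lemma differentiable_bigsum (I : Type) (r : seq I) (F : I -> 'rV[R]_n -> R) x :
  (forall a, differentiable (F a) x) ->
  differentiable (fun y => \sum_(a <- r) F a y) x.
Proof.
move=> dF; elim: r => [|a r IH].
  under eq_fun do rewrite big_nil; exact: differentiable_cst.
by under eq_fun do rewrite big_cons; apply: differentiableD.
Qed.

Lemma partial_sum i (I : Type) (r : seq I) (F : I -> 'rV[R]_n -> R) x :
  (forall a, differentiable (F a) x) ->
  partial i (fun y => \sum_(a <- r) F a y) x = \sum_(a <- r) partial i (F a) x.
Proof.
move=> dF; elim: r => [|a r IH].
  by rewrite big_nil; under eq_fun do rewrite big_nil; rewrite partial_cst.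
under eq_fun do rewrite big_cons.
by rewrite big_cons partialD ?IH//; apply: differentiable_bigsum.
Qed.

End Partial.

Section Chain.
Variables (R : realType) (n m : nat).
Implicit Types (f : 'rV[R]_m -> R) (phi : 'rV[R]_n -> 'rV[R]_m) (x : 'rV[R]_n).

Lemma differentiable_row phi x :
  (forall k, differentiable (fun y => phi y 0 k) x) -> differentiable phi x.
Proof.
move=> dphi.
have -> : phi = \sum_k (fun y => phi y 0 k *: (delta_mx 0 k : 'rV[R]_m)).
  by apply/funext => y; rewrite fct_sumE [LHS]row_sum_delta.
by apply: differentiable_sum => k; apply: differentiableZl.
Qed.

Lemma diff_row_sum f (y v : 'rV[R]_m) : differentiable f y ->
  'd f y v = \sum_k v 0 k * partial k f y.
Proof.
move=> df; rewrite {1}(row_sum_delta v) linear_sum; apply: eq_bigr => k _.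
by rewrite linearZ /= /partial deriveE.
Qed.

(** The differential commutes with the coordinate projections, since these are
    linear and continuous. *)
Lemma diff_coord phi x v k : differentiable phi x ->
  'd phi x v 0 k = 'd (fun y => phi y 0 k : R) x v.
Proof.
move=> dphi.
have @c : {linear 'rV[R]_m -> R}.
  by exists (fun N : 'rV[R]_m => N 0 k); do 2![eexists]; do ?[constructor];
     rewrite ?mxE// => ? *; rewrite ?mxE//; move=> ?; rewrite !mxE.
have cc : continuous c by exact: coord_continuous.
have dc := linear_differentiable (phi x) cc.
have E : 'd (c \o phi) x v = ('d c (phi x) \o 'd phi x) v by rewrite (diff_comp dphi dc).
by move: E; rewrite {2}/comp diff_lin// => <-.
Qed.

Lemma partial_comp i f phi x :
  (forall k, differentiable (fun y => phi y 0 k) x) -> differentiable f (phi x) ->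
  partial i (fun y => f (phi y)) x =
  \sum_k partial k f (phi x) * partial i (fun z => phi z 0 k) x.
Proof.
move=> dphi df; have dp := differentiable_row dphi.
rewrite {1}/partial deriveE; last exact: (differentiable_comp dp df).
rewrite (diff_comp dp df) /= diff_row_sum//; apply: eq_bigr => k _.
by rewrite mulrC diff_coord// -deriveE.
Qed.
End Chain.

Section Smooth.
Variables (R : realType) (n : nat).
Implicit Types (f g : 'rV[R]_n -> R) (U V : set 'rV[R]_n) (x : 'rV[R]_n).

(** An order-by-order form of [smooth_on]: closure under products, inverses and
    composition needs an induction on the order of differentiation in which the
    function varies, which the list of indices in [smooth_on] does not offer. *)
Fixpoint class_C k U f : Prop :=
  (forall x, U x -> differentiable f x) /\
  (if k is j.+1 then forall i, class_C j U (partial i f) else True).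

Lemma class_C_diff k U f x : class_C k U f -> U x -> differentiable f x.
Proof. by case: k => [|k] /= [df _]; apply: df. Qed.

Lemma class_CS k U f i : class_C k.+1 U f -> class_C k U (partial i f).
Proof. by move=> /= [_]; apply. Qed.

Lemma class_CW k U f : class_C k.+1 U f -> class_C k U f.
Proof.
elim: k f => [|k IH] f [df Df] /=; split => // i; exact/IH/Df.
Qed.

Lemma smooth_on_class_C U f : smooth_on U f <-> forall k, class_C k U f.
Proof.
split=> [sf k|Cf s x Ux].
  elim: k f sf => [|k IH] f sf /=; split => //; try exact: (sf [::]).
  by move=> i; apply: IH => s x; have := sf (rcons s i) x; rewrite foldr_rcons.
elim/last_ind: s f Cf => [|s i IH] f Cf; first exact: class_C_diff (Cf 0%N) Ux.
by rewrite foldr_rcons; apply: IH => k; apply: class_CS.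
Qed.

Lemma smooth_on_differentiable U f x : smooth_on U f -> U x -> differentiable f x.
Proof. by move=> sf; exact: (sf [::]). Qed.

Lemma smooth_on_partial U f i : smooth_on U f -> smooth_on U (partial i f).
Proof. by move=> sf s x Ux; have := sf (rcons s i) x Ux; rewrite foldr_rcons. Qed.

Lemma smooth_onS U V f : V `<=` U -> smooth_on U f -> smooth_on V f.
Proof. by move=> VU sf s x /VU; apply: sf. Qed.

Lemma open_near_eq U f g x : open U -> (forall y, U y -> f y = g y) -> U x ->
  \near x, f x = g x.
Proof. by move=> oU fg Ux; near=> y; apply: fg; near: y; exact: open_nbhs_nbhs.
Unshelve. all: by end_near. Qed.

Lemma open_partial_eq i U f g x : open U -> (forall y, U y -> f y = g y) -> U x ->
  partial i f x = partial i g x.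
Proof. by move=> oU fg Ux; apply/near_partial/(open_near_eq oU). Qed.

Lemma class_C_ext k U f g : open U -> (forall y, U y -> f y = g y) ->
  class_C k U f -> class_C k U g.
Proof.
move=> oU; elim: k f g => [|k IH] f g fg /= [df Df]; split => //.
- by move=> x Ux; apply: near_differentiable (df x Ux); exact: open_near_eq Ux.
- by move=> x Ux; apply: near_differentiable (df x Ux); exact: open_near_eq Ux.
- by move=> i; apply: IH (Df i) => y Uy; exact: open_partial_eq Uy.
Qed.

Lemma smooth_on_ext U f g : open U -> (forall y, U y -> f y = g y) ->
  smooth_on U f -> smooth_on U g.
Proof. by move=> oU fg /smooth_on_class_C sf; apply/smooth_on_class_C => k; exact: class_C_ext (sf k). Qed.

Lemma class_C_cst k U (a : R) : open U -> class_C k U (fun=> a).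
Proof.
move=> oU; elim: k a => [|k IH] a /=; split => //; try by move=> x _; exact: differentiable_cst.
move=> i.
by apply: (@class_C_ext _ _ (fun=> 0)) => // y _; rewrite partial_cst.
Qed.

Lemma class_CD k U f g : open U -> class_C k U f -> class_C k U g ->
  class_C k U (fun x => f x + g x).
Proof.
move=> oU; elim: k f g => [|k IH] f g /= [df Df] [dg Dg]; split => //;
  try by move=> x Ux; apply: differentiableD; [exact: df|exact: dg].
move=> i; apply: (@class_C_ext _ _ (fun x => partial i f x + partial i g x)) => //.
  by move=> y Uy; rewrite partialD//; [exact: df|exact: dg].
exact: IH.
Qed.

Lemma class_CM k U f g : open U -> class_C k U f -> class_C k U g ->
  class_C k U (fun x => f x * g x).
Proof.
move=> oU; elim: k f g => [|k IH] f g Cf Cg; have df := class_C_diff Cf; have dg := class_C_diff Cg;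
  split => //; try by move=> x Ux; apply: differentiableM; [exact: df|exact: dg].
move=> i; apply: (@class_C_ext _ _ (fun x => partial i f x * g x + f x * partial i g x)) => //.
  by move=> y Uy; rewrite partialM//; [exact: df|exact: dg].
by apply: class_CD => //; apply: IH; (try exact: class_CS); exact: class_CW.
Qed.

Lemma class_CV k U f : open U -> (forall x, U x -> f x != 0) -> class_C k U f ->
  class_C k U (fun x => (f x)^-1).
Proof.
move=> oU f0; elim: k => [|k IH] Cf; have df := class_C_diff Cf;
  split => //; try by move=> x Ux; apply: differentiableV; [exact: df|exact: f0].
have CV := IH (class_CW Cf).
move=> i; apply: (@class_C_ext _ _ (fun x => (-1) * partial i f x * ((f x)^-1 * (f x)^-1))) => //.
  move=> y Uy; rewrite [RHS]/partial deriveV; [|exact: f0|exact/diff_derivable/df].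
  by rewrite /GRing.scale /= expr2 invfM -/(partial i f y); ring.
by do 2 (apply: class_CM => //); [exact: class_C_cst|exact: class_CS].
Qed.

Lemma differentiable_sqrt (f : 'rV[R]_n -> R) x : 0 < f x -> differentiable f x ->
  differentiable (fun y => Num.sqrt (f y)) x.
Proof.
move=> f0 df; apply: (@differentiable_comp _ _ _ _ f Num.sqrt) => //.
by apply/derivable1_diffP; have [] := is_derive1_sqrt f0.
Qed.

Lemma partial_sqrt i f x : 0 < f x -> differentiable f x ->
  partial i (fun y => Num.sqrt (f y)) x = partial i f x * (2 * Num.sqrt (f x))^-1.
Proof.
move=> f0 df; have dfs := differentiable_sqrt f0 df.
have ds : differentiable (@Num.sqrt R) (f x).
  by apply/derivable1_diffP; have [] := is_derive1_sqrt f0.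
have ds1 : 'd (@Num.sqrt R) (f x) 1 = (2 * Num.sqrt (f x))^-1.
  by rewrite -deriveE// derive_sqrt.
rewrite /partial !deriveE// (diff_comp df ds) /= -{1}['d f x _]mulr1 linearZ /=.
by rewrite ds1.
Qed.

Lemma class_C_sqrt k U f : open U -> (forall x, U x -> 0 < f x) -> class_C k U f ->
  class_C k U (fun x => Num.sqrt (f x)).
Proof.
move=> oU f0; elim: k => [|k IH] Cf; have df := class_C_diff Cf;
  split => //; try by move=> x Ux; apply: differentiable_sqrt; [exact: f0|exact: df].
have CV := IH (class_CW Cf).
move=> i; apply: (@class_C_ext _ _ (fun x => partial i f x * (2 * Num.sqrt (f x))^-1)) => //.
  by move=> y Uy; rewrite partial_sqrt//; [exact: f0|exact: df].
apply: class_CM => //; first exact: class_CS.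
apply: class_CV => //; last by apply: class_CM => //; exact: class_C_cst.
by move=> x Ux; rewrite mulf_neq0 ?pnatr_eq0// gt_eqF// sqrtr_gt0 f0.
Qed.

Section Ops.
Variable U : set 'rV[R]_n.
Hypothesis oU : open U.

Lemma smooth_on_cst (a : R) : smooth_on U (fun=> a).
Proof. by apply/smooth_on_class_C => k; apply: class_C_cst. Qed.

Lemma smooth_onD f g : smooth_on U f -> smooth_on U g -> smooth_on U (fun x => f x + g x).
Proof. by move=> /smooth_on_class_C sf /smooth_on_class_C sg; apply/smooth_on_class_C => k; apply: class_CD. Qed.

Lemma smooth_onM f g : smooth_on U f -> smooth_on U g -> smooth_on U (fun x => f x * g x).
Proof. by move=> /smooth_on_class_C sf /smooth_on_class_C sg; apply/smooth_on_class_C => k; apply: class_CM. Qed.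

Lemma smooth_onN f : smooth_on U f -> smooth_on U (fun x => - f x).
Proof.
move=> sf; apply: (@smooth_on_ext _ (fun x => (-1) * f x)) => //; first by move=> y _; rewrite mulN1r.
by apply: smooth_onM => //; exact: smooth_on_cst.
Qed.

Lemma smooth_onB f g : smooth_on U f -> smooth_on U g -> smooth_on U (fun x => f x - g x).
Proof. by move=> sf sg; apply: smooth_onD => //; exact: smooth_onN. Qed.

Lemma smooth_onV f : (forall x, U x -> f x != 0) -> smooth_on U f ->
  smooth_on U (fun x => (f x)^-1).
Proof. by move=> f0 /smooth_on_class_C sf; apply/smooth_on_class_C => k; apply: class_CV. Qed.

Lemma smooth_on_sqrt f : (forall x, U x -> 0 < f x) -> smooth_on U f ->
  smooth_on U (fun x => Num.sqrt (f x)).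
Proof. by move=> f0 /smooth_on_class_C sf; apply/smooth_on_class_C => k; apply: class_C_sqrt. Qed.

Lemma smooth_on_sum (I : Type) (r : seq I) (P : pred I) (F : I -> 'rV[R]_n -> R) :
  (forall a, P a -> smooth_on U (F a)) -> smooth_on U (fun x => \sum_(a <- r | P a) F a x).
Proof.
move=> sF; elim: r => [|a r IH].
  by under eq_fun do rewrite big_nil; exact: smooth_on_cst.
under eq_fun do rewrite big_cons.
by case: (boolP (P a)) => // /sF sa; exact: smooth_onD.
Qed.

Lemma smooth_on_prod (I : Type) (r : seq I) (P : pred I) (F : I -> 'rV[R]_n -> R) :
  (forall a, P a -> smooth_on U (F a)) -> smooth_on U (fun x => \prod_(a <- r | P a) F a x).
Proof.
move=> sF; elim: r => [|a r IH].
  by under eq_fun do rewrite big_nil; exact: smooth_on_cst.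
under eq_fun do rewrite big_cons.
by case: (boolP (P a)) => // /sF sa; exact: smooth_onM.
Qed.

Lemma smooth_on_det m (A : 'rV[R]_n -> 'M[R]_m) :
  (forall a b, smooth_on U (fun x => A x a b)) -> smooth_on U (fun x => \det (A x)).
Proof.
move=> sA; rewrite /determinant; apply: smooth_on_sum => s _; apply: smooth_onM.
  exact: smooth_on_cst.
exact: smooth_on_prod.
Qed.

Lemma smooth_on_invmx m (A : 'rV[R]_n -> 'M[R]_m) :
  (forall a b, smooth_on U (fun x => A x a b)) -> (forall x, U x -> A x \in unitmx) ->
  forall a b, smooth_on U (fun x => invmx (A x) a b).
Proof.
move=> sA uA a b.
apply: (@smooth_on_ext _ (fun x => (\det (A x))^-1 * cofactor (A x) b a)) => //.
  by move=> y Uy; rewrite /invmx uA// !mxE.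
apply: smooth_onM.
  apply: smooth_onV; last exact: smooth_on_det.
  by move=> x Ux; have := uA x Ux; rewrite unitmxE unitfE.
apply: smooth_onM; first exact: smooth_on_cst.
apply: smooth_on_det => c d.
by under eq_fun do rewrite !mxE; exact: sA.
Qed.

End Ops.
End Smooth.

Section SmoothComp.
Variables (R : realType) (n m : nat).

Lemma smooth_on_comp (U : set 'rV[R]_n) (V : set 'rV[R]_m) (f : 'rV[R]_m -> R)
    (phi : 'rV[R]_n -> 'rV[R]_m) :
  open U -> (forall x, U x -> V (phi x)) -> smooth_on V f ->
  (forall k, smooth_on U (fun x => phi x 0 k)) -> smooth_on U (fun x => f (phi x)).
Proof.
move=> oU UV sf sphi; apply/smooth_on_class_C => k.
have dphi x : U x -> forall k, differentiable (fun y => phi y 0 k) x.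
  by move=> Ux j; exact: smooth_on_differentiable (sphi j) Ux.
have dc (h : 'rV[R]_m -> R) x : smooth_on V h -> U x -> differentiable (fun y => h (phi y)) x.
  move=> sh Ux; apply: (@differentiable_comp _ _ _ _ phi h).
    exact/differentiable_row/dphi.
  exact: smooth_on_differentiable sh (UV _ Ux).
elim: k f sf => [|k IH] f sf /=; split => //; try by move=> x; exact: dc.
move=> i.
apply: (@class_C_ext _ _ _ _ (fun x => \sum_j partial j f (phi x) * partial i (fun z => phi z 0 j) x)) => //.
  move=> y Uy; rewrite partial_comp//; first exact: dphi.
  exact: smooth_on_differentiable sf (UV _ Uy).
elim: (index_enum _) => [|j r IHr].
  by under eq_fun do rewrite big_nil; exact: class_C_cst.
under eq_fun do rewrite big_cons.
apply: class_CD => //; apply: class_CM => //; first exact/IH/smooth_on_partial.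
by have /smooth_on_partial/smooth_on_class_C := sphi j; apply.
Qed.
End SmoothComp.

Section Lines.
Variables (R : realType) (n : nat).
Implicit Types (f : 'rV[R]_n -> R) (U : set 'rV[R]_n) (x v w : 'rV[R]_n).

Lemma is_derive_line f x v (t : R) : differentiable f (x + t *: v) ->
  is_derive t (1:R) (fun s : R => f (x + s *: v)) ('D_v f (x + t *: v)).
Proof.
move=> df.
have dl : is_diff t (fun s : R => x + s *: v) (fun s => s *: v).
  have dl0 : is_diff t (cst x + (fun s : R => s *: v)) (0 + (fun s : R => s *: v)) by exact: is_diffD.
  by rewrite add0r in dl0.
have dl' : differentiable (fun s : R => x + s *: v) t by case: dl => ? _.
have dc := @differentiable_comp _ _ _ _ (fun s : R => x + s *: v) f t dl' df.
apply: DeriveDef; first exact: diff_derivable.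
rewrite (deriveE _ dc) (@diff_comp _ _ _ _ (fun s : R => x + s *: v) f t dl' df) /=.
by case: dl => _ ->; rewrite scale1r deriveE.
Qed.

Lemma MVT_line f x v (t : R) : 0 < t ->
  (forall s : R, 0 <= s <= t -> differentiable f (x + s *: v)) ->
  exists2 s, 0 <= s <= t & f (x + t *: v) - f x = t * 'D_v f (x + s *: v).
Proof.
move=> t0 df.
have [||c] := @MVT R (fun s => f (x + s *: v)) (fun s => 'D_v f (x + s *: v)) 0 t t0.
- move=> s; rewrite in_itv /= => /andP[s0 st]; apply: is_derive_line; apply: df.
  by rewrite !ltW.
- apply: derivable_within_continuous => s; rewrite in_itv /= => st.
  by have [] := is_derive_line (df s st).
rewrite in_itv /= => /andP[c0 ct]; rewrite scale0r addr0 subr0 mulrC => ->.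
by exists c => //; rewrite !ltW.
Qed.

(** The mixed second difference of f over the parallelogram t v, t w, as t^2 times
    a second derivative: the mean value theorem is applied along v to
    y |-> f (y + t w) - f y, then along w to the derivative of f along v. *)
Lemma second_difference f x v w (t r : R) : 0 < t -> t * (`|v| + `|w|) < r ->
  (forall y, `|y - x| < r -> differentiable f y) ->
  (forall y, `|y - x| < r -> differentiable ('D_v f) y) ->
  exists2 y, `|y - x| <= t * (`|v| + `|w|) &
    f (x + t *: v + t *: w) - f (x + t *: v) - (f (x + t *: w) - f x) =
    t ^+ 2 * 'D_w ('D_v f) y.
Proof.
move=> t0 tr df ddf.
have bnd (a b : R) : 0 <= a <= t -> 0 <= b <= t ->
    `|x + a *: v + b *: w - x| <= t * (`|v| + `|w|).
  move=> /andP[a0 at_] /andP[b0 bt]; rewrite addrAC [x + _]addrC addrK.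
  rewrite (le_trans (ler_normD _ _))// !normrZ !ger0_norm// mulrDr lerD//; exact: ler_wpM2r.
have bnd' a b ha hb : `|_ - x| < r := le_lt_trans (bnd a b ha hb) tr.
have tt : 0 <= t <= t by rewrite lexx ltW.
have t00 : 0 <= (0:R) <= t by rewrite lexx ltW.
pose F y := f (y + t *: w) - f y.
have dF y : differentiable f y -> differentiable f (y + t *: w) ->
    differentiable F y /\ 'D_v F y = 'D_v f (y + t *: w) - 'D_v f y.
  move=> d1 d2.
  have dT : is_diff y (id + cst (t *: w)) (id + 0) by exact: is_diffD.
  have [dT1 dT2] := dT.
  have d3 := @differentiable_comp _ _ _ _ (fun z => z + t *: w) f y dT1 d2.
  have e3 := @diff_comp _ _ _ _ (fun z => z + t *: w) f y dT1 d2.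
  split; first exact: differentiableB.
  rewrite deriveB; [|exact: diff_derivable..].
  have dTv : 'd (fun z => z + t *: w) y v = v.
    by rewrite -[RHS]addr0; exact: (congr1 (fun h => h v) dT2).
  have -> : 'D_v (fun z => f (z + t *: w)) y = 'd f (y + t *: w) v.
    have h1 := deriveE v d3; rewrite e3 /= dTv in h1; exact: h1.
  by rewrite -deriveE.
have dd s : 0 <= s <= t -> differentiable F (x + s *: v).
  move=> hs; apply: (dF _ _ _).1; apply: df; last exact: bnd'.
  by have := bnd' _ _ hs t00; rewrite scale0r addr0.
have [s hs] := MVT_line t0 dd.
rewrite /F => E.
have hd u : 0 <= u <= t -> differentiable ('D_v f) (x + s *: v + u *: w).
  by move=> hu; apply: ddf; exact: bnd'.
have [u hu E2] := MVT_line t0 hd.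
exists (x + s *: v + u *: w); first exact: bnd.
rewrite E (dF _ _ _).2.
- by rewrite E2 expr2 mulrA.
- by apply: df; have := bnd' _ _ hs t00; rewrite scale0r addr0.
- by apply: df; exact: bnd'.
Qed.

Lemma open_ball_norm U x : open U -> U x -> exists2 r : R, 0 < r & forall y, `|y - x| < r -> U y.
Proof.
move=> oU Ux; have /nbhs_ballP [r r0 H] := open_nbhs_nbhs (conj oU Ux).
by exists r => // y yx; apply: H; rewrite -ball_normE /ball_ /= distrC.
Qed.

Lemma continuous_ball_norm f x (e : R) : {for x, continuous f} -> 0 < e ->
  exists2 d : R, 0 < d & forall y, `|y - x| < d -> `|f x - f y| < e.
Proof.
move=> cf e0.
have /cvgrPdist_lt/(_ _ e0)/nbhs_ballP [d d0 H] := cf.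
by exists d => // y yx; apply: H; rewrite -ball_normE /ball_ /= distrC.
Qed.

(** Schwarz: [second_difference] read in the two orders shows that the two mixed
    derivatives agree at two points arbitrarily close to x, and both are
    continuous at x. *)
Lemma partialC i j U f x : open U -> smooth_on U f -> U x ->
  partial i (partial j f) x = partial j (partial i f) x.
Proof.
move=> oU sf Ux.
have [r r0 rU] := open_ball_norm oU Ux.
have sj := smooth_on_partial j sf; have si := smooth_on_partial i sf.
have cij : {for x, continuous (partial i (partial j f))}.
  apply: differentiable_continuous; exact: smooth_on_differentiable (smooth_on_partial i sj) Ux.
have cji : {for x, continuous (partial j (partial i f))}.
  apply: differentiable_continuous; exact: smooth_on_differentiable (smooth_on_partial j si) Ux.
apply/eqP; rewrite -subr_eq0 -normr_le0; apply/ler_addgt0Pr => e e0; rewrite add0r.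
have e20 : 0 < e / 2 by rewrite divr_gt0.
have [d1 d10 H1] := continuous_ball_norm cij e20.
have [d2 d20 H2] := continuous_ball_norm cji e20.
pose v : 'rV[R]_n := delta_mx 0 i; pose w : 'rV[R]_n := delta_mx 0 j.
pose N := `|v| + `|w| + 1.
have N0 : 0 < N by rewrite ltr_wpDl// addr_ge0.
pose m := Num.min r (Num.min d1 d2).
have m0 : 0 < m by rewrite !lt_min r0 d10.
(* t is small enough for both intermediate points to lie in the three balls. *)
pose t := m / (2 * N).
have t0 : 0 < t by rewrite divr_gt0// mulr_gt0.
have tm : t * (`|v| + `|w|) < m.
  apply: (@le_lt_trans _ _ (t * N)); first by rewrite ler_wpM2l ?ltW// ltrDl.
  have N0' : N != 0 by rewrite gt_eqF.
  have -> : t * N = m / 2 by rewrite /t; field.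
  by rewrite ltr_pdivrMr// mulr_natr mulr2n ltrDl.
have [mr m1 m2] : [/\ m <= r, m <= d1 & m <= d2].
  by rewrite !ge_min !lexx ?orbT.
have dU y : `|y - x| < r -> differentiable f y /\ differentiable ('D_v f) y /\ differentiable ('D_w f) y.
  move=> /rU Uy; split; first exact: smooth_on_differentiable Uy.
  split; [exact: smooth_on_differentiable si Uy|exact: smooth_on_differentiable sj Uy].
have [||y hy E1] := @second_difference f x v w t r t0 (lt_le_trans tm mr).
  by move=> y /dU[].
  by move=> y /dU[_ []].
have [|||z hz E2] := @second_difference f x w v t r t0.
  by rewrite addrC; exact: (lt_le_trans tm mr).
  by move=> z /dU[].
  by move=> z /dU[_ []].
have E : partial j (partial i f) y = partial i (partial j f) z.
  have t20 : t ^+ 2 != 0 by rewrite expf_neq0// gt_eqF.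
  apply: (mulfI t20); rewrite -[LHS]E1 -[RHS]E2.
  by rewrite -!addrA [t *: v + _]addrC; ring.
have H1z : `|partial i (partial j f) x - partial i (partial j f) z| < e / 2.
  by apply: H1; apply: (le_lt_trans hz); rewrite addrC; exact: (lt_le_trans tm m1).
have H2y : `|partial j (partial i f) x - partial j (partial i f) y| < e / 2.
  by apply: H2; apply: (le_lt_trans hy); exact: (lt_le_trans tm m2).
move: E H1z H2y.
move: (partial i (partial j f) x) (partial j (partial i f) x)
  (partial i (partial j f) z) (partial j (partial i f) y) => a b c d E ac bd.
have -> : a - b = (a - c) - (b - d) by rewrite E; ring.
by rewrite (le_trans (ler_normB _ _))// [e]splitr lerD// ltW.
Qed.
End Lines.

(** * Linear differential equations on the unit interval *)

Section Geometric.
Variable R : realType.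

Lemma geometric_zero (x C : R) : (forall k, `|x| <= C / 2 ^+ k) -> x = 0.
Proof.
move=> H; apply/eqP; rewrite -normr_le0; apply/ler_addgt0Pr => e e0; rewrite add0r.
have C0 : 0 <= C by have := H 0%N; rewrite expr0 divr1; apply: le_trans.
have Ce0 : 0 <= C / e by rewrite divr_ge0// ltW.
set k := Num.bound (C / e).
have hk : C / e < 2 ^+ k.
  by rewrite (lt_le_trans (archi_boundP Ce0))// -natrX ler_nat ltnW// ltn_expl.
rewrite (le_trans (H k))// ler_pdivrMr ?exprn_gt0// mulrC.
by rewrite -ler_pdivrMr// ltW.
Qed.

(** The bound on the increments makes u k + 2 K / 2^k nonincreasing and
    u k - 2 K / 2^k nondecreasing, so that the infimum of the former is the limit. *)
Lemma geometric_limit (u : nat -> R) (K : R) :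
  (forall k, `|u k.+1 - u k| <= K / 2 ^+ k) ->
  exists l, forall k, `|l - u k| <= 2 * K / 2 ^+ k.
Proof.
move=> H; pose e k := 2 * K / 2 ^+ k.
have eS k : e k = K / 2 ^+ k + e k.+1.
  have h : 2 ^+ k != 0 :> R by rewrite expf_neq0.
  by rewrite /e exprS; field.
have up k m : u (k + m)%N + e (k + m)%N <= u k + e k.
  elim: m => [|m IH]; first by rewrite addn0.
  rewrite addnS (le_trans _ IH)// (eS (k + m)%N) addrA lerD2r -lerBlDl.
  by rewrite (le_trans (ler_norm _)).
have dn k m : u k - e k <= u (k + m)%N - e (k + m)%N.
  elim: m => [|m IH]; first by rewrite addn0.
  rewrite addnS (le_trans IH)// (eS (k + m)%N) opprD addrA lerD2r lerBlDr -lerBlDl.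
  by rewrite (le_trans (ler_norm _))// distrC.
have e0 k : 0 <= e k.
  by rewrite /e -mulrA mulr_ge0// (le_trans _ (H k)).
have ud k m : u k - e k <= u m + e m.
  apply: (le_trans (dn k m)); apply: (le_trans _ (up m k)).
  by rewrite addnC lerD2l (le_trans _ (e0 _))// oppr_le0.
pose E := [set x | exists k, x = u k + e k].
have lE : has_lbound E by exists (u 0%N - e 0%N) => _ [k ->].
exists (inf E) => k; rewrite ler_distl; apply/andP; split.
  apply: lb_le_inf; first by exists (u 0%N + e 0%N), 0%N.
  by move=> _ [m ->].
by apply: ge_inf => //; exists k.
Qed.

Lemma continuous_geometric (f : R -> R) (u : nat -> R -> R) (C : R) :
  (forall k, continuous (u k)) -> (forall k t, `|f t - u k t| <= C / 2 ^+ k) ->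
  continuous f.
Proof.
move=> cu H t; apply/cvgrPdist_le => e e0.
have C0 : 0 <= C by have := H 0%N 0; rewrite expr0 divr1; apply: le_trans.
have Ce0 : 0 <= C / (e / 3) by rewrite divr_ge0// divr_ge0// ltW.
set k := Num.bound (C / (e / 3)).
have hk : C / 2 ^+ k <= e / 3.
  have hk : C / (e / 3) < 2 ^+ k.
    by rewrite (lt_le_trans (archi_boundP Ce0))// -natrX ler_nat ltnW// ltn_expl.
  by rewrite ler_pdivrMr ?exprn_gt0// mulrC -ler_pdivrMr ?divr_gt0// ltW.
have e30 : 0 < e / 3 by rewrite divr_gt0.
have /cvgrPdist_le/(_ _ e30) hc := cu k t.
near=> s.
have -> : f t - f s = (f t - u k t) + (u k t - u k s) - (f s - u k s) by ring.
have -> : e = e / 3 + e / 3 + e / 3 by field.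
rewrite (le_trans (ler_normB _ _))// lerD//; last exact: le_trans (H _ _) hk.
rewrite (le_trans (ler_normD _ _))// lerD//; first exact: le_trans (H _ _) hk.
by near: s.
Unshelve. all: by end_near. Qed.

Lemma primitive_exists (f : R -> R) : continuous f ->
  exists F : R -> R, F 0 = 0 /\ forall t : R, -1 < t < 2 -> is_derive t (1:R) F (f t).
Proof.
move=> cf.
pose G x := (\int[lebesgue_measure]_(t in `[(-1:R), x]) f t)%R.
exists (fun x => G x - G 0); split; first by rewrite subrr.
move=> t /andP[t1 t2].
have [] := @continuous_FTC1_closed R f (-1) t 2 t2 _ t1 (cf t).
  apply: continuous_compact_integrable; first exact: segment_compact.
  exact: continuous_subspaceT.
rewrite -/G => dG; rewrite derive1E => eG.
rewrite -[f t]subr0; apply: is_deriveB.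
by rewrite -eG; exact: derivableP.
Qed.

Lemma unit_interval_le (D : R -> R) (D' : R -> R) (t M : R) :
  (forall s : R, 0 <= s <= 1 -> is_derive s (1:R) D (D' s)) -> D 0 = 0 ->
  (forall s : R, 0 <= s <= 1 -> `|D' s| <= M) -> 0 <= t <= 1 -> `|D t| <= M.
Proof.
move=> dD D0 HM /andP[t0 t1].
have [||c] := @MVT_segment R D D' 0 t t0.
- move=> s; rewrite in_itv /= => /andP[s0 st]; apply: dD.
  by rewrite (ltW s0) (le_trans (ltW st)).
- apply: derivable_within_continuous => s; rewrite in_itv /= => /andP[s0 st].
  by apply: ex_derive; apply: dD; rewrite s0 (le_trans st).
rewrite in_itv /= => /andP[c0 ct]; rewrite D0 !subr0 => ->.
have hc : `|D' c| <= M by apply: HM; rewrite c0 (le_trans ct).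
rewrite normrM (ger0_norm t0) (le_trans _ hc)// ler_piMr//.
Qed.

(** Gronwall's inequality on [0, 1] for a coefficient of norm at most 1/2, where it
    needs no exponential: if M is the maximum of the |D a|, the mean value theorem
    gives M <= M / 2 + e. *)
Lemma small_gronwall (I : finType) (D D' : I -> R -> R) (e : R) : 0 <= e ->
  (forall a (s : R), 0 <= s <= 1 -> is_derive s (1:R) (D a) (D' a s)) ->
  (forall a, D a 0 = 0) ->
  (forall a (s M : R), 0 <= s <= 1 -> (forall b, `|D b s| <= M) -> `|D' a s| <= M / 2 + e) ->
  forall a (t : R), 0 <= t <= 1 -> `|D a t| <= 2 * e.
Proof.
move=> e0 dD D0 HM.
have cD a : {within `[0, 1], continuous (fun t => `|D a t|)}.
  have c1 : {within `[0, 1], continuous (D a)}.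
    apply: derivable_within_continuous => s; rewrite in_itv /= => hs.
    by apply: ex_derive; exact: dD hs.
  by move=> x; apply: continuous_comp; [exact: c1|exact: norm_continuous].
have /choice [c hc] : forall a, exists c, forall t, 0 <= t <= 1 -> `|D a t| <= `|D a c| /\ 0 <= c <= 1.
  move=> a; have [c c01 cM] := EVT_max ler01 (cD a).
  by exists c => t t01; split=> //; exact: cM.
have u01 : 0 <= (0:R) <= 1 by rewrite lexx ler01.
pose M : R := \big[Num.max/0]_a `|D a (c a)|.
have DM a t : 0 <= t <= 1 -> `|D a t| <= M.
  by move=> t01; apply: le_trans (hc a t t01).1 _; exact: (le_bigmax 0 (fun a => `|D a (c a)|)).
have M0 : 0 <= M.
  by rewrite /M; elim/big_ind : _ => // x y x0 y0; rewrite le_max x0.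
have D2 a t : 0 <= t <= 1 -> `|D a t| <= M / 2 + e.
  move=> t01; apply: (@unit_interval_le (D a) (D' a)) => //.
  by move=> s s01; apply: HM => // b; exact: DM.
have : M <= M / 2 + e.
  apply: bigmax_le => [|a _]; first by rewrite addr_ge0// divr_ge0.
  exact: D2 (hc a 0 u01).2.
move=> MM a t t01; rewrite (le_trans (DM a t t01))//; lra.
Qed.

(** Retraction of the line on [0, 1], by which a function defined on this interval
    is extended to a continuous function on the line. *)
Definition clamp (t : R) := Num.max 0 (Num.min 1 t).

Lemma clamp_itv t : 0 <= clamp t <= 1.
Proof. by rewrite /clamp le_max lexx ge_max ler01 /= ge_min lexx. Qed.

Lemma clamp_id t : 0 <= t <= 1 -> clamp t = t.
Proof. by move=> /andP[t0 t1]; rewrite /clamp (min_idPr t1) (max_idPr t0). Qed.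

Lemma clamp_continuous : continuous clamp.
Proof.
move=> t; apply: continuous_max; first exact: cst_continuous.
by apply: continuous_min; [exact: cst_continuous|exact: cvg_id].
Qed.

Lemma continuous_bigsum (T : topologicalType) (I : Type) (r : seq I) (F : I -> T -> R) :
  (forall a, continuous (F a)) -> continuous (fun t => \sum_(a <- r) F a t).
Proof.
move=> cF; elim: r => [|a r IH].
  by under eq_fun do rewrite big_nil; exact: cst_continuous.
under eq_fun do rewrite big_cons.
by move=> t; apply: continuousD; [exact: cF|exact: IH].
Qed.

Lemma primitive_diff_le (f g F G : R -> R) (M t : R) :
  F 0 = 0 -> G 0 = 0 ->
  (forall t : R, -1 < t < 2 -> is_derive t (1:R) F (f t)) ->
  (forall t : R, -1 < t < 2 -> is_derive t (1:R) G (g t)) ->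
  (forall s : R, 0 <= s <= 1 -> `|f s - g s| <= M) -> 0 <= t <= 1 ->
  `|F t - G t| <= M.
Proof.
move=> F0 G0 dF dG HM t01.
apply: (@unit_interval_le (fun s => F s - G s) (fun s => f s - g s)) => //.
  move=> s /andP[s0 s1]; have s12 : -1 < s < 2 by apply/andP; split; lra.
  by apply: is_deriveB; [exact: dF|exact: dG].
by rewrite F0 G0 subrr.
Qed.

(** Picard iteration.  The rows of the coefficient have l^1-norm at most 1/2, so
    each step halves the sup norm of the increments and the iterates converge on
    the whole interval; the limit is the fixed point of the integral equation. *)
Lemma linear_ODE (I : finType) (a : I -> I -> R -> R) (y0 : I -> R) :
  (forall i j, continuous (a i j)) ->
  (forall i (t : R), \sum_j `|a i j t| <= 1 / 2) ->
  exists y : I -> R -> R, (forall i, y i 0 = y0 i) /\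
    forall i (t : R), 0 <= t <= 1 -> is_derive t (1:R) (y i) (\sum_j a i j t * y j t).
Proof.
move=> ca sa.
(* P is a primitive vanishing at 0, chosen for all continuous functions. *)
have /choice [P hP] : forall f : R -> R, exists F : R -> R, continuous f ->
    F 0 = 0 /\ forall t : R, -1 < t < 2 -> is_derive t (1:R) F (f t).
  move=> f; have [cf|ncf] := pselect (continuous f); last by exists f.
  by have [F hF] := primitive_exists cf; exists F.
pose rhs (Z : I -> R -> R) i s := \sum_j a i j s * Z j s.
pose Z := fix Z k := if k is k'.+1 then (fun i t => y0 i + P (rhs (Z k') i) (clamp t)) else (fun i _ => y0 i).
have crhs W i : (forall j, continuous (W j)) -> continuous (rhs W i).
  move=> cW; apply: continuous_bigsum => j t.
  by apply: continuousM; [exact: ca|exact: cW].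
have c01 t : -1 < clamp t < 2.
  by have /andP[h1 h2] := clamp_itv t; apply/andP; split; lra.
have cP f : continuous f -> continuous (fun t => P f (clamp t)).
  move=> /hP[_ dP] t; apply: continuous_comp; first exact: clamp_continuous.
  apply: differentiable_continuous; apply/derivable1_diffP.
  by have [] := dP _ (c01 t).
have cZ k i : continuous (Z k i).
  elim: k i => [|k IH] i; first exact: cst_continuous.
  move=> t; apply: continuousD; first exact: cst_continuous.
  by apply: cP; exact: crhs.
pose K : R := \big[Num.max/0]_i `|y0 i|.
have hK i : `|y0 i| <= K by exact: (le_bigmax 0 (fun i => `|y0 i|)).
have rhs_le W W' i (s M : R) : (forall j, `|W j s - W' j s| <= M) ->
    `|rhs W i s - rhs W' i s| <= M / 2.
  move=> hM; rewrite /rhs -sumrB (le_trans (ler_norm_sum _ _ _))//.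
  have M0 : 0 <= M by exact: le_trans (normr_ge0 _) (hM i).
  apply: (@le_trans _ _ (\sum_j `|a i j s| * M)).
    by apply: ler_sum => j _; rewrite -mulrBr normrM ler_wpM2l.
  by rewrite -mulr_suml mulrC ler_wpM2l// (le_trans (sa _ _))// div1r.
have step k i t : `|Z k.+1 i t - Z k i t| <= K / 2 ^+ k.
  elim: k i t => [|k IH] i t.
    rewrite /= addrC addKr expr0 divr1.
    have [P0 dP] := hP _ (crhs _ i (fun j => @cst_continuous _ _ (y0 j))).
    apply: (@le_trans _ _ (K / 2)); last first.
      have := le_trans (normr_ge0 _) (hK i); lra.
    rewrite -[P _ _]subr0; apply: (@primitive_diff_le _ (cst 0) _ (cst 0) _ _ P0) => //.
      move=> s s12; have r0 : rhs (fun _ _ => 0) i s = 0.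
        by rewrite /rhs big1// => j _; rewrite mulr0.
      by rewrite [cst 0 s](esym r0); apply: rhs_le => j; rewrite subr0.
    exact: clamp_itv.
  rewrite [Z k.+2 i t]/= [Z k.+1 i t]/= opprD addrACA subrr add0r.
  have [P0 dP] := hP _ (crhs _ i (cZ k)).
  have [P0' dP'] := hP _ (crhs _ i (cZ k.+1)).
  apply: (primitive_diff_le P0' P0 dP' dP); last exact: clamp_itv.
  move=> s _; have -> : K / 2 ^+ k.+1 = K / 2 ^+ k / 2 by rewrite exprS invfM mulrCA mulrC.
  exact: rhs_le.
have /choice [Y hY] : forall i, exists Yi, forall t k, `|Yi t - Z k i t| <= 2 * K / 2 ^+ k.
  move=> i; have /choice [Yi hYi] : forall t, exists l, forall k, `|l - Z k i t| <= 2 * K / 2 ^+ k.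
    by move=> t; exact: geometric_limit (fun k => step k i t).
  by exists Yi.
have cY i : continuous (Y i).
  by apply: continuous_geometric (fun k t => hY i t k) => k; exact: cZ.
(* Y solves the integral equation on [0, 1] only, because of the clamping;
   the solution y has the right derivative at the end points also. *)
pose y i t := y0 i + P (rhs Y i) t.
have yY i t : 0 <= t <= 1 -> y i t = Y i t.
  move=> t01; apply/eqP; rewrite -subr_eq0; apply/eqP.
  apply: (@geometric_zero _ (2 * K)) => k.
  have -> : y i t - Y i t = (P (rhs Y i) t - P (rhs (Z k) i) t) - (Y i t - Z k.+1 i t).
    by rewrite /y [Z k.+1 i t]/= (clamp_id t01); ring.
  have -> : 2 * K / 2 ^+ k = 2 * K / 2 ^+ k / 2 + 2 * K / 2 ^+ k.+1.
    by have h : 2 ^+ k != 0 :> R; [rewrite expf_neq0|rewrite exprS; field].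
  rewrite (le_trans (ler_normB _ _))// lerD//.
  have [P0 dP] := hP _ (crhs _ i (cZ k)).
  have [P0' dP'] := hP _ (crhs _ i cY).
  apply: (primitive_diff_le P0' P0 dP' dP) => //.
  by move=> s _; apply: rhs_le.
exists y; split=> [i|i t t01].
  by rewrite /y (hP _ (crhs _ i cY)).1 addr0.
have -> : \sum_j a i j t * y j t = 0 + rhs Y i t.
  by rewrite add0r; apply: eq_bigr => j _; rewrite yY.
apply: is_deriveD; apply: (hP _ (crhs _ i cY)).2.
by move: t01 => /andP[? ?]; apply/andP; split; lra.
Qed.

End Geometric.

Section RealDerive.
Variable R : realType.

Lemma is_derive_mul (f g : R -> R) (df dg t : R) :
  is_derive t (1:R) f df -> is_derive t (1:R) g dg ->
  is_derive t (1:R) (fun s => f s * g s) (df * g t + f t * dg).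
Proof.
move=> hf hg.
have h : is_derive t (1:R) (f * g) (f t *: dg + g t *: df) by exact: is_deriveM.
by rewrite /GRing.scale /= addrC [g t * _]mulrC in h.
Qed.

Lemma is_derive_bigsum (I : Type) (r : seq I) (F : I -> R -> R) (dF : I -> R) (t : R) :
  (forall a, is_derive t (1:R) (F a) (dF a)) ->
  is_derive t (1:R) (fun s => \sum_(a <- r) F a s) (\sum_(a <- r) dF a).
Proof.
move=> dFa; elim: r => [|a r IH].
  by rewrite big_nil; under eq_fun do rewrite big_nil; exact: is_derive_cst.
by rewrite big_cons; under eq_fun do rewrite big_cons; apply: is_deriveD.
Qed.
End RealDerive.

(** * Linear total differential systems *)

Section Taylor.
Variables (R : realType) (n : nat).
Implicit Types (f : 'rV[R]_n -> R) (x y u v : 'rV[R]_n).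

Lemma coord_le_norm v i : `|v 0 i| <= `|v|.
Proof.
rewrite [leRHS]/Num.norm /= mx_normrE.
exact: (le_bigmax 0 (fun ij : 'I_1 * 'I_n => `|v ij.1 ij.2|) (0, i)).
Qed.

Lemma derive_rowE f x v : differentiable f x ->
  'D_v f x = \sum_j v 0 j * partial j f x.
Proof. by move=> df; rewrite deriveE// diff_row_sum. Qed.

Lemma ball_convex (x0 y u : 'rV[R]_n) (r s : R) : `|y - x0| < r -> `|y + u - x0| < r ->
  0 <= s <= 1 -> `|y + s *: u - x0| < r.
Proof.
move=> h1 h2 /andP[s0 s1].
have -> : y + s *: u - x0 = (1 - s) *: (y - x0) + s *: (y + u - x0).
  rewrite scalerBl scale1r [y + u - x0]addrAC [s *: (_ + u)]scalerDr addrA subrK.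
  by rewrite addrAC.
rewrite (le_lt_trans (ler_normD _ _))// !normrZ (ger0_norm s0) ger0_norm ?subr_ge0//.
have [->|s0'] := eqVneq s 0; first by rewrite subr0 mul1r mul0r addr0.
apply: (@lt_le_trans _ _ ((1 - s) * r + s * r)); last by rewrite -mulrDl subrK mul1r.
apply: ler_ltD; first by apply: ler_wpM2l; rewrite ?subr_ge0// ltW.
by rewrite ltr_pM2l// lt_neqAle eq_sym s0'.
Qed.

Variables (x0 : 'rV[R]_n) (r C : R).

(** Lipschitz bound from a bound C on the partial derivatives; n appears because
    the norm is the sup norm. *)
Lemma taylor1 f y u :
  (forall z, `|z - x0| < r -> differentiable f z) ->
  (forall z j, `|z - x0| < r -> `|partial j f z| <= C) ->
  `|y - x0| < r -> `|y + u - x0| < r ->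
  `|f (y + u) - f y| <= n%:R * C * `|u|.
Proof.
move=> df Cf hy hyu.
have [s s01|s s01] := @MVT_line R n f y u 1 ltr01.
  by apply: df; apply: ball_convex.
have hz := ball_convex hy hyu s01.
rewrite scale1r mul1r => ->; rewrite derive_rowE; last exact: df.
rewrite (le_trans (ler_norm_sum _ _ _))//.
apply: (@le_trans _ _ (\sum_(j < n) `|u| * C)); last first.
  by rewrite sumr_const card_ord -[X in X <= _]mulr_natl [`|u| * C]mulrC mulrA.
apply: ler_sum => j _; rewrite normrM ler_pM//; [exact: coord_le_norm|exact: Cf].
Qed.

Lemma taylor2 f y u : 0 <= C ->
  (forall z, `|z - x0| < r -> differentiable f z) ->
  (forall z j, `|z - x0| < r -> differentiable (partial j f) z) ->
  (forall z i j, `|z - x0| < r -> `|partial i (partial j f) z| <= C) ->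
  `|y - x0| < r -> `|y + u - x0| < r ->
  `|f (y + u) - f y - \sum_j u 0 j * partial j f y| <= n%:R * (n%:R * C) * `|u| ^+ 2.
Proof.
move=> C0 df ddf Cf hy hyu.
have [s s01|s s01] := @MVT_line R n f y u 1 ltr01.
  by apply: df; apply: ball_convex.
have hz := ball_convex hy hyu s01.
rewrite scale1r mul1r => ->; rewrite derive_rowE; last exact: df.
rewrite -sumrB (le_trans (ler_norm_sum _ _ _))//.
apply: (@le_trans _ _ (\sum_(j < n) `|u| * (n%:R * C * `|u|))); last first.
  by rewrite sumr_const card_ord -[X in X <= _]mulr_natl expr2 [`|u| * (_ * _)]mulrC -!mulrA.
apply: ler_sum => j _; rewrite -mulrBr normrM ler_pM//; first exact: coord_le_norm.
apply: (@le_trans _ _ (n%:R * C * `|s *: u|)).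
  apply: taylor1 => //; [by move=> z /ddf|by move=> z i hz'; exact: Cf].
rewrite ler_wpM2l ?mulr_ge0//.
by case/andP: s01 => s0 s1; rewrite normrZ ger0_norm// ler_piMl.
Qed.

End Taylor.

Section UniformO.
Variables (R : realType) (n : nat) (d : R).
Hypothesis d0 : 0 <= d.
Implicit Types (e : R -> 'rV[R]_n -> R).

(** O(|k|^m) as k tends to 0, uniformly in the time t in [0, 1]. *)
Definition unifO (m : nat) e := exists2 c : R, 0 <= c &
  forall (t : R) k, 0 <= t <= 1 -> `|k| < d -> `|e t k| <= c * `|k| ^+ m.

Lemma unifOD m e1 e2 : unifO m e1 -> unifO m e2 -> unifO m (fun t k => e1 t k + e2 t k).
Proof.
move=> [c c0 hc] [c' c'0 hc']; exists (c + c'); first exact: addr_ge0.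
move=> t k t01 kd; rewrite (le_trans (ler_normD _ _))// mulrDl lerD//; [exact: hc|exact: hc'].
Qed.

Lemma unifOM m1 m2 e1 e2 : unifO m1 e1 -> unifO m2 e2 ->
  unifO (m1 + m2) (fun t k => e1 t k * e2 t k).
Proof.
move=> [c c0 hc] [c' c'0 hc']; exists (c * c'); first exact: mulr_ge0.
move=> t k t01 kd; rewrite normrM exprD mulrACA ler_pM//; [exact: hc|exact: hc'].
Qed.

Lemma unifO_sum m (I : Type) (r : seq I) (F : I -> R -> 'rV[R]_n -> R) :
  (forall a, unifO m (F a)) -> unifO m (fun t k => \sum_(a <- r) F a t k).
Proof.
move=> hF; elim: r => [|a r IH].
  by exists 0 => // t k _ _; rewrite big_nil normr0 mul0r.
have [c c0 hc] := unifOD (hF a) IH; exists c => // t k t01 kd.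
by rewrite big_cons; exact: hc.
Qed.

Lemma unifO_bounded (f : R -> 'rV[R]_n -> R) (c : R) :
  (forall (t : R) k, 0 <= t <= 1 -> `|k| < d -> `|f t k| <= c) -> unifO 0 f.
Proof.
move=> hf; exists `|c| => // t k t01 kd.
by rewrite expr0 mulr1 (le_trans (hf _ _ t01 kd))// ler_norm.
Qed.

Lemma unifO_coord i : unifO 1 (fun _ k => k 0 i).
Proof. by exists 1 => // t k _ _; rewrite expr1 mul1r coord_le_norm. Qed.

Lemma unifO_time : unifO 0 (fun t _ => t).
Proof. by apply: (@unifO_bounded _ 1) => t k /andP[t0 t1] _; rewrite ger0_norm. Qed.

Lemma unifOS m e : unifO m.+1 e -> unifO m e.
Proof.
move=> [c c0 hc]; exists (c * d); first exact: mulr_ge0.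
move=> t k t01 kd; rewrite (le_trans (hc _ _ t01 kd))// exprS mulrA ler_wpM2r ?exprn_ge0//.
by rewrite ler_wpM2l// ltW.
Qed.
End UniformO.

Lemma row_norm_near0 (R : realType) (n : nat) (e : R) : 0 < e ->
  \forall k \near (0 : 'rV[R]_n), `|k| < e.
Proof.
move=> e0; apply/nbhs_ballP; exists e => // k.
by rewrite -ball_normE /ball_ /= sub0r normrN.
Qed.

Lemma differentiable_of_quadratic (R : realType) (n : nat) (f : 'rV[R]_n -> R) x
    (b : 'I_n -> R) (c d : R) : 0 < d -> 0 <= c ->
  (forall k : 'rV[R]_n, `|k| < d ->
     `|f (x + k) - f x - \sum_i k 0 i * b i| <= c * `|k| ^+ 2) ->
  differentiable f x /\ forall i, partial i f x = b i.
Proof.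
move=> d0 c0 H.
pose h (k : 'rV[R]_n) : R := \sum_i k 0 i * b i.
have lh : linear h.
  move=> a u v; rewrite /h /GRing.scale /= mulr_sumr -big_split /=.
  by apply: eq_bigr => i _; rewrite !mxE mulrDl mulrA.
pose hM := GRing.isLinear.Build _ _ _ _ _ lh.
pose hL : {linear 'rV[R]_n -> R} := HB.pack h hM.
have ch : continuous hL.
  move=> y; apply: (@differentiable_continuous _ _ _ y (h : 'rV[R]_n -> R)).
  by apply: differentiable_bigsum => i; apply: differentiableM => //; exact: differentiable_coord.
have [df ef] : is_diff x f hL.
  apply: is_diff_of_eps => // e e0.
  near=> k.
  have kd : `|k| < d.
    by near: k; exact: row_norm_near0.
  have -> : k + x = x + k by exact: addrC.
  apply: (le_trans (H _ kd)); rewrite expr2 mulrA ler_wpM2r//.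
  have kc : `|k| < e / (c + 1).
    by near: k; apply: row_norm_near0; rewrite divr_gt0// ltr_wpDl.
  have c1 : 0 < c + 1 by rewrite ltr_wpDl.
  move: kc; rewrite ltr_pdivlMr// mulrDr mulr1 => kc.
  by rewrite mulrC ltW// (le_lt_trans _ kc)// lerDl.
split=> // i; rewrite /partial deriveE// ef /= /h (bigD1 i)//= big1 ?addr0.
  by rewrite mxE !eqxx mul1r.
by move=> j ji; rewrite mxE eqxx (negbTE ji) mul0r.
Unshelve. all: by end_near. Qed.

Lemma locally_bounded (R : realType) (n : nat) (J : finType)
    (F : J -> 'rV[R]_n -> R) x0 :
  (forall j, {for x0, continuous (F j)}) ->
  exists d C : R, [/\ 0 < d, 0 <= C & forall x j, `|x - x0| < d -> `|F j x| <= C].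
Proof.
move=> cF.
have /choice [d hd] : forall j, exists d : R, 0 < d /\ forall y, `|y - x0| < d -> `|F j x0 - F j y| < 1.
  by move=> j; have [d d0 H] := continuous_ball_norm (cF j) ltr01; exists d.
exists (\big[Num.min/1]_j d j), (\sum_j (`|F j x0| + 1)); split.
- by elim/big_ind : _ => // [x y x0' y0|j _]; [rewrite lt_min x0'|exact: (hd j).1].
- by apply: sumr_ge0 => j _; rewrite addr_ge0.
move=> x j xd.
have xdj : `|x - x0| < d j by apply: lt_le_trans xd _; exact: bigmin_le_cond.
apply: (@le_trans _ _ (`|F j x0| + 1)); last first.
  by rewrite (bigD1 j)//= lerDl sumr_ge0// => i _; rewrite addr_ge0.
have -> : F j x = F j x0 - (F j x0 - F j x) by ring.
by rewrite (le_trans (ler_normB _ _))// lerD2l ltW// (hd j).2.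
Qed.

(** On a ray issued from x0 the unknowns satisfy a linear homogeneous ordinary
    differential equation, whose coefficient has norm at most 1/2 if the ray is
    short; [small_gronwall] with e = 0 concludes. *)
Lemma linear_system_unique (R : realType) (n : nat) (J : finType)
    (f : J -> 'rV[R]_n -> R) (m : 'I_n -> J -> J -> 'rV[R]_n -> R) x0 (r0 : R) :
  0 < r0 ->
  (forall i a b, {for x0, continuous (m i a b)}) ->
  (forall x a, `|x - x0| < r0 -> differentiable (f a) x) ->
  (forall x i a, `|x - x0| < r0 -> partial i (f a) x = \sum_b m i a b x * f b x) ->
  (forall a, f a x0 = 0) ->
  exists2 r : R, 0 < r & forall x a, `|x - x0| < r -> f a x = 0.
Proof.
move=> r00 cm df pf f0.
have [d [C [d0 C0 hC]]] := @locally_bounded R n ('I_n * J * J)%type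
  (fun q => m q.1.1 q.1.2 q.2) x0 (fun q => cm _ _ _).
pose L : R := n%:R * #|J|%:R * C.
have L0 : 0 <= L by rewrite !mulr_ge0.
pose r := Num.min (Num.min r0 d) (2 * (L + 1))^-1.
have r_gt0 : 0 < r.
  by rewrite /r !lt_min r00 d0 /= invr_gt0 mulr_gt0// ltr_wpDl.
exists r => // x a; rewrite /r !lt_min => /andP[/andP[xr0 xd] xL].
pose v := x - x0.
have hz s : 0 <= s <= 1 -> `|x0 + s *: v - x0| <= `|v|.
  move=> /andP[s0 s1]; rewrite addrC addKr normrZ ger0_norm//.
  by rewrite ler_piMl.
have xE : x = x0 + 1 *: v by rewrite scale1r addrC subrK.
have h2 : 2 * (0:R) = 0 by rewrite mulr0.
suff : `|f a (x0 + 1 *: v)| <= 2 * 0 by rewrite h2 normr_le0 -xE => /eqP.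
apply: (@small_gronwall R J (fun a t => f a (x0 + t *: v))
  (fun a t => \sum_i v 0 i * partial i (f a) (x0 + t *: v))) => //.
- move=> b s s01; rewrite -derive_rowE; last by apply: df; exact: le_lt_trans (hz s s01) xr0.
  by apply: is_derive_line; apply: df; exact: le_lt_trans (hz s s01) xr0.
- by move=> b; rewrite scale0r addr0.
- move=> b s M s01 hM; rewrite addr0.
  have M0 : 0 <= M by exact: le_trans (normr_ge0 _) (hM b).
  apply: (@le_trans _ _ (\sum_(i < n) `|v| * (\sum_(c : J) C * M))).
    rewrite (le_trans (ler_norm_sum _ _ _))//; apply: ler_sum => i _.
    rewrite normrM ler_pM//; first exact: coord_le_norm.
    rewrite pf; last exact: le_lt_trans (hz s s01) xr0.
    rewrite (le_trans (ler_norm_sum _ _ _))//; apply: ler_sum => c _.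
    rewrite normrM ler_pM//.
    by apply: (hC _ (i, b, c)); exact: le_lt_trans (hz s s01) xd.
  rewrite !sumr_const card_ord -[X in X <= _]mulr_natl -[(C * M) *+ _]mulr_natl.
  have -> : n%:R * (`|v| * (#|J|%:R * (C * M))) = (`|v| * L) * M by rewrite /L; ring.
  rewrite mulrC ler_wpM2l//.
  have xL' : `|v| <= (2 * (L + 1))^-1 by exact: ltW.
  apply: (@le_trans _ _ ((2 * (L + 1))^-1 * L)); first by rewrite ler_wpM2r.
  by rewrite invfM -mulrA ler_piMr// mulrC ler_pdivrMr ?mul1r ?lerDl// ltr_wpDl.
- by rewrite lexx ler01.
Qed.

Section FlatSystem.
Variables (R : realType) (n : nat) (I : finType).
Variables (U : set 'rV[R]_n) (x0 : 'rV[R]_n) (B : 'I_n -> I -> I -> 'rV[R]_n -> R).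
Hypotheses (oU : open U) (Ux0 : U x0).
Hypothesis sB : forall i a b, smooth_on U (B i a b).
Hypothesis flatB : forall x i j a b, U x ->
  partial j (B i a b) x + \sum_c B i a c x * B j c b x =
  partial i (B j a b) x + \sum_c B j a c x * B i c b x.

(** The matrix of the system at z, contracted with the direction v. *)
Local Notation A v z a b := (\sum_i (v : 'rV[R]_n) 0 i * B i a b z).

Section Increment.
Variables (r C : R).
Hypothesis C0 : 0 <= C.
Hypothesis rU : forall x, `|x - x0| < r -> U x.
Hypothesis BC : forall x i a b, `|x - x0| < r -> `|B i a b x| <= C.
Hypothesis dBC : forall x i j a b, `|x - x0| < r -> `|partial j (B i a b) x| <= C.
Hypothesis ddBC : forall x i j k a b, `|x - x0| < r ->
  `|partial k (partial j (B i a b)) x| <= C.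
Hypothesis rC : #|I|%:R * (n%:R * r * C) <= 1 / 2.

Let dB x i a b : `|x - x0| < r -> differentiable (B i a b) x.
Proof. by move=> /rU; exact: smooth_on_differentiable. Qed.

Let ddB x i j a b : `|x - x0| < r -> differentiable (partial j (B i a b)) x.
Proof. by move=> /rU; apply: smooth_on_differentiable; exact: smooth_on_partial. Qed.

Lemma segment_in_ball v (t : R) : 0 <= t <= 1 -> `|v| < r -> `|x0 + t *: v - x0| < r.
Proof.
move=> /andP[t0 t1] vr; rewrite addrC addKr normrZ ger0_norm//.
by rewrite (le_lt_trans _ vr)// ler_piMl.
Qed.

Lemma coefficient_small v z a : `|v| < r -> `|z - x0| < r -> \sum_b `|A v z a b| <= 1 / 2.
Proof.
move=> vr zr; apply: le_trans rC.
apply: (@le_trans _ _ (\sum_(b : I) n%:R * r * C)); last first.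
  by rewrite sumr_const -[X in X <= _]mulr_natl.
apply: ler_sum => b _; rewrite (le_trans (ler_norm_sum _ _ _))//.
apply: (@le_trans _ _ (\sum_(i < n) r * C)); last first.
  by rewrite sumr_const card_ord -[X in X <= _]mulr_natl mulrA.
apply: ler_sum => i _; rewrite normrM ler_pM//; last exact: BC.
by rewrite (le_trans (coord_le_norm _ _))// ltW.
Qed.

(** The restriction of a solution to the ray t |-> x0 + t v is determined by its
    value at x0. *)
Lemma radial_solution (w0 : I -> R) v : `|v| < r -> exists y : I -> R -> R,
  (forall a, y a 0 = w0 a) /\
  forall a (t : R), 0 <= t <= 1 -> is_derive t (1:R) (y a) (\sum_b A v (x0 + t *: v) a b * y b t).
Proof.
move=> vr.
have hc t : `|x0 + clamp t *: v - x0| < r by apply: segment_in_ball => //; exact: clamp_itv.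
have [|a t|y [y0 dy]] := @linear_ODE R I (fun a b t => A v (x0 + clamp t *: v) a b) w0.
- move=> a b; apply: continuous_bigsum => i t; apply: continuousM; first exact: cst_continuous.
  apply: continuous_comp.
    apply: continuousD; first exact: cst_continuous.
    by apply: continuousZl; exact: clamp_continuous.
  by apply: differentiable_continuous; apply: dB.
- exact: coefficient_small.
by exists y; split => // a t t01; have := dy a t t01; rewrite (clamp_id t01).
Qed.

Lemma radial_solution_bound (w0 : I -> R) v (y : I -> R -> R) (K : R) : `|v| < r ->
  (forall a, y a 0 = w0 a) -> (forall a, `|w0 a| <= K) -> 0 <= K ->
  (forall a (t : R), 0 <= t <= 1 -> is_derive t (1:R) (y a) (\sum_b A v (x0 + t *: v) a b * y b t)) ->
  forall a (t : R), 0 <= t <= 1 -> `|y a t| <= 2 * K.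
Proof.
move=> vr y0 hK K0 dy a t t01.
have : `|y a t - w0 a| <= 2 * (K / 2).
  apply: (@small_gronwall R I (fun a t => y a t - w0 a)
    (fun a t => \sum_b A v (x0 + t *: v) a b * y b t)) => //.
  - by rewrite divr_ge0.
  - move=> b s s01; rewrite -[X in is_derive _ _ _ X]subr0; apply: is_deriveB; exact: dy.
  - by move=> b; rewrite y0 subrr.
  move=> b s M s01 hM.
  have MK c : `|y c s| <= M + K.
    have -> : y c s = (y c s - w0 c) + w0 c by ring.
    by rewrite (le_trans (ler_normD _ _))// lerD.
  rewrite (le_trans (ler_norm_sum _ _ _))//.
  apply: (@le_trans _ _ (\sum_c `|A v (x0 + s *: v) b c| * (M + K))).
    by apply: ler_sum => c _; rewrite normrM ler_wpM2l.
  rewrite -mulr_suml; have -> : M / 2 + K / 2 = 1 / 2 * (M + K) by field.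
  rewrite ler_wpM2r//; first exact: le_trans (normr_ge0 _) (MK b).
  by apply: coefficient_small => //; exact: segment_in_ball.
have -> : 2 * (K / 2) = K by field.
move=> h; have -> : y a t = (y a t - w0 a) + w0 a by ring.
by rewrite (le_trans (ler_normD _ _))// mulr_natl mulr2n lerD.
Qed.

Lemma is_derive_coefficient v k (t : R) a b : 0 <= t <= 1 -> `|v| < r ->
  is_derive t (1:R) (fun s : R => A k (x0 + s *: v) a b)
    (\sum_i k 0 i * \sum_j v 0 j * partial j (B i a b) (x0 + t *: v)).
Proof.
move=> t01 vr; apply: is_derive_bigsum => i.
have hb := segment_in_ball t01 vr.
have h := @is_derive_mul R (cst (k 0 i)) (fun s => B i a b (x0 + s *: v)) 0 _ t
   (is_derive_cst _ _ _) (is_derive_line (dB i a b hb)).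
by rewrite mul0r add0r derive_rowE in h; last exact: dB.
Qed.

(** First order expansion, in the direction of the ray, of the coefficient of the
    radial equation. *)
Lemma coefficient_expansion v a b : `|v| < r ->
  unifO (r - `|v|) 2 (fun t k => A (v + k) (x0 + t *: (v + k)) a b - A v (x0 + t *: v) a b
    - A k (x0 + t *: v) a b
    - t * \sum_i v 0 i * \sum_j k 0 j * partial j (B i a b) (x0 + t *: v)).
Proof.
move=> vr.
have vk k : `|k| < r - `|v| -> `|v + k| < r.
  by rewrite ltrBrDl => h; rewrite (le_lt_trans (ler_normD _ _)).
have d0 : 0 <= r - `|v| by rewrite subr_ge0 ltW.
pose T1 i (t : R) k := B i a b (x0 + t *: v + t *: k) - B i a b (x0 + t *: v).
pose T2 i (t : R) k := T1 i t k - \sum_j (t *: k) 0 j * partial j (B i a b) (x0 + t *: v).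
have hq t k : 0 <= t <= 1 -> `|k| < r - `|v| -> `|x0 + t *: v + t *: k - x0| < r.
  by move=> t01 kr; rewrite -[x0 + _ + _]addrA -scalerDr; apply: segment_in_ball => //; exact: vk.
have tk (t : R) (k : 'rV[R]_n) : 0 <= t <= 1 -> `|t *: k| <= `|k|.
  by move=> /andP[t0 t1]; rewrite normrZ ger0_norm// ler_piMl.
have hT1 i : unifO (r - `|v|) 1 (T1 i).
  exists (n%:R * C) => [|t k t01 kr]; first by rewrite mulr_ge0.
  rewrite expr1; apply: (@le_trans _ _ (n%:R * C * `|t *: k|)).
    apply: (@taylor1 _ _ x0 r) => //; [by move=> z hz; exact: dB|by move=> z j hz; exact: dBC| |].
    - exact: segment_in_ball.
    - exact: hq.
  by rewrite ler_wpM2l ?mulr_ge0// tk.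
have hT2 i : unifO (r - `|v|) 2 (T2 i).
  exists (n%:R * (n%:R * C)) => [|t k t01 kr]; first by rewrite !mulr_ge0.
  apply: (@le_trans _ _ (n%:R * (n%:R * C) * `|t *: k| ^+ 2)).
    apply: (@taylor2 _ _ x0 r) => //.
    - by move=> z hz; exact: dB.
    - by move=> z j hz; exact: ddB.
    - by move=> z j l hz; exact: ddBC.
    - exact: segment_in_ball.
    - exact: hq.
  by rewrite ler_wpM2l ?mulr_ge0// lerXn2r ?nnegrE// tk.
have [c c0 hc] : unifO (r - `|v|) 2 (fun t k => \sum_i (v 0 i * T2 i t k + k 0 i * T1 i t k)).
  apply: unifO_sum => i; apply: unifOD.
    apply: (@unifOM _ _ _ 0 2) => //.
    by apply: (@unifO_bounded _ _ _ _ `|v 0 i|) => t k _ _.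
  apply: (@unifOM _ _ _ 1 1) => //; exact: unifO_coord.
exists c => // t k t01 kr; rewrite (le_trans _ (hc t k t01 kr))//.
rewrite le_eqVlt; apply/orP; left; apply/eqP; congr (`|_|).
rewrite mulr_sumr -!sumrB; apply: eq_bigr => i _.
rewrite /T2 /T1 !mxE scalerDr addrA.
have -> : \sum_j (t *: k) 0 j * partial j (B i a b) (x0 + t *: v) =
    t * \sum_j k 0 j * partial j (B i a b) (x0 + t *: v).
  by rewrite mulr_sumr; apply: eq_bigr => j _; rewrite mxE mulrA.
move: (\sum_j _) (B i a b _) (B i a b _) => S b1 b2; ring.
Qed.

Lemma flat_contractE (y : I -> R) (v k : 'rV[R]_n) p a :
  \sum_b (\sum_i v 0 i * \sum_j k 0 j * partial j (B i a b) p) * y b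
    + \sum_b A v p a b * \sum_c A k p b c * y c =
  \sum_i \sum_j \sum_c v 0 i * k 0 j * y c *
    (partial j (B i a c) p + \sum_b B i a b p * B j b c p).
Proof.
have -> : \sum_b (\sum_i v 0 i * \sum_j k 0 j * partial j (B i a b) p) * y b =
    \sum_i \sum_j \sum_c v 0 i * k 0 j * y c * partial j (B i a c) p.
  under eq_bigr do rewrite mulr_suml.
  rewrite exchange_big /=; apply: eq_bigr => i _.
  under eq_bigr do rewrite mulr_sumr mulr_suml.
  by rewrite exchange_big /=; apply: eq_bigr => j _; apply: eq_bigr => c _; ring.
have -> : \sum_b A v p a b * \sum_c A k p b c * y c =
    \sum_i \sum_j \sum_c \sum_b v 0 i * k 0 j * y c * (B i a b p * B j b c p).
  under eq_bigr do rewrite mulr_suml.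
  rewrite exchange_big /=; apply: eq_bigr => i _.
  under eq_bigr do (under eq_bigr do rewrite mulr_suml).
  under eq_bigr do rewrite exchange_big mulr_sumr.
  rewrite exchange_big /=; apply: eq_bigr => j _.
  under eq_bigr do rewrite mulr_sumr.
  by rewrite exchange_big /=; apply: eq_bigr => c _; apply: eq_bigr => b _; ring.
rewrite -big_split; apply: eq_bigr => i _; rewrite -big_split; apply: eq_bigr => j _.
rewrite -big_split; apply: eq_bigr => c _ /=.
by rewrite mulrDr mulr_sumr.
Qed.

(** Flatness of the system, contracted with the directions v and k and with y. *)
Lemma flat_contract (y : I -> R) (v k : 'rV[R]_n) p a : U p ->
  \sum_b (\sum_i v 0 i * \sum_j k 0 j * partial j (B i a b) p) * y b
    + \sum_b A v p a b * \sum_c A k p b c * y c =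
  \sum_b (\sum_i k 0 i * \sum_j v 0 j * partial j (B i a b) p) * y b
    + \sum_b A k p a b * \sum_c A v p b c * y c.
Proof.
move=> Up; rewrite !flat_contractE [RHS]exchange_big /=.
apply: eq_bigr => i _; apply: eq_bigr => j _; apply: eq_bigr => c _.
by rewrite flatB// [v 0 i * _]mulrC.
Qed.

(** Subtracts from the radial equations of z and y the derivative of t W, which
    leaves a linear equation in z - y - t W with a quadratic forcing term. *)
Lemma increment_sum (Avk Av Ak G z y W : I -> R) (t : R) :
  \sum_c Avk c * z c - \sum_c Av c * y c
    - (\sum_c Ak c * y c + t * (\sum_c G c * y c + \sum_c Av c * W c)) =
  \sum_c Avk c * (z c - y c - t * W c)
    + (\sum_c (Avk c - Av c - Ak c - t * G c) * y c
       + t * \sum_c (Ak c + t * G c + (Avk c - Av c - Ak c - t * G c)) * W c).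
Proof.
rewrite -big_split /= !mulr_sumr -[X in _ - X]big_split -!sumrB -!big_split /=.
by apply: eq_bigr => c _; ring.
Qed.

(** The point of the integration along rays: let y and z be the radial solutions
    in the directions v and v + k.  The expected first variation of y is t W with
    W = A k y.  By flatness ([flat_contract]) t W satisfies the linearized radial
    equation, so z - y - t W satisfies a linear equation with a forcing term
    O(|k|^2) and is O(|k|^2) by [small_gronwall]. *)
Lemma radial_increment (w0 : I -> R) v (y : I -> R -> R) : `|v| < r ->
  (forall a, y a 0 = w0 a) ->
  (forall a (t : R), 0 <= t <= 1 -> is_derive t (1:R) (y a) (\sum_b A v (x0 + t *: v) a b * y b t)) ->
  exists2 c : R, 0 <= c & forall k (z : I -> R -> R), `|k| < r - `|v| ->
    (forall a, z a 0 = w0 a) ->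
    (forall a (t : R), 0 <= t <= 1 ->
       is_derive t (1:R) (z a) (\sum_b A (v + k) (x0 + t *: (v + k)) a b * z b t)) ->
    forall a, `|z a 1 - y a 1 - \sum_b A k (x0 + v) a b * y b 1| <= c * `|k| ^+ 2.
Proof.
move=> vr y0 dy.
pose K : R := \big[Num.max/0]_i `|w0 i|.
have hK i : `|w0 i| <= K by exact: (le_bigmax 0 (fun i => `|w0 i|)).
have K0 : 0 <= K by rewrite /K; elim/big_ind : _ => // p q p0 q0; rewrite le_max p0.
have yK := radial_solution_bound vr y0 hK K0 dy.
have d0 : 0 <= r - `|v| by rewrite subr_ge0 ltW.
have hp t : 0 <= t <= 1 -> `|x0 + t *: v - x0| < r by move=> t01; exact: segment_in_ball.
pose d := r - `|v|.
have Oy b : unifO d 0 (fun t _ => y b t).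
  by apply: (@unifO_bounded _ _ _ _ (2 * K)) => t k t01 _; exact: yK.
have OB i a b : unifO d 0 (fun t _ => B i a b (x0 + t *: v)).
  by apply: (@unifO_bounded _ _ _ _ C) => t k t01 _; exact/BC/hp.
have OdB i j a b : unifO d 0 (fun t _ => partial j (B i a b) (x0 + t *: v)).
  by apply: (@unifO_bounded _ _ _ _ C) => t k t01 _; exact/dBC/hp.
have OA a b : unifO d 1 (fun t k => A k (x0 + t *: v) a b).
  by apply: unifO_sum => i; apply: (@unifOM _ _ _ 1 0) => //; exact: unifO_coord.
pose G t (k : 'rV[R]_n) a b := \sum_i v 0 i * \sum_j k 0 j * partial j (B i a b) (x0 + t *: v).
have OG a b : unifO d 1 (fun t k => G t k a b).
  apply: unifO_sum => i; apply: (@unifOM _ _ _ 0 1).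
    by apply: (@unifO_bounded _ _ _ _ `|v 0 i|) => t k _ _.
  by apply: unifO_sum => j; apply: (@unifOM _ _ _ 1 0) => //; exact: unifO_coord.
pose X t k a b := A (v + k) (x0 + t *: (v + k)) a b - A v (x0 + t *: v) a b
    - A k (x0 + t *: v) a b - t * G t k a b.
have OX a b : unifO d 2 (fun t k => X t k a b) by exact: coefficient_expansion.
pose W t k b := \sum_c A k (x0 + t *: v) b c * y c t.
have OW b : unifO d 1 (fun t k => W t k b).
  by apply: unifO_sum => c; apply: (@unifOM _ _ _ 1 0).
pose rem a t k := \sum_b X t k a b * y b t
  + t * \sum_b (A k (x0 + t *: v) a b + t * G t k a b + X t k a b) * W t k b.
have Orem a : unifO d 2 (fun t k => rem a t k).
  apply: unifOD.
    by apply: unifO_sum => b; apply: (@unifOM _ _ _ 2 0).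
  apply: (@unifOM _ _ _ 0 2); first exact: unifO_time.
  apply: unifO_sum => b; apply: (@unifOM _ _ _ 1 1) => //.
  apply: unifOD; last exact: unifOS.
  by apply: unifOD => //; apply: (@unifOM _ _ _ 0 1) => //; exact: unifO_time.
have /choice [c hc] : forall a, exists c : R, 0 <= c /\ forall (t : R) k, 0 <= t <= 1 -> `|k| < d ->
    `|rem a t k| <= c * `|k| ^+ 2.
  by move=> a; have [c c0 h] := Orem a; exists c.
pose cs := \sum_a c a.
have c_le a : c a <= cs.
  by rewrite /cs (bigD1 a)//= lerDl sumr_ge0// => b _; exact: (hc b).1.
have cs0 : 0 <= cs by apply: sumr_ge0 => b _; exact: (hc b).1.
exists (2 * cs); first by rewrite mulr_ge0.
move=> k z kr z0 dz a; rewrite -mulrA.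
have vk : `|v + k| < r.
  by move: kr; rewrite ltrBrDl => h; rewrite (le_lt_trans (ler_normD _ _)).
have u01 : 0 <= (1:R) <= 1 by rewrite lexx ler01.
have -> : z a 1 - y a 1 - \sum_b A k (x0 + v) a b * y b 1 =
    z a 1 - y a 1 - 1 * W 1 k a by rewrite mul1r /W scale1r.
pose V t b := \sum_c A v (x0 + t *: v) b c * y c t.
pose H t (k : 'rV[R]_n) a b := \sum_i k 0 i * \sum_j v 0 j * partial j (B i a b) (x0 + t *: v).
apply: (@small_gronwall R I (fun a t => z a t - y a t - t * W t k a)
  (fun a t => \sum_b A (v + k) (x0 + t *: (v + k)) a b * z b t - V t a
    - (1 * W t k a + t * \sum_b (H t k a b * y b t + A k (x0 + t *: v) a b * V t b)))) => //.
- by rewrite mulr_ge0// exprn_ge0.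
- move=> b t t01; apply: is_deriveB; first by apply: is_deriveB; [exact: dz|exact: dy].
  apply: is_derive_mul; apply: is_derive_bigsum => e; apply: is_derive_mul.
    exact: is_derive_coefficient.
  exact: dy.
- by move=> b; rewrite z0 y0 subrr mul0r subrr.
move=> b t M t01 hM.
have E : \sum_c A (v + k) (x0 + t *: (v + k)) b c * z c t - V t b
    - (1 * W t k b + t * \sum_c (H t k b c * y c t + A k (x0 + t *: v) b c * V t c)) =
  \sum_c A (v + k) (x0 + t *: (v + k)) b c * (z c t - y c t - t * W t k c) + rem b t k.
  rewrite [in LHS]big_split /= -(flat_contract (fun c => y c t)); last exact/rU/hp.
  by rewrite /rem /X /V mul1r; exact: increment_sum.
rewrite E (le_trans (ler_normD _ _))// lerD//; last first.
  by rewrite (le_trans ((hc b).2 _ _ t01 kr))// ler_wpM2r// exprn_ge0.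
rewrite (le_trans (ler_norm_sum _ _ _))//.
have M0 : 0 <= M by exact: le_trans (normr_ge0 _) (hM b).
apply: (@le_trans _ _ (\sum_c0 `|A (v + k) (x0 + t *: (v + k)) b c0| * M)).
  by apply: ler_sum => e _; rewrite normrM ler_wpM2l.
rewrite -mulr_suml [M / 2]mulrC ler_wpM2r// -div1r; apply: coefficient_small => //.
exact: segment_in_ball.
Qed.

End Increment.

(** Frobenius theorem for linear systems.  The solution at x0 + v is the value at
    time 1 of the radial solution in the direction v; [radial_increment] at t = 1
    says that it has the prescribed derivatives, with a quadratic remainder. *)
Theorem flat_system_solvable : exists2 r : R, 0 < r &
  (forall x, `|x - x0| < r -> U x) /\
  forall w0 : I -> R, exists w : I -> 'rV[R]_n -> R,
    (forall a, w a x0 = w0 a) /\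
    forall x, `|x - x0| < r -> forall a, differentiable (w a) x /\
      forall i, partial i (w a) x = \sum_b B i a b x * w b x.
Proof.
have [r1 r10 r1U] := open_ball_norm oU Ux0.
have cs f : smooth_on U f -> {for x0, continuous f}.
  by move=> sf; apply: differentiable_continuous; exact: smooth_on_differentiable sf Ux0.
have [d1 [C1 [d10 C10 h1]]] := @locally_bounded R n ('I_n * I * I)%type
  (fun q => B q.1.1 q.1.2 q.2) x0 (fun q => cs _ (sB _ _ _)).
have [d2 [C2 [d20 C20 h2]]] := @locally_bounded R n ('I_n * 'I_n * I * I)%type
  (fun q => partial q.1.1.2 (B q.1.1.1 q.1.2 q.2)) x0
  (fun q => cs _ (smooth_on_partial _ (sB _ _ _))).
have [d3 [C3 [d30 C30 h3]]] := @locally_bounded R n ('I_n * 'I_n * 'I_n * I * I)%type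
  (fun q => partial q.1.1.2 (partial q.1.1.1.2 (B q.1.1.1.1 q.1.2 q.2))) x0
  (fun q => cs _ (smooth_on_partial _ (smooth_on_partial _ (sB _ _ _)))).
pose C := C1 + C2 + C3.
have C0 : 0 <= C by rewrite !addr_ge0.
pose L : R := #|I|%:R * n%:R * C.
have L0 : 0 <= L by rewrite !mulr_ge0.
(* The last bound on r makes the radial coefficient at most 1/2. *)
pose r := Num.min (Num.min (Num.min r1 d1) (Num.min d2 d3)) (2 * (L + 1))^-1.
have r0 : 0 < r.
  by rewrite /r !lt_min r10 d10 d20 d30 /= invr_gt0 mulr_gt0// ltr_wpDl.
have lt_r x : `|x - x0| < r -> [/\ `|x - x0| < r1, `|x - x0| < d1, `|x - x0| < d2 & `|x - x0| < d3].
  by rewrite /r !lt_min => /andP[/andP[/andP[? ?] /andP[? ?]] _].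
have rU x : `|x - x0| < r -> U x by move=> /lt_r[/r1U].
have BC x i a b : `|x - x0| < r -> `|B i a b x| <= C.
  move=> /lt_r[_ xd _ _]; apply: le_trans (h1 x (i, a, b) xd) _.
  by rewrite /C -addrA lerDl addr_ge0.
have dBC x i j a b : `|x - x0| < r -> `|partial j (B i a b) x| <= C.
  move=> /lt_r[_ _ xd _]; apply: le_trans (h2 x (i, j, a, b) xd) _.
  by rewrite /C addrAC lerDr addr_ge0.
have ddBC x i j k a b : `|x - x0| < r -> `|partial k (partial j (B i a b)) x| <= C.
  move=> /lt_r[_ _ _ xd]; apply: le_trans (h3 x (i, j, k, a, b) xd) _.
  by rewrite /C lerDr addr_ge0.
have rC : #|I|%:R * (n%:R * r * C) <= 1 / 2.
  have -> : #|I|%:R * (n%:R * r * C) = L * r by rewrite /L; ring.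
  have rL : r <= (2 * (L + 1))^-1 by rewrite /r ge_min lexx orbT.
  apply: (le_trans (ler_wpM2l L0 rL)).
  have L1 : 0 < L + 1 by rewrite ltr_wpDl.
  by rewrite invfM mulrCA div1r ler_piMr// ler_pdivrMr// mul1r lerDl.
exists r => //; split => // w0.
have /choice [Y hY] : forall v : 'rV[R]_n, exists y : I -> R -> R, `|v| < r ->
    (forall a, y a 0 = w0 a) /\
    forall a (t : R), 0 <= t <= 1 -> is_derive t (1:R) (y a) (\sum_b A v (x0 + t *: v) a b * y b t).
  move=> v; have [vr|vr] := boolP (`|v| < r); last by exists (fun _ _ => 0).
  by have [y hy] := radial_solution rU BC rC w0 vr; exists y.
exists (fun a x => Y (x - x0) a 1); split.
  move=> a; rewrite subrr.
  have nr : `|0 : 'rV[R]_n| < r by rewrite normr0.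
  have [y0 dy] := hY 0 nr.
  apply/eqP; rewrite -subr_eq0 -normr_le0 -(mulr0 2) -[X in `|_ - X|]y0.
  apply: (@small_gronwall R I (fun a t => Y 0 a t - Y 0 a 0)
    (fun a t => \sum_b A (0 : 'rV[R]_n) (x0 + t *: (0 : 'rV[R]_n)) a b * Y 0 b t)) => //.
  - move=> b t t01; rewrite -[X in is_derive _ _ _ X]subr0; apply: is_deriveB; exact: dy.
  - by move=> b; rewrite subrr.
  - move=> b t M t01 hM; rewrite big1 ?normr0 ?addr0 ?divr_ge0//.
      exact: le_trans (normr_ge0 _) (hM b).
    by move=> c _; rewrite big1 ?mul0r// => i _; rewrite mxE mul0r.
  - by rewrite lexx ler01.
move=> x xr a.
have [y0 dy] := hY _ xr.
have [c c0 hc] := radial_increment C0 rU BC dBC ddBC rC xr y0 dy.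
have d0 : 0 < r - `|x - x0| by rewrite subr_gt0.
apply: (@differentiable_of_quadratic _ _ _ _ _ c _ d0 c0) => k kd.
have vk : `|x - x0 + k| < r.
  by move: kd; rewrite ltrBrDl => h; rewrite (le_lt_trans (ler_normD _ _)).
have [z0 dz] := hY _ vk.
have := hc k (Y (x - x0 + k)) kd z0 dz a.
have -> : x0 + (x - x0) = x by rewrite addrC subrK.
rewrite [x + k - x0]addrAC; congr (`|_ - _| <= _).
under eq_bigr do rewrite mulr_suml.
rewrite exchange_big /=; apply: eq_bigr => i _; rewrite mulr_sumr.
by apply: eq_bigr => b _; rewrite mulrA.
Qed.

End FlatSystem.

(** * Positive definite matrices and the spectral theorem *)

Section PosDef.
Variable R : realType.

Definition sqnorm n (v : 'rV[R]_n) : R := \sum_i v 0 i ^+ 2.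

Lemma sqnormE n (v : 'rV[R]_n) : (v *m v^T) 0 0 = sqnorm v.
Proof. by rewrite mxE; apply: eq_bigr => i _; rewrite mxE expr2. Qed.

Lemma sqnorm_ge0 n (v : 'rV[R]_n) : 0 <= sqnorm v.
Proof. by apply: sumr_ge0 => i _; rewrite sqr_ge0. Qed.

Lemma sqnorm_eq0 n (v : 'rV[R]_n) : (sqnorm v == 0) = (v == 0).
Proof.
apply/idP/eqP => [|->]; last by rewrite /sqnorm big1// => i _; rewrite mxE expr0n.
rewrite psumr_eq0 => [/allP h|i _]; last by rewrite sqr_ge0.
apply/rowP => i; have := h i (mem_index_enum i); rewrite sqrf_eq0 => /eqP ->.
by rewrite mxE.
Qed.

Definition posmx n (g : 'M[R]_n) := g^T = g /\
  forall v : 'rV[R]_n, v != 0 -> 0 < (v *m g *m v^T) 0 0.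

Lemma posmx_unit n (g : 'M[R]_n) : posmx g -> g \in unitmx.
Proof.
move=> [_ gp]; rewrite unitmxE unitfE; apply/det0P => -[v v0 vg].
by have := gp v v0; rewrite vg mul0mx mxE ltxx.
Qed.

Lemma quad_form_linear_coef (a b : R) : (forall t, 0 <= 2 * t * a + t ^+ 2 * b) -> a = 0.
Proof.
move=> H; apply/eqP; case: (ltgtP a 0) => // a0.
- have h := H (- a / (`|b| + 1)); have b1 : 0 < `|b| + 1 by rewrite ltr_wpDl.
  set t := - a / _ in h; have t0 : 0 < t by rewrite divr_gt0// oppr_gt0.
  have E : t * (`|b| + 1) = - a by rewrite /t mulfVK// gt_eqF.
  have : t * b <= t * `|b| by rewrite ler_pM2l// ler_norm.
  have : 0 <= t * (2 * a + t * b) by rewrite mulrDr; nra.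
  rewrite pmulr_rge0//; nra.
- have h := H (- a / (`|b| + 1)); have b1 : 0 < `|b| + 1 by rewrite ltr_wpDl.
  set t := - a / _ in h; have t0 : t < 0 by rewrite /t mulNr oppr_lt0 divr_gt0.
  have E : t * (`|b| + 1) = - a by rewrite /t mulfVK// gt_eqF.
  have : t * `|b| <= t * b by rewrite ler_nM2l// ler_norm.
  have : 0 <= t * (2 * a + t * b) by rewrite mulrDr; nra.
  rewrite nmulr_rge0//; nra.
Qed.

(** A nonnegative quadratic form is minimal at its isotropic vectors, so its
    gradient vanishes there. *)
Lemma quad_form_ge0_ker n (A : 'M[R]_n) (u : 'rV[R]_n) : A^T = A ->
  (forall v : 'rV[R]_n, 0 <= (v *m A *m v^T) 0 0) -> (u *m A *m u^T) 0 0 = 0 -> u *m A = 0.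
Proof.
move=> As A0 u0; apply/eqP; rewrite -sqnorm_eq0 -sqnormE; apply/eqP.
pose w := u *m A; apply: (@quad_form_linear_coef _ ((w *m A *m w^T) 0 0)) => t.
apply: le_trans (A0 (u + t *: w)) _; rewrite le_eqVlt; apply/orP; left; apply/eqP.
have -> : (u + t *: w) *m A *m (u + t *: w)^T =
    u *m A *m u^T + t *: (w *m w^T) + t *: (w *m A *m u^T) + t ^+ 2 *: (w *m A *m w^T).
  rewrite linearD linearZ /= !mulmxDl !mulmxDr -!scalemxAl -!scalemxAr scalerA -expr2.
  by rewrite !addrA.
rewrite !mxE in u0 *; rewrite u0 add0r.
have -> : \sum_j (w *m A) 0 j * u^T j 0 = (w *m A *m u^T) 0 0 by rewrite mxE.
have -> : w *m A *m u^T = (w *m w^T).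
  by rewrite /w trmx_mul As !mulmxA.
by rewrite mxE; ring.
Qed.

(** At a maximum u of the quadratic form of A on the unit sphere, with value l,
    the form of l - A is nonnegative and u is isotropic for it. *)
Lemma rayleigh n (A : 'M[R]_n.+1) : A^T = A ->
  exists (u : 'rV[R]_n.+1) (l : R), sqnorm u = 1 /\ u *m A = l *: u.
Proof.
move=> As.
pose S := [set v : 'rV[R]_n.+1 | sqnorm v = 1].
pose f (v : 'rV[R]_n.+1) : R := (v *m A *m v^T) 0 0.
have csq : continuous (@sqnorm n.+1 : 'rV[R]_n.+1 -> R).
  move=> v; apply: (@differentiable_continuous R 'rV[R]_n.+1 R v (@sqnorm n.+1)).
  by apply: differentiable_bigsum => i; apply: differentiableM; exact: differentiable_coord.
have cf : continuous (f : 'rV[R]_n.+1 -> R).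
  move=> v; apply: (@differentiable_continuous R 'rV[R]_n.+1 R v f).
  have -> : f = (fun v => \sum_j (\sum_i v 0 i * A i j) * v 0 j).
    apply/funext => w; rewrite /f mxE; apply: eq_bigr => j _.
    by rewrite mxE [w^T j 0]mxE.
  apply: differentiable_bigsum => j; apply: differentiableM; last exact: differentiable_coord.
  apply: differentiable_bigsum => i; apply: differentiableM => //; exact: differentiable_coord.
have [|||u uS uM] := @EVT_max_rV R n.+1 f S.
- exists (delta_mx 0 0); rewrite /S /= /sqnorm (bigD1 ord0)//= big1 ?addr0.
    by rewrite mxE !eqxx expr1n.
  by move=> i i0; rewrite mxE (negbTE i0) andbF expr0n.
- apply: bounded_closed_compact.
    exists 1; split; first exact: real1.
    move=> M M1 v Sv; apply: (le_trans _ (ltW M1)).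
    rewrite [leLHS]/Num.norm /= mx_normrE; apply: bigmax_le => // -[i j] _ /=.
    rewrite (ord1 i) -[leRHS]sqrtr1 -[X in Num.sqrt X]Sv -sqrtr_sqr ler_sqrt ?sqnorm_ge0//.
    by rewrite /sqnorm (bigD1 j)//= lerDl sumr_ge0// => k _; rewrite sqr_ge0.
  have -> : S = (@sqnorm n.+1) @^-1` [set 1] by [].
  by apply: preimage_closed => //; exact: closed_eq.
- exact: continuous_subspaceT.
rewrite inE in uS; exists u, (f u); split => //.
have u1 : sqnorm u = 1 by [].
have H v : f v <= f u * sqnorm v.
  have [->|v0] := eqVneq v 0.
    by rewrite /f !mul0mx mxE (eqP (_ : sqnorm 0 == 0)) ?sqnorm_eq0// mulr0.
  have s0 : 0 < sqnorm v by rewrite lt_neqAle eq_sym sqnorm_eq0 v0 sqnorm_ge0.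
  pose c := (Num.sqrt (sqnorm v))^-1.
  have c2 : c ^+ 2 = (sqnorm v)^-1 by rewrite exprVn sqr_sqrtr// ltW.
  have fc : f (c *: v) = c ^+ 2 * f v.
    by rewrite /f linearZ /= -scalemxAl -scalemxAl -scalemxAr scalerA mxE expr2.
  have : f (c *: v) <= f u.
    apply: uM; rewrite inE /S /= /sqnorm.
    under eq_bigr do rewrite mxE exprMn.
    by rewrite -mulr_sumr c2 mulVf// gt_eqF.
  by rewrite fc c2 mulrC ler_pdivrMr.
have : u *m ((f u)%:M - A) = 0.
  apply: quad_form_ge0_ker.
  - by rewrite linearB /= tr_scalar_mx As.
  - move=> v; rewrite mulmxBr mulmxBl mul_mx_scalar -scalemxAl mxE mxE sqnormE.
    by rewrite [X in _ + X]mxE subr_ge0; exact: H.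
  rewrite mulmxBr mulmxBl mul_mx_scalar -scalemxAl mxE mxE sqnormE u1 mulr1.
  by rewrite [X in _ + X]mxE subrr.
by rewrite mulmxBr mul_mx_scalar => /eqP; rewrite subr_eq0 => /eqP.
Qed.
End PosDef.

Section Spectral.
Variable R : realType.

(** Unless they are equal, P is the reflection that exchanges u and the first basis
    vector. *)
Lemma orthogonal_completion n (u : 'rV[R]_n.+1) : sqnorm u = 1 ->
  exists P : 'M[R]_n.+1, P *m P^T = 1%:M /\ delta_mx 0 0 *m P = u.
Proof.
move=> u1; pose e : 'rV[R]_n.+1 := delta_mx 0 0.
have e1 : (e *m e^T) 0 0 = 1.
  rewrite sqnormE /sqnorm (bigD1 ord0)//= big1 ?addr0; first by rewrite mxE !eqxx expr1n.
  by move=> i i0; rewrite mxE (negbTE i0) andbF expr0n.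
have uu1 : (u *m u^T) 0 0 = 1 by rewrite sqnormE.
have [ue|ue] := eqVneq u e; first by exists 1%:M; rewrite trmx1 !mulmx1 -/e ue.
have sub00 (X Y : 'M[R]_1) : (X - Y) 0 0 = X 0 0 - Y 0 0 by rewrite !mxE.
pose w := u - e; pose s := sqnorm w.
have s0 : s != 0 by rewrite sqnorm_eq0 subr_eq0.
have ww : w *m w^T = s%:M.
  by apply/matrixP => i j; rewrite !ord1 sqnormE -/s mxE eqxx mulr1n.
have ewE : (e *m w^T) 0 0 = - (s / 2).
  have se : s = 2 - 2 * (e *m u^T) 0 0.
    rewrite /s -sqnormE /w linearB /= mulmxBl !mulmxBr.
    have -> : u *m e^T = (e *m u^T)^T by rewrite trmx_mul trmxK.
    rewrite !mxE in e1 uu1 *; rewrite e1 uu1; ring.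
  have -> : (e *m w^T) 0 0 = (e *m u^T) 0 0 - 1 by rewrite /w linearB /= mulmxBr sub00 e1.
  by rewrite se; field.
have uw : u = e + w by rewrite /w addrC subrK.
move: (w) s s0 ww ewE uw => {}w s s0 ww ewE uw.
pose P := 1%:M - (2 / s) *: (w^T *m w).
have PT : P^T = P by rewrite /P linearB /= trmx1 linearZ /= trmx_mul trmxK.
exists P; split.
  rewrite PT /P mulmxBl !mulmxBr !mul1mx mulmx1 -!scalemxAl -!scalemxAr.
  have -> : w^T *m w *m (w^T *m w) = s *: (w^T *m w).
    by rewrite mulmxA -(mulmxA w^T w w^T) ww mul_mx_scalar -scalemxAl.
  rewrite !scalerA; have -> : 2 / s * (2 / s) * s = 2 / s + 2 / s by field.
  by rewrite scalerDl opprB addrK subrK.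
rewrite /P mulmxBr mulmx1 -scalemxAr mulmxA.
have -> : delta_mx 0 0 *m w^T = (- (s / 2))%:M.
  by apply/matrixP => i j; rewrite !ord1 ewE mxE eqxx mulr1n.
rewrite mul_scalar_mx scalerA; have -> : 2 / s * - (s / 2) = -1 by field.
by rewrite scaleN1r opprK uw.
Qed.

(** By induction: in an orthonormal basis that starts with an eigenvector, a
    symmetric matrix is block diagonal. *)
Theorem spectral_theorem n (A : 'M[R]_n) : A^T = A ->
  exists (Q : 'M[R]_n) (d : 'rV[R]_n), Q *m Q^T = 1%:M /\ Q *m A *m Q^T = diag_mx d.
Proof.
elim: n A => [|n IH] A As.
  by exists 1%:M, 0; split; apply/matrixP => -[].
have [u [l [u1 ul]]] := rayleigh As.
have [P [PP eP]] := orthogonal_completion u1.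
have PP' : P^T *m P = 1%:M by exact: mulmx1C.
have [B BP] : exists B : 'M[R]_(1 + n), B = P *m A *m P^T by eexists.
have Bs : B^T = B by rewrite BP !trmx_mul trmxK As mulmxA.
have e0 : row 0 B = l *: delta_mx 0 0.
  rewrite rowE BP !mulmxA eP ul -scalemxAl -eP -mulmxA PP mulmx1.
  by [].
have Bu j : B 0 j = l * (j == 0)%:R.
  by have /rowP/(_ j) := e0; rewrite !mxE eqxx.
have Bur : ursubmx B = 0.
  apply/matrixP => i j; rewrite !mxE ord1; have := Bu (rshift 1 j).
  have -> : lshift n 0 = 0 :> 'I_(1 + n) by exact: val_inj.
  by have -> : (rshift 1 j == 0) = false; [by []|rewrite mulr0].
have Bul : ulsubmx B = l%:M.
  apply/matrixP => i j; rewrite !mxE !ord1 /=; have -> : lshift n 0 = 0 :> 'I_(1 + n) by exact: val_inj.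
  by rewrite Bu eqxx mulr1 mulr1n.
have Bdl : dlsubmx B = 0 by rewrite -[dlsubmx B]trmxK trmx_dlsub Bs Bur trmx0.
have BE : B = block_mx l%:M 0 0 (drsubmx B) by rewrite -[LHS]submxK Bul Bur Bdl.
have As' : (drsubmx B)^T = drsubmx B by rewrite trmx_drsub Bs.
have [Q [d [QQ Qd]]] := IH _ As'.
pose Q1 : 'M[R]_(1 + n) := block_mx 1%:M 0 0 Q.
have Q1T : Q1^T = block_mx 1%:M 0 0 Q^T by rewrite tr_block_mx trmx1 !trmx0.
have Q11 : Q1 *m Q1^T = 1%:M.
  rewrite Q1T mulmx_block !mulmx0 !mul0mx !addr0 !add0r mulmx1 QQ.
  by rewrite -scalar_mx_block.
have Q1B : Q1 *m B *m Q1^T = diag_mx (row_mx l%:M d).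
  rewrite Q1T BE !mulmx_block !mulmx0 !mul0mx !addr0 !add0r !mul1mx !mulmx1 Qd.
  rewrite mul0mx diag_mx_row.
  by congr block_mx; apply/matrixP => i j; rewrite !ord1 !mxE.
exists (Q1 *m P), (row_mx l%:M d); split.
  by rewrite trmx_mul mulmxA -(mulmxA Q1 P) PP mulmx1; exact: Q11.
rewrite trmx_mul !mulmxA -(mulmxA Q1 P A) -(mulmxA Q1 (P *m A)) -BP; exact: Q1B.
Qed.

(** The spectral theorem for matrices indexed by a finite type, used for pairs of
    indices. *)
Lemma spectral_fintype (T : finType) (S : T -> T -> R) : (forall s t, S s t = S t s) ->
  exists (k : T -> R) (W : T -> T -> R),
  [/\ forall r s, \sum_t W r t * W s t = (r == s)%:R,
      forall s t, \sum_r W r s * W r t = (s == t)%:R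
    & forall r s, \sum_t S s t * W r t = k r * W r s].
Proof.
move=> Ss; pose A : 'M[R]_#|T| := \matrix_(i, j) S (enum_val i) (enum_val j).
have As : A^T = A by apply/matrixP => i j; rewrite !mxE Ss.
have [Q [d [QQ Qd]]] := spectral_theorem As.
have QQ' : Q^T *m Q = 1%:M by exact: mulmx1C.
have QA : Q *m A = diag_mx d *m Q by rewrite -Qd -mulmxA QQ' mulmx1.
have reT (F : T -> R) : \sum_t F t = \sum_(i < #|T|) F (enum_val i).
  by rewrite (reindex _ (onW_bij _ (@enum_val_bij T))).
exists (fun r => d 0 (enum_rank r)), (fun r t => Q (enum_rank r) (enum_rank t)); split.
- move=> r s; have /matrixP/(_ (enum_rank r) (enum_rank s)) := QQ.
  rewrite !mxE (inj_eq enum_rank_inj) => <-; rewrite reT.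
  by apply: eq_bigr => i _; rewrite mxE enum_valK.
- move=> s t; have /matrixP/(_ (enum_rank s) (enum_rank t)) := QQ'.
  rewrite !mxE (inj_eq enum_rank_inj) => <-; rewrite reT.
  by apply: eq_bigr => i _; rewrite mxE enum_valK.
move=> r s; have /matrixP/(_ (enum_rank r) (enum_rank s)) := QA.
rewrite mul_diag_mx !mxE => <-; rewrite reT.
by apply: eq_bigr => i _; rewrite mxE enum_valK enum_rankK mulrC Ss.
Qed.

Lemma orthonormal_frame n (g : 'M[R]_n) : posmx g ->
  exists E : 'M[R]_n, E *m g *m E^T = 1%:M.
Proof.
move=> [gs gp]; have [Q [d [QQ Qd]]] := spectral_theorem gs.
have dp i : 0 < d 0 i.
  have := gp (row i Q); rewrite tr_row -row_mul.
  have -> : (row i (Q *m g) *m col i Q^T) 0 0 = (Q *m g *m Q^T) i i.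
    by rewrite !mxE; apply: eq_bigr => k _; rewrite !mxE.
  rewrite Qd mxE eqxx mulr1n; apply; apply/eqP => /(congr1 (fun v => v *m Q^T)).
  rewrite -row_mul QQ mul0mx => /rowP/(_ i); rewrite !mxE eqxx => /eqP.
  by rewrite oner_eq0.
exists (diag_mx (\row_i (Num.sqrt (d 0 i))^-1) *m Q).
rewrite trmx_mul tr_diag_mx !mulmxA -(mulmxA _ Q g) -(mulmxA _ (Q *m g)) Qd !mulmx_diag.
apply/matrixP => i j; rewrite !mxE; case: (i == j) => //; rewrite ?mulr0n// !mulr1n.
rewrite mulrAC -expr2 exprVn sqr_sqrtr ?ltW// mulVf// gt_eqF//.
Qed.

Lemma simultaneous_diagonalization n (g h : 'M[R]_n) : posmx g -> h^T = h ->
  exists (E : 'M[R]_n) (d : 'rV[R]_n), E *m g *m E^T = 1%:M /\ E *m h *m E^T = diag_mx d.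
Proof.
move=> gp hs; have [E0 E0g] := orthonormal_frame gp.
have [|Q [d [QQ Qd]]] := @spectral_theorem n (E0 *m h *m E0^T).
  by rewrite !trmx_mul trmxK hs mulmxA.
exists (Q *m E0), d; split; rewrite trmx_mul !mulmxA.
  by rewrite -(mulmxA Q E0 g) -(mulmxA Q (E0 *m g)) E0g mulmx1.
by rewrite -(mulmxA Q E0 h) -(mulmxA Q (E0 *m h)).
Qed.
End Spectral.

(** * Operators on 2-forms *)

Section TwoForms.
Variables (R : realType) (n : nat).
Implicit Types (g h P w v : 'M[R]_n) (T L : 'I_n -> 'I_n -> 'I_n -> 'I_n -> R).

(** By the definition of the Weyl tensor, weyl g T = 0 means that T is
    kulkarni_nomizu g P, where P is the Schouten tensor of T. *)
Definition kulkarni_nomizu g P (a b c d : 'I_n) : R :=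
  g a c * P b d + P a c * g b d - P a d * g b c - g a d * P b c.

(** As an operator on 2-forms, the exterior square of h. *)
Definition gauss_tensor h (a b c d : 'I_n) : R := h a c * h b d - h a d * h b c.

Lemma raise2E g w : g^T = g -> raise2 g w = invmx g *m w *m invmx g.
Proof.
move=> gs; apply/matrixP => a b; rewrite !mxE.
under [RHS]eq_bigr do rewrite mxE mulr_suml.
rewrite exchange_big /=; apply: eq_bigr => c _; apply: eq_bigr => d _.
have -> : invmx g c b = invmx g b c by rewrite -[in RHS]gs -trmx_inv mxE.
ring.
Qed.

Lemma invmx_sym g : g^T = g -> (invmx g)^T = invmx g.
Proof. by move=> gs; rewrite trmx_inv gs. Qed.

Lemma two_form_raise2 g w : g^T = g -> two_form w -> two_form (raise2 g w).
Proof.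
move=> gs ww; rewrite /two_form raise2E// !trmx_mul invmx_sym// ww.
by rewrite mulNmx mulmxN mulmxA.
Qed.

Lemma two_form_antisym w a b : two_form w -> w b a = - w a b.
Proof. by move=> /matrixP/(_ a b); rewrite !mxE. Qed.

Lemma contract_pair (A B r : 'M[R]_n) a b :
  \sum_c \sum_d A a c * B b d * r c d = (A *m r *m B^T) a b.
Proof.
rewrite !mxE; under [RHS]eq_bigr do rewrite mxE mulr_suml.
rewrite exchange_big /=; apply: eq_bigr => d _; apply: eq_bigr => c _.
by rewrite mxE; ring.
Qed.

Lemma contract_pair_swap (A B r : 'M[R]_n) a b :
  \sum_c \sum_d A a d * B b c * r c d = (A *m r^T *m B^T) a b.
Proof.
rewrite -contract_pair exchange_big /=.
by apply: eq_bigr => c _; apply: eq_bigr => d _; rewrite mxE.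
Qed.

Lemma op_of_gauss_tensor g h w : g^T = g -> h^T = h -> two_form w ->
  op_of g (gauss_tensor h) w = h *m raise2 g w *m h.
Proof.
move=> gs hs /(two_form_raise2 gs) rw; apply/matrixP => a b; rewrite mxE.
move: (raise2 g w) rw => r rw.
have -> : \sum_c \sum_d gauss_tensor h a b c d * r c d =
    (h *m r *m h^T) a b - (h *m r^T *m h^T) a b.
  rewrite -contract_pair -contract_pair_swap -sumrB; apply: eq_bigr => c _.
  by rewrite -sumrB; apply: eq_bigr => d _; rewrite -mulrBl.
by rewrite rw hs mulmxN mulNmx [X in _ - X]mxE; field.
Qed.

Lemma op_of_kulkarni_nomizu g P w : g^T = g -> P^T = P -> g \in unitmx -> two_form w ->
  op_of g (kulkarni_nomizu g P) w = w *m invmx g *m P + P *m invmx g *m w.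
Proof.
move=> gs Ps gu ww; have := two_form_raise2 gs ww; have rE := raise2E w gs.
have -> : w *m invmx g *m P + P *m invmx g *m w = g *m raise2 g w *m P + P *m raise2 g w *m g.
  by rewrite rE !mulmxA mulmxV// mul1mx -!mulmxA mulVmx// mulmx1.
move=> rw0; apply/matrixP => a b; rewrite mxE.
move: (raise2 g w) rw0 {rE} => r rw.
have -> : \sum_c \sum_d kulkarni_nomizu g P a b c d * r c d =
    (g *m r *m P^T) a b + (P *m r *m g^T) a b - (P *m r^T *m g^T) a b - (g *m r^T *m P^T) a b.
  rewrite -!contract_pair_swap -!contract_pair -big_split -!sumrB; apply: eq_bigr => c _.
  rewrite -big_split -!sumrB; apply: eq_bigr => d _ /=.
  by rewrite /kulkarni_nomizu; ring.
by rewrite rw gs Ps !mulmxN !mulNmx [in RHS]mxE [(- (P *m r *m g)) a b]mxE [(- (g *m r *m P)) a b]mxE; field.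
Qed.

Lemma ricci_kulkarni_nomizu g P : g^T = g -> P^T = P -> g \in unitmx ->
  ricci g (kulkarni_nomizu g P) = (n%:R - 2) *: P + (\sum_k \sum_l invmx g k l * P l k) *: g.
Proof.
move=> gs Ps gu; apply/matrixP => i j; rewrite !mxE.
have gi (A B : 'M[R]_n) a b : (\sum_k \sum_l invmx g k l * (A l a * B k b)) = (A^T *m invmx g *m B) a b.
  rewrite exchange_big mxE; under [RHS]eq_bigr do rewrite mxE mulr_suml.
  rewrite [RHS]exchange_big /=; apply: eq_bigr => l _; apply: eq_bigr => k _.
  by rewrite mxE -[in RHS](invmx_sym gs) mxE; ring.
have tr1 : \sum_k \sum_l invmx g k l * g l k = n%:R.
  have := mxtrace1 R n; rewrite -(mulVmx gu) /mxtrace => <-.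
  by apply: eq_bigr => k _; rewrite mxE.
have -> : \sum_k \sum_l invmx g k l * kulkarni_nomizu g P l i k j =
   (\sum_k \sum_l invmx g k l * g l k) * P i j + (\sum_k \sum_l invmx g k l * P l k) * g i j
   - \sum_k \sum_l invmx g k l * (P l j * g k i) - \sum_k \sum_l invmx g k l * (g l j * P k i).
  rewrite !mulr_suml -big_split -!sumrB; apply: eq_bigr => k _ /=.
  rewrite !mulr_suml -big_split -!sumrB; apply: eq_bigr => l _ /=.
  rewrite /kulkarni_nomizu.
  have -> : g i k = g k i by rewrite -[in LHS]gs mxE.
  have -> : P i k = P k i by rewrite -[in LHS]Ps mxE.
  ring.
rewrite !gi tr1 gs Ps -!mulmxA mulVmx// mulmx1 mulmxA mulmxV// mul1mx.
have -> : P j i = P i j by rewrite -[in LHS]Ps mxE.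
ring.
Qed.

(** The factors n - 2 and n - 1 in the Schouten tensor are chosen so that it
    inverts P |-> kulkarni_nomizu g P. *)
Lemma schouten_kulkarni_nomizu g P : (3 <= n)%N -> g^T = g -> P^T = P -> g \in unitmx ->
  schouten g (kulkarni_nomizu g P) = P.
Proof.
move=> n3 gs Ps gu; rewrite /schouten /Defs.scalar ricci_kulkarni_nomizu//.
set t := \sum_k \sum_l _.
have tP : \sum_a \sum_b invmx g a b * P a b = t.
  apply: eq_bigr => a _; apply: eq_bigr => b _.
  by rewrite -[in LHS]Ps mxE.
have tg : \sum_a \sum_b invmx g a b * g a b = n%:R.
  have := mxtrace1 R n; rewrite -(mulVmx gu) /mxtrace => <-.
  by apply: eq_bigr => a _; rewrite mxE; apply: eq_bigr => b _; rewrite -[in X in _ * X]gs mxE.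
have lin (x y : R) : \sum_a \sum_b invmx g a b * (x *: P + y *: g) a b = x * t + y * n%:R.
  rewrite -tP -tg !mulr_sumr -big_split; apply: eq_bigr => a _ /=.
  by rewrite !mulr_sumr -big_split; apply: eq_bigr => b _ /=; rewrite !mxE; ring.
rewrite lin.
have n2 : n%:R - 2 != 0 :> R by rewrite subr_eq0 eqr_nat; case: n n3 => [|[|[|]]].
have n1 : n%:R - 1 != 0 :> R by rewrite subr_eq0 (eqr_nat _ _ 1); case: n n3 => [|[|[|]]].
have -> : ((n%:R - 2) * t + t * n%:R) / (2 * (n%:R - 1)) = t by field.
by rewrite addrK scalerA mulVf// scale1r.
Qed.

Lemma weyl_eq0E g T : (forall a b c d, weyl g T a b c d = 0) ->
  T = kulkarni_nomizu g (schouten g T).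
Proof.
move=> H; do 4 (apply/funext => ?).
by apply/eqP; rewrite -subr_eq0; apply/eqP; exact: H.
Qed.

Lemma weyl_kulkarni_nomizu g P a b c d : (3 <= n)%N -> g^T = g -> P^T = P -> g \in unitmx ->
  weyl g (kulkarni_nomizu g P) a b c d = 0.
Proof. by move=> *; rewrite /weyl schouten_kulkarni_nomizu// subrr. Qed.

Lemma schouten_sym g T : g^T = g -> operator_tensor T -> (schouten g T)^T = schouten g T.
Proof.
move=> gs [_ _ Ts]; rewrite /schouten linearZ /= linearB /= linearZ /= gs.
congr (_ *: (_ - _)); apply/matrixP => i j; rewrite !mxE exchange_big /=.
apply: eq_bigr => k _; apply: eq_bigr => l _.
by rewrite Ts -[in LHS](invmx_sym gs) mxE.
Qed.

Lemma operator_tensor_kulkarni_nomizu g P : g^T = g -> P^T = P ->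
  operator_tensor (kulkarni_nomizu g P).
Proof.
move=> gs Ps.
have gE a b : g b a = g a b by rewrite -[in LHS]gs mxE.
have PE a b : P b a = P a b by rewrite -[in LHS]Ps mxE.
split=> a b c d; rewrite /kulkarni_nomizu; try ring.
by rewrite (gE a c) (gE b d) (gE b c) (gE a d) (PE a c) (PE b d) (PE b c) (PE a d); ring.
Qed.

Lemma operator_tensor_gauss h : h^T = h -> operator_tensor (gauss_tensor h).
Proof.
move=> hs; have hE a b : h b a = h a b by rewrite -[in LHS]hs mxE.
split=> a b c d; rewrite /gauss_tensor; try ring.
by rewrite (hE a c) (hE b d) (hE b c) (hE a d); ring.
Qed.

Lemma op_of_linear g T a v w : g^T = g -> op_of g T (a *: v + w) = a *: op_of g T v + op_of g T w.
Proof.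
move=> gs; apply/matrixP => i j; rewrite !mxE mulrCA -mulrDr; congr (_ * _).
rewrite mulr_sumr -big_split; apply: eq_bigr => c _ /=.
rewrite mulr_sumr -big_split; apply: eq_bigr => d _ /=.
have -> : raise2 g (a *: v + w) = a *: raise2 g v + raise2 g w.
  by rewrite !raise2E// mulmxDr mulmxDl -scalemxAr -scalemxAl.
move: (raise2 g v) (raise2 g w) => V W; rewrite !mxE; ring.
Qed.

Lemma op_of_sum g T (J : Type) (r : seq J) (c : J -> R) (w : J -> 'M[R]_n) : g^T = g ->
  op_of g T (\sum_(k <- r) c k *: w k) = \sum_(k <- r) c k *: op_of g T (w k).
Proof.
move=> gs; have op0 : op_of g T 0 = 0.
  have := op_of_linear T 1 0 0 gs; rewrite scaler0 addr0 scale1r => /eqP.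
  by rewrite -subr_eq0 opprD addrA subrr sub0r oppr_eq0 => /eqP.
elim: r => [|k r IH]; first by rewrite !big_nil.
by rewrite !big_cons op_of_linear// IH.
Qed.

Lemma form_dotE g v w : g^T = g ->
  form_dot g v w = 2^-1 * \tr (v *m invmx g *m w^T *m invmx g).
Proof.
move=> gs; rewrite /form_dot; congr (_ * _).
have -> : v *m invmx g *m w^T *m invmx g = v *m (raise2 g w)^T.
  by rewrite raise2E// !trmx_mul invmx_sym// !mulmxA.
by apply: eq_bigr => a _; rewrite mxE; apply: eq_bigr => b _; rewrite !mxE.
Qed.

Lemma form_dotC g v w : g^T = g -> form_dot g v w = form_dot g w v.
Proof.
move=> gs; rewrite !form_dotE//; congr (_ * _).
rewrite -[LHS]mxtrace_tr !trmx_mul trmxK !invmx_sym// mxtrace_mulC.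
by rewrite !mulmxA mxtrace_mulC !mulmxA.
Qed.

Lemma form_dotZ g a v w : g^T = g -> form_dot g v (a *: w) = a * form_dot g v w.
Proof.
by move=> gs; rewrite !form_dotE// linearZ /= -scalemxAr -scalemxAl mxtraceZ mulrCA.
Qed.

Lemma form_dot0 g v : g^T = g -> form_dot g v 0 = 0.
Proof. by move=> gs; have := form_dotZ 0 v 0 gs; rewrite scale0r mul0r. Qed.

Lemma form_dot_op g T v w : g^T = g -> operator_tensor T ->
  form_dot g v (op_of g T w) = form_dot g (op_of g T v) w.
Proof.
move=> gs [_ _ Ts]; rewrite [LHS]form_dotC// /form_dot; congr (_ * _).
under eq_bigr do under eq_bigr do rewrite mxE.
under [RHS]eq_bigr do under eq_bigr do rewrite mxE.
move: (raise2 g v) (raise2 g w) => V W.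
have E (A B : 'M[R]_n) : \sum_i \sum_j 2^-1 * (\sum_c \sum_d T i j c d * A c d) * B i j =
   2^-1 * \sum_i \sum_j \sum_c \sum_d T i j c d * A c d * B i j.
  rewrite mulr_sumr; apply: eq_bigr => i _; rewrite mulr_sumr; apply: eq_bigr => j _.
  rewrite -mulrA; congr (_ * _); rewrite mulr_suml; apply: eq_bigr => c _.
  by rewrite mulr_suml.
rewrite !E; congr (_ * _).
pose F (p q : 'I_n * 'I_n) := T p.1 p.2 q.1 q.2 * W q.1 q.2 * V p.1 p.2.
have -> : \sum_i \sum_j \sum_c \sum_d T i j c d * W c d * V i j = \sum_p \sum_q F p q.
  by rewrite pair_big; apply: eq_bigr => -[i j] _; rewrite pair_big; apply: eq_bigr => -[c d] _.
rewrite exchange_big [RHS]pair_big /=; apply: eq_bigr => -[i j] _.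
rewrite [RHS]pair_big; apply: eq_bigr => -[c d] _; rewrite /F /= Ts; ring.
Qed.

(** For F = g, the 2-form that extracts the components of an operator; for F the
    inverse of an orthonormal frame e, the 2-form e^i /\ e^j. *)
Definition wedge (F : 'M[R]_n) (i j : 'I_n) : 'M[R]_n :=
  F *m (delta_mx i j - delta_mx j i) *m F^T.

Lemma two_form_wedge F i j : two_form (wedge F i j).
Proof.
rewrite /two_form /wedge !trmx_mul trmxK linearB /= !trmx_delta mulmxA.
by rewrite -mulNmx -mulmxN opprB.
Qed.

Lemma contract_wedge (A : 'I_n -> 'I_n -> R) c d :
  \sum_i \sum_j A i j * (delta_mx c d - delta_mx d c : 'M[R]_n) i j = A c d - A d c.
Proof.
have E a b : \sum_i \sum_j A i j * (delta_mx a b : 'M[R]_n) i j = A a b.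
  rewrite (bigD1 a)//= [X in _ + X]big1 ?addr0 => [|i ia].
    rewrite (bigD1 b)//= big1 ?addr0 => [|j jb]; first by rewrite mxE !eqxx mulr1.
    by rewrite mxE (negbTE jb) andbF mulr0.
  by rewrite big1// => j _; rewrite mxE (negbTE ia) mulr0.
rewrite -[A c d]E -[A d c]E -sumrB; apply: eq_bigr => i _.
by rewrite -sumrB; apply: eq_bigr => j _; rewrite !mxE mulrBr.
Qed.

Lemma op_of_wedge g T a b c d : g^T = g -> g \in unitmx -> (forall a b c d, T a b d c = - T a b c d) ->
  op_of g T (wedge g c d) a b = T a b c d.
Proof.
move=> gs gu Ts; rewrite mxE.
have -> : raise2 g (wedge g c d) = delta_mx c d - delta_mx d c.
  by rewrite raise2E// /wedge gs !mulmxA mulVmx// mul1mx -mulmxA mulmxV// mulmx1.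
by rewrite contract_wedge Ts; field.
Qed.

Lemma operator_tensor_ext g T L : g^T = g -> g \in unitmx -> operator_tensor T -> operator_tensor L ->
  (forall w, two_form w -> op_of g T w = op_of g L w) -> T = L.
Proof.
move=> gs gu [_ Ts _] [_ Ls _] H; do 4 (apply/funext => ?).
by rewrite -[LHS](op_of_wedge _ _ _ _ gs gu)// -[RHS](op_of_wedge _ _ _ _ gs gu)// H//; exact: two_form_wedge.
Qed.

Lemma two_form_op g T w : operator_tensor T -> two_form (op_of g T w).
Proof.
move=> [Ta _ _]; apply/matrixP => i j; rewrite !mxE -mulrN -sumrN; congr (_ * _).
apply: eq_bigr => c _; rewrite -sumrN; apply: eq_bigr => d _.
by rewrite Ta mulNr.
Qed.
End TwoForms.

Section OpLog.
Variables (R : realType) (n : nat).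
Implicit Types (g h P w v : 'M[R]_n) (T L : 'I_n -> 'I_n -> 'I_n -> 'I_n -> R).

Lemma orthonormal_frame_inverse g (E : 'M[R]_n) : E *m g *m E^T = 1%:M ->
  [/\ E \in unitmx, invmx g = E^T *m E & g = invmx E *m (invmx E)^T].
Proof.
move=> H; have [Eu gu] : E \in unitmx /\ E^T \in unitmx.
  by have := mulmx1_unit H; rewrite unitmx_mul => -[/andP[-> _] ->].
have gE : g = invmx E *m (invmx E)^T.
  rewrite trmx_inv; have := congr1 (fun X => invmx E *m X *m invmx E^T) H.
  by rewrite mulmx1 !mulmxA mulVmx// mul1mx -mulmxA mulmxV// mulmx1.
split=> //; have h := mulmx1C H; rewrite mulmxA in h.
have [_ ug] := mulmx1_unit h.
by rewrite -[LHS]mul1mx -h -(mulmxA (E^T *m E)) mulmxV// mulmx1.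
Qed.

Lemma op_of_scale g T a w : g^T = g -> op_of g T (a *: w) = a *: op_of g T w.
Proof.
move=> gs; have := @op_of_sum R n g T unit [:: tt] (fun=> a) (fun=> w) gs.
by rewrite !big_seq1.
Qed.

Lemma op_of_tr g T w : g^T = g -> operator_tensor T -> op_of g T w^T = - op_of g T w.
Proof.
move=> gs [_ Ts _]; apply/matrixP => a b; rewrite !mxE -mulrN; congr (_ * _).
have -> : raise2 g w^T = (raise2 g w)^T.
  by rewrite !raise2E// !trmx_mul invmx_sym// mulmxA.
rewrite exchange_big -sumrN; apply: eq_bigr => c _; rewrite -sumrN.
by apply: eq_bigr => d _; rewrite mxE Ts mulNr.
Qed.

Lemma form_dot_two_form_sym g v w : g^T = g -> v^T = v -> two_form w -> form_dot g v w = 0.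
Proof.
move=> gs vs ww; have : form_dot g v w = - form_dot g v w; last lra.
have -> : - form_dot g v w = form_dot g v^T w^T.
  by rewrite ww vs -[- w]scaleN1r form_dotZ// mulN1r.
rewrite !form_dotE// trmxK; congr (_ * _).
rewrite -[LHS]mxtrace_tr !trmx_mul trmxK !invmx_sym//.
by rewrite !mulmxA mxtrace_mulC !mulmxA.
Qed.

Lemma form_dot_frame g (E : 'M[R]_n) v w : g^T = g -> E *m g *m E^T = 1%:M ->
  form_dot g v w = 2^-1 * \sum_i \sum_j (E *m v *m E^T) i j * (E *m w *m E^T) i j.
Proof.
move=> gs /orthonormal_frame_inverse[_ gi _]; rewrite form_dotE// gi; congr (_ * _).
transitivity (\tr ((E *m v *m E^T) *m (E *m w *m E^T)^T)).
  by rewrite !trmx_mul trmxK -!mulmxA [in RHS]mxtrace_mulC !mulmxA.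
by apply: eq_bigr => i _; rewrite mxE; apply: eq_bigr => j _; rewrite [X in _ * X]mxE.
Qed.

(** The operator is diagonalized on the space of all n x n matrices, of dimension
    n^2, so that the indices stay simple.  It kills the symmetric matrices and is
    positive on the 2-forms; hence the eigenvectors of nonzero eigenvalue are
    2-forms, and those of eigenvalue 0 are orthogonal to all 2-forms.  The latter
    are replaced by 0, which changes no expansion of a 2-form; the factor 2 comes
    from the 1/2 in [form_dot]. *)
Lemma two_form_eigenframe g T : posmx g -> operator_tensor T -> op_posdef g T ->
  exists (J : finType) (k : J -> R) (w : J -> 'M[R]_n),
  (forall r, [/\ two_form (w r), 0 < k r & op_of g T (w r) = k r *: w r]) /\
  forall v, two_form v -> v = \sum_r (2 * form_dot g (w r) v) *: w r.
Proof.
move=> gp Tt Tp; have [gs _] := gp.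
have [E Eg] := orthonormal_frame gp; have [Eu gi gE] := orthonormal_frame_inverse Eg.
pose F := invmx E.
pose hat w := E *m w *m E^T; pose unhat w := F *m w *m F^T.
have hatK w : unhat (hat w) = w.
  by rewrite /unhat /hat /F !mulmxA mulVmx// mul1mx -mulmxA trmx_inv mulmxV ?unitmx_tr// mulmx1.
have unhatK w : hat (unhat w) = w.
  by rewrite /unhat /hat /F !mulmxA mulmxV// mul1mx -mulmxA trmx_inv mulVmx ?unitmx_tr// mulmx1.
have dotE v w : form_dot g v w = 2^-1 * \sum_p hat v p.1 p.2 * hat w p.1 p.2.
  by rewrite (form_dot_frame v w gs Eg) pair_big.
pose D (p : 'I_n * 'I_n) := unhat (delta_mx p.1 p.2).
have DE v : v = \sum_p hat v p.1 p.2 *: D p.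
  rewrite -[LHS]hatK {1}[hat v]matrix_sum_delta pair_big /= /unhat mulmx_sumr mulmx_suml.
  by apply: eq_bigr => p _; rewrite -scalemxAr -scalemxAl.
pose K p q := hat (op_of g T (D q)) p.1 p.2.
have dD p v : form_dot g (D p) v = 2^-1 * hat v p.1 p.2.
  rewrite dotE unhatK; congr (_ * _); rewrite (bigD1 p)//= big1 ?addr0.
    by rewrite mxE !eqxx mul1r.
  move=> [i j] /negbTE ijp; rewrite mxE /= -[_ && _]/((i, j) == (p.1, p.2)) -surjective_pairing ijp.
  by rewrite mul0r.
have Ks p q : K p q = K q p.
  have := form_dot_op (D p) (D q) gs Tt; rewrite dD form_dotC// dD /K => h.
  by have/(congr1 ( *%R 2)) := h; rewrite !mulrA mulfV// !mul1r.
have [k [W [W1 W2 W3]]] := spectral_fintype Ks.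
pose om r := unhat (\matrix_(i, j) W r (i, j)).
have hom r p : hat (om r) p.1 p.2 = W r p by rewrite unhatK mxE -surjective_pairing.
have hat_inj v w : (forall p : 'I_n * 'I_n, hat v p.1 p.2 = hat w p.1 p.2) -> v = w.
  by move=> H; rewrite [v]DE [w]DE; apply: eq_bigr => p _; rewrite H.
have hat_sum (J : finType) (c : J -> R) (x : J -> 'M[R]_n) i j :
    hat (\sum_r c r *: x r) i j = \sum_r c r * hat (x r) i j.
  rewrite /hat mulmx_sumr mulmx_suml summxE; apply: eq_bigr => r _.
  by rewrite -scalemxAr -scalemxAl mxE.
have hatZ a v i j : hat (a *: v) i j = a * hat v i j.
  by rewrite /hat -scalemxAr -scalemxAl mxE.
have eig r : op_of g T (om r) = k r *: om r.
  apply: hat_inj => p; rewrite hatZ hom -W3 [om r]DE op_of_sum// hat_sum.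
  by apply: eq_bigr => q _; rewrite hom mulrC.
have dom r v : 2 * form_dot g (om r) v = \sum_p W r p * hat v p.1 p.2.
  rewrite dotE mulrA mulfV// mul1r; apply: eq_bigr => p _.
  by rewrite hom.
have norm1 r : form_dot g (om r) (om r) = 2^-1.
  rewrite dotE; under eq_bigr do rewrite hom.
  by rewrite W1 eqxx mulr1.
have om0 r : om r != 0.
  apply/eqP => h; have := norm1 r; rewrite {2}h form_dot0// => /eqP.
  by rewrite eq_sym invr_eq0 pnatr_eq0.
have pos r : k r != 0 -> two_form (om r) /\ 0 < k r.
  move=> k0; have tw : two_form (om r).
    rewrite -[om r]scale1r -(mulVf k0) -scalerA -eig /two_form linearZ /=.
    by rewrite two_form_op// scalerN.
  split=> //; have := Tp _ tw (om0 r); rewrite eig form_dotZ// norm1.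
  by rewrite pmulr_lgt0 ?invr_gt0.
have zero r v : k r = 0 -> two_form v -> form_dot g (om r) v = 0.
  move=> k0 tv; apply: form_dot_two_form_sym => //.
  pose al := om r - (om r)^T.
  have tal : two_form al by rewrite /two_form /al linearB /= trmxK opprB.
  have op0 : op_of g T al = 0.
    have -> : al = (-1) *: (om r)^T + om r by rewrite scaleN1r addrC.
    by rewrite op_of_linear// op_of_tr// eig k0 scale0r oppr0 scaler0 addr0.
  apply/eqP; rewrite eq_sym -subr_eq0; apply/negPn/negP => al0.
  have := Tp _ tal al0; by rewrite op0 form_dot0// ltxx.
exists ('I_n * 'I_n)%type, (fun r => if k r == 0 then 1 else k r), (fun r => if k r == 0 then 0 else om r).
split=> [r|v tv].
  case: eqP => [k0|/eqP k0]; last by have [] := pos r k0; split.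
  split; [by rewrite /two_form trmx0 oppr0|exact: ltr01|].
  by rewrite scaler0; have := op_of_scale T 0 0 gs; rewrite !scale0r.
apply: hat_inj => q; rewrite hat_sum.
have vE : hat v q.1 q.2 = \sum_r (2 * form_dot g (om r) v) * hat (om r) q.1 q.2.
  under eq_bigr do rewrite dom hom mulr_suml.
  rewrite exchange_big /= (bigD1 q)//= [X in _ + X]big1 ?addr0 => [|p pq].
    under eq_bigr do rewrite mulrAC.
    by rewrite -mulr_suml W2 eqxx mul1r.
  under eq_bigr do rewrite mulrAC.
  by rewrite -mulr_suml W2 (negbTE pq) mul0r.
rewrite vE; apply: eq_bigr => r _; case: eqP => // k0.
by rewrite zero// mulr0 mul0r /hat mulmx0 mul0mx mxE mulr0.
Qed.

(** L is the sum of ln (k r) w r (x) w r over an orthogonal eigenframe of T.  For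
    an eigenvector v of eigenvalue l, only the w r with k r = l contribute. *)
Lemma is_op_log_exists g T : posmx g -> operator_tensor T -> op_posdef g T ->
  exists L, is_op_log g T L.
Proof.
move=> gp Tt Tp; have [gs _] := gp.
have [J [k [w [wP wE]]]] := two_form_eigenframe gp Tt Tp.
pose L a b c d := 2 * \sum_r ln (k r) * w r a b * w r c d.
have opL v : op_of g L v = \sum_r (ln (k r) * (2 * form_dot g (w r) v)) *: w r.
  apply/matrixP => a b; rewrite mxE summxE.
  have -> : \sum_c \sum_d L a b c d * raise2 g v c d =
      2 * \sum_r \sum_c \sum_d ln (k r) * w r a b * w r c d * raise2 g v c d.
    rewrite [in RHS]exchange_big mulr_sumr; apply: eq_bigr => c _.
    rewrite [in RHS]exchange_big mulr_sumr; apply: eq_bigr => d _ /=.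
    by rewrite /L -mulrA mulr_suml.
  rewrite mulrA mulVf// mul1r; apply: eq_bigr => r _; rewrite mxE /form_dot [2 * (_ * _)]mulrA mulfV// mul1r.
  rewrite mulrAC mulr_sumr; apply: eq_bigr => c _; rewrite mulr_sumr; apply: eq_bigr => d _.
  by rewrite mulrA.
exists L; split.
  split=> a b c d; rewrite /L ?mulr_sumr -?sumrN; apply: eq_bigr => r _; have [tw _ _] := wP r.
  - by rewrite (two_form_antisym a b tw); ring.
  - by rewrite (two_form_antisym c d tw); ring.
  - ring.
move=> v l tv vl; rewrite opL [in RHS](wE v tv) scaler_sumr; apply: eq_bigr => r _.
rewrite scalerA; congr (_ *: _).
have [tw kp wk] := wP r.
have e : l * form_dot g (w r) v = k r * form_dot g (w r) v.
  have := form_dot_op (w r) v gs Tt; rewrite vl wk form_dotZ// => ->.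
  by rewrite form_dotC// form_dotZ// form_dotC.
have [->|d0] := eqVneq (form_dot g (w r) v) 0; first by rewrite !mulr0.
by rewrite (mulIf d0 e).
Qed.

Lemma is_op_log_unique g T L L' : posmx g -> operator_tensor T -> op_posdef g T ->
  is_op_log g T L -> is_op_log g T L' -> L = L'.
Proof.
move=> gp Tt Tp [Lt HL] [Lt' HL']; have [gs _] := gp.
have [J [k [w [wP wE]]]] := two_form_eigenframe gp Tt Tp.
apply: (operator_tensor_ext gs (posmx_unit gp) Lt Lt') => v tv.
rewrite [in LHS](wE v tv) [in RHS](wE v tv) !op_of_sum//; apply: eq_bigr => r _.
by have [tw kp wk] := wP r; rewrite (HL _ _ tw wk) (HL' _ _ tw wk).
Qed.

Lemma op_logP g T : posmx g -> operator_tensor T -> op_posdef g T ->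
  is_op_log g T (op_log g T).
Proof.
move=> gp Tt Tp; have [L HL] := is_op_log_exists gp Tt Tp.
by rewrite /op_log; case: xgetP => [L' -> //|/(_ L)].
Qed.

Lemma op_log_eq g T L : posmx g -> operator_tensor T -> op_posdef g T ->
  is_op_log g T L -> op_log g T = L.
Proof. by move=> gp Tt Tp; apply: is_op_log_unique => //; exact: op_logP. Qed.
End OpLog.

(** In dimension 3 a curvature-like tensor has six independent components, as many
    as its Ricci tensor.  The 81 cases are checked; the 4 is 2 (n - 1). *)
Lemma dim3_schouten (R : realType) n (L : 'I_n -> 'I_n -> 'I_n -> 'I_n -> R) : n = 3%N ->
  (forall i j k l, L j i k l = - L i j k l) ->
  (forall i j k l, L i j l k = - L i j k l) ->
  (forall i j k l, L k l i j = L i j k l) ->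
  forall i j k l,
  let P i j := \sum_k L k i k j - (\sum_k \sum_l L k l k l) / 4 * (i == j)%:R in
  L i j k l = (i == k)%:R * P j l + P i k * (j == l)%:R
    - P i l * (j == k)%:R - (i == l)%:R * P j k.
Proof.
move=> n3; subst n => L1 L2 L3 i j k l P.
have L10 a c d : L a a c d = 0 by have := L1 a a c d; lra.
have L20 a c d : L c d a a = 0 by have := L2 c d a a; lra.
pose o0 : 'I_3 := ord0; pose o1 : 'I_3 := lift ord0 ord0; pose o2 : 'I_3 := lift ord0 (lift ord0 ord0).
have sum3 (f : 'I_3 -> R) : \sum_a f a = f o0 + (f o1 + f o2).
  by rewrite !big_ord_recl big_ord0 addr0.
have case3 (Q : 'I_3 -> Prop) : Q o0 -> Q o1 -> Q o2 -> forall a, Q a.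
  move=> q0 q1 q2 [[|[|[|//]]] h].
  - by rewrite (_ : Ordinal h = o0)//; exact: val_inj.
  - by rewrite (_ : Ordinal h = o1)//; exact: val_inj.
  - by rewrite (_ : Ordinal h = o2)//; exact: val_inj.
rewrite /P !sum3 {P}.
have A1 := L1 o0 o1; have A2 := L1 o0 o2; have A3 := L1 o1 o2.
have B1 a b := L2 a b o0 o1; have B2 a b := L2 a b o0 o2; have B3 a b := L2 a b o1 o2.
have C1 := L3 o0 o1 o0 o2; have C2 := L3 o0 o1 o1 o2; have C3 := L3 o0 o2 o1 o2.
elim/case3: i; elim/case3: j; elim/case3: k; elim/case3: l; rewrite ?L10 ?L20;
by rewrite ?(A1, A2, A3) ?(B1, B2, B3) ?(C1, C2, C3) /=; field.
Qed.

(** * The logarithm of an exterior square *)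

Section ExpLog.
Variables (R : realType) (n : nat).
Implicit Types (g h P w v X Y : 'M[R]_n) (T L : 'I_n -> 'I_n -> 'I_n -> 'I_n -> R).

Section Frame.
Variables (g E : 'M[R]_n).
Hypotheses (gp : posmx g) (Eg : E *m g *m E^T = 1%:M).

Let gs : g^T = g. Proof. by case: gp. Qed.
Let Eu : E \in unitmx. Proof. by case: (orthonormal_frame_inverse Eg). Qed.

Lemma frame_conj_inj X Y : E *m X *m E^T = E *m Y *m E^T -> X = Y.
Proof.
move=> H; have := congr1 (fun Z => invmx E *m Z *m invmx E^T) H.
by rewrite !mulmxA !mulVmx// !mul1mx -!mulmxA !mulmxV ?unitmx_tr// !mulmx1.
Qed.

Lemma frame_mul X Y : E *m (X *m invmx g *m Y) *m E^T = (E *m X *m E^T) *m (E *m Y *m E^T).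
Proof. by have [_ -> _] := orthonormal_frame_inverse Eg; rewrite !mulmxA. Qed.

Lemma frame_op_gauss h w : h^T = h -> two_form w ->
  E *m op_of g (gauss_tensor h) w *m E^T =
  (E *m h *m E^T) *m (E *m w *m E^T) *m (E *m h *m E^T).
Proof.
move=> hs tw; rewrite op_of_gauss_tensor// raise2E//.
by rewrite -!frame_mul !mulmxA.
Qed.

Lemma frame_op_kn P w : P^T = P -> two_form w ->
  E *m op_of g (kulkarni_nomizu g P) w *m E^T =
  (E *m w *m E^T) *m (E *m P *m E^T) + (E *m P *m E^T) *m (E *m w *m E^T).
Proof.
move=> Ps tw; rewrite op_of_kulkarni_nomizu ?posmx_unit//.
by rewrite mulmxDr mulmxDl !frame_mul.
Qed.

Lemma frame_unconj (d : 'rV[R]_n) :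
  E *m (invmx E *m diag_mx d *m (invmx E)^T) *m E^T = diag_mx d.
Proof. by rewrite !mulmxA mulmxV// mul1mx -mulmxA trmx_inv mulVmx ?unitmx_tr// mulmx1. Qed.

Lemma frame_diag_sym (d : 'rV[R]_n) :
  (invmx E *m diag_mx d *m (invmx E)^T)^T = invmx E *m diag_mx d *m (invmx E)^T.
Proof. by rewrite !trmx_mul trmxK tr_diag_mx mulmxA. Qed.

Lemma frame_posmx h (d : 'rV[R]_n) : h^T = h -> E *m h *m E^T = diag_mx d ->
  (forall i, 0 < d 0 i) -> posmx h.
Proof.
move=> hs hd dp; split=> // v v0.
have hE : h = invmx E *m diag_mx d *m (invmx E)^T.
  by apply: frame_conj_inj; rewrite frame_unconj.
pose u := v *m invmx E.
have -> : v *m h *m v^T = u *m diag_mx d *m u^T.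
  by rewrite hE /u trmx_mul !mulmxA.
have u0 : u != 0.
  apply: contra v0 => /eqP h0; have := congr1 (fun Z : 'rV[R]_n => Z *m E) h0.
  by rewrite /u mul0mx -mulmxA mulVmx// mulmx1 => ->.
have uE : (u *m diag_mx d *m u^T) 0 0 = \sum_i d 0 i * u 0 i ^+ 2.
  by rewrite mul_mx_diag mxE; apply: eq_bigr => i _; rewrite !mxE expr2; ring.
rewrite uE lt_neqAle eq_sym; apply/andP; split; last first.
  by apply: sumr_ge0 => i _; rewrite mulr_ge0 ?sqr_ge0// ltW.
apply: contra u0; rewrite psumr_eq0 => [/allP H|i _]; last by rewrite mulr_ge0 ?sqr_ge0// ltW.
apply/eqP/rowP => i; rewrite [RHS]mxE; have := H i (mem_index_enum i).
by rewrite implyTb mulf_eq0 gt_eqF //= sqrf_eq0 => /eqP.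
Qed.

Lemma posmx_frame h (d : 'rV[R]_n) i : posmx h -> E *m h *m E^T = diag_mx d -> 0 < d 0 i.
Proof.
move=> [_ hp] hd; have := hp (row i E).
have -> : (row i E *m h *m (row i E)^T) 0 0 = d 0 i.
  have <- : (E *m h *m E^T) i i = d 0 i by rewrite hd mxE eqxx mulr1n.
  by rewrite -row_mul !mxE; apply: eq_bigr => k _; rewrite !mxE.
apply; apply/eqP => h0; have := congr1 (fun Z : 'rV[R]_n => Z *m invmx E) h0.
rewrite -row_mul mulmxV// mul0mx => /rowP/(_ i); rewrite !mxE eqxx => /eqP.
by rewrite oner_eq0.
Qed.

(** The partial sums of the exponential series of a matrix diagonalized by E are
    combinations of the projectors X i on the lines of the frame, with the partial
    sums of scalar exponential series as coefficients. *)
Lemma frame_mexp (d : 'rV[R]_n) :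
  exp_lower g (invmx E *m diag_mx d *m (invmx E)^T) =
  invmx E *m diag_mx (map_mx expR d) *m (invmx E)^T.
Proof.
have [_ giE gE] := orthonormal_frame_inverse Eg.
rewrite /exp_lower.
have -> : invmx E *m diag_mx d *m (invmx E)^T *m invmx g = invmx E *m diag_mx d *m E.
  by rewrite giE !mulmxA -(mulmxA _ (invmx E)^T) trmx_inv mulVmx ?unitmx_tr// mulmx1.
suff -> : mexp (invmx E *m diag_mx d *m E) = invmx E *m diag_mx (map_mx expR d) *m E.
  rewrite [X in _ *m X]gE !mulmxA -(mulmxA _ E) mulmxV// mulmx1.
  by [].
pose X i : 'M[R]_n := invmx E *m delta_mx i i *m E.
have diagE (c : 'rV[R]_n) : invmx E *m diag_mx c *m E = \sum_i c 0 i *: X i.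
  rewrite diag_mx_sum_delta mulmx_sumr mulmx_suml; apply: eq_bigr => i _.
  by rewrite -scalemxAr -scalemxAl.
have powE k : (invmx E *m diag_mx d *m E) ^+ k = invmx E *m diag_mx (\row_i d 0 i ^+ k) *m E.
  elim: k => [|k IH].
    rewrite expr0 (_ : diag_mx _ = 1%:M) ?mulmx1 ?mulVmx//.
    by apply/matrixP => i j; rewrite !mxE expr0.
  rewrite exprS IH -[LHS]/(_ *m _) !mulmxA -(mulmxA _ E) mulmxV// mulmx1.
  rewrite -(mulmxA _ (diag_mx d)) mulmx_diag; congr (_ *m diag_mx _ *m _).
  by apply/rowP => i; rewrite !mxE exprS.
have serE K : series (fun k : nat => (k`!%:R)^-1 *: (invmx E *m diag_mx d *m E) ^+ k) K =
    \sum_i series (exp_coeff (d 0 i)) K *: X i.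
  rewrite /series /=; under eq_bigr do rewrite powE diagE scaler_sumr.
  rewrite exchange_big /=; apply: eq_bigr => i _; rewrite scaler_suml.
  by apply: eq_bigr => k _; rewrite scalerA mxE /exp_coeff /= mulrC.
rewrite /mexp [RHS]diagE; apply: cvg_lim; first exact: norm_hausdorff.
rewrite (_ : series _ = fun K => \sum_i series (exp_coeff (d 0 i)) K *: X i); last first.
  by apply/funext => K; exact: serE.
elim: (index_enum _) => [|i s IH].
  by rewrite big_nil; under eq_fun do rewrite big_nil; exact: cvg_cst.
rewrite big_cons; under eq_fun do rewrite big_cons.
apply: cvgD; last exact: IH.
apply: cvgZ; last exact: cvg_cst.
by rewrite mxE; exact: is_cvg_series_exp_coeff.
Qed.

(** In the frame E, the exterior square of h multiplies the (i, j) entry of a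
    2-form by d_i d_j, and the Kulkarni-Nomizu product with ln h multiplies it by
    ln d_i + ln d_j.  A 2-form is an eigenvector if all its nonzero entries have
    the same multiplier. *)
Lemma is_op_log_gauss h (d : 'rV[R]_n) : h^T = h -> E *m h *m E^T = diag_mx d ->
  (forall i, 0 < d 0 i) ->
  is_op_log g (gauss_tensor h)
    (kulkarni_nomizu g (invmx E *m diag_mx (map_mx (@ln R) d) *m (invmx E)^T)).
Proof.
move=> hs hd dp; set P := invmx E *m _ *m _.
have Ps : P^T = P by exact: frame_diag_sym.
split; first exact: operator_tensor_kulkarni_nomizu.
move=> w k tw wk; apply: frame_conj_inj; rewrite frame_op_kn// frame_unconj.
rewrite -scalemxAr -scalemxAl.
have := congr1 (fun X => E *m X *m E^T) wk; rewrite frame_op_gauss// hd -scalemxAr -scalemxAl.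
move: (E *m w *m E^T) => v /matrixP vk; apply/matrixP => i j.
have := vk i j; rewrite mul_mx_diag mul_diag_mx mul_mx_diag mul_diag_mx !mxE.
have [->|v0] := eqVneq (v i j) 0; first by rewrite !(mulr0, mul0r) addr0.
have -> : d 0 i * v i j * d 0 j = d 0 i * d 0 j * v i j by ring.
move=> /(mulIf v0) <-; rewrite lnM ?posrE//; ring.
Qed.

(** The converse of [is_op_log_gauss]: on each eigenvector of T the logarithm of
    the eigenvalue is d_i + d_j wherever the (i, j) entry is nonzero, hence the
    eigenvalue is exp d_i exp d_j. *)
Lemma gauss_of_log T (d : 'rV[R]_n) : operator_tensor T -> op_posdef g T ->
  is_op_log g T (kulkarni_nomizu g (invmx E *m diag_mx d *m (invmx E)^T)) ->
  T = gauss_tensor (invmx E *m diag_mx (map_mx expR d) *m (invmx E)^T).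
Proof.
move=> Tt Tp [_ HL]; set h := invmx E *m _ *m _.
have hs : h^T = h by exact: frame_diag_sym.
set P := invmx E *m _ *m _ in HL; have Ps : P^T = P by exact: frame_diag_sym.
apply: (operator_tensor_ext gs (posmx_unit gp) Tt (operator_tensor_gauss hs)) => v tv.
have [J [k [w [wP wE]]]] := two_form_eigenframe gp Tt Tp.
rewrite [in LHS](wE v tv) [in RHS](wE v tv) !op_of_sum//; apply: eq_bigr => r _.
have [tw kp wk] := wP r; congr (_ *: _).
have lk := HL _ _ tw wk; rewrite wk; apply: frame_conj_inj; rewrite frame_op_gauss// frame_unconj.
have := congr1 (fun X => E *m X *m E^T) lk; rewrite frame_op_kn// frame_unconj.
rewrite -!scalemxAr -!scalemxAl.
move: (E *m w r *m E^T) => u /matrixP uk; apply/matrixP => i j.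
have := uk i j; rewrite mul_mx_diag mul_diag_mx mul_mx_diag mul_diag_mx !mxE.
have [->|u0] := eqVneq (u i j) 0; first by rewrite !(mulr0, mul0r).
have -> : u i j * d 0 j + d 0 i * u i j = (d 0 i + d 0 j) * u i j by ring.
move=> /(mulIf u0) e; have -> : expR (d 0 i) * u i j * expR (d 0 j) = expR (d 0 i + d 0 j) * u i j.
  by rewrite expRD; ring.
by rewrite e lnK.
Qed.

End Frame.

Theorem op_log_gauss g h : (3 <= n)%N -> posmx g -> posmx h -> op_posdef g (gauss_tensor h) ->
  exists2 P, P^T = P & op_log g (gauss_tensor h) = kulkarni_nomizu g P /\ exp_lower g P = h.
Proof.
move=> n3 gp hp Tp; have [hs _] := hp; have [gs _] := gp.
have [E [d [Eg Eh]]] := simultaneous_diagonalization gp hs.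
have dp i : 0 < d 0 i by exact: (posmx_frame Eg _ hp Eh).
exists (invmx E *m diag_mx (map_mx (@ln R) d) *m (invmx E)^T); first exact: frame_diag_sym.
split.
  apply: op_log_eq => //; first exact: operator_tensor_gauss.
  exact: is_op_log_gauss.
rewrite (frame_mexp Eg); apply: (frame_conj_inj Eg); rewrite (frame_unconj Eg) Eh.
by congr diag_mx; apply/rowP => i; rewrite !mxE lnK ?posrE//.
Qed.

Theorem gauss_of_weyl_eq0 g T : posmx g -> operator_tensor T -> op_posdef g T ->
  (forall a b c d, weyl g (op_log g T) a b c d = 0) ->
  posmx (exp_lower g (schouten g (op_log g T))) /\
  T = gauss_tensor (exp_lower g (schouten g (op_log g T))).
Proof.
move=> gp Tt Tp W0; have [gs _] := gp.
have HL := op_logP gp Tt Tp; have Lt := HL.1.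
have LE := weyl_eq0E W0.
move: (op_log g T) HL Lt LE {W0} => L HL Lt LE.
have Ps := schouten_sym gs Lt; move: (schouten g L) LE Ps => P LE Ps.
have [E [d [Eg EP]]] := simultaneous_diagonalization gp Ps.
have PE : P = invmx E *m diag_mx d *m (invmx E)^T.
  by apply: (frame_conj_inj Eg); rewrite (frame_unconj Eg).
rewrite PE (frame_mexp Eg); split.
  apply: (frame_posmx Eg (d := map_mx expR d)); first exact: frame_diag_sym.
    exact: (frame_unconj Eg).
  by move=> i; rewrite mxE expR_gt0.
by apply: (gauss_of_log gp Eg) => //; rewrite -PE -LE.
Qed.

(** On e_i /\ e_j the exterior square of h takes the value d_i d_j > 0, so the
    eigenvalues of h have the same sign. *)
Lemma gauss_definite g h : (1 < n)%N -> posmx g -> h^T = h -> op_posdef g (gauss_tensor h) ->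
  posmx h \/ posmx (- h).
Proof.
move=> n1 gp hs Tp; have [gs _] := gp.
have [E [d [Eg Eh]]] := simultaneous_diagonalization gp hs.
have dd i j : i != j -> 0 < d 0 i * d 0 j.
  move=> ij; pose w := wedge (invmx E) i j.
  have tw : two_form w by exact: two_form_wedge.
  have [Eu _ _] := orthonormal_frame_inverse Eg.
  have wh : E *m w *m E^T = delta_mx i j - delta_mx j i.
    rewrite /w /wedge !mulmxA mulmxV// mul1mx -mulmxA trmx_inv mulVmx ?unitmx_tr// mulmx1.
    by [].
  have w0 : w != 0.
    apply/eqP => h0; move: wh; rewrite h0 mulmx0 mul0mx => /matrixP/(_ i j).
    rewrite !mxE !eqxx (negbTE ij) /= subr0 => /eqP.
    by rewrite eq_sym oner_eq0.
  have := Tp w tw w0; rewrite (form_dot_frame _ _ gs Eg) (frame_op_gauss gp Eg)// Eh wh.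
  have E1 a b : (delta_mx i j - delta_mx j i : 'M[R]_n) a b *
     (diag_mx d *m (delta_mx i j - delta_mx j i) *m diag_mx d) a b =
     (d 0 a * d 0 b * (delta_mx i j - delta_mx j i : 'M[R]_n) a b) *
     (delta_mx i j - delta_mx j i : 'M[R]_n) a b.
    rewrite mul_mx_diag mul_diag_mx !mxE; ring.
  under eq_bigr do under eq_bigr do rewrite E1.
  rewrite contract_wedge !mxE !eqxx (negbTE ij) eq_sym (negbTE ij) /=.
  move: (d 0 i) (d 0 j) => x y.
  by rewrite [X in 0 < X -> _](_ : _ = x * y)//; field.
pose i0 := Ordinal (ltnW n1); pose i1 := Ordinal n1.
have i01 : i0 != i1 by [].
case: (ltgtP (d 0 i0) 0) => [d0|d0|d0]; last by have := dd _ _ i01; rewrite d0 mul0r ltxx.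
- right; apply: (frame_posmx Eg (d := - d)).
  + by rewrite linearN /= hs.
  + by rewrite mulmxN mulNmx Eh; apply/matrixP => i j; rewrite !mxE mulNrn.
  move=> i; rewrite mxE oppr_gt0; have [->//|ii] := eqVneq i i0.
  by have := dd _ _ ii; rewrite nmulr_lgt0.
- left; apply: (frame_posmx Eg hs Eh) => i; have [->//|ii] := eqVneq i i0.
  by have := dd _ _ ii; rewrite pmulr_lgt0.
Qed.

(** Transports [dim3_schouten] to an orthonormal frame, where g is the identity. *)
Lemma weyl_dim3 g T : n = 3%N -> posmx g -> operator_tensor T ->
  forall a b c d, weyl g T a b c d = 0.
Proof.
move=> n3 gp Tt; have [gs _] := gp.
have [E Eg] := orthonormal_frame gp; have [Eu giE gE] := orthonormal_frame_inverse Eg.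
pose F := invmx E.
have hatw i j : E *m wedge F i j *m E^T = delta_mx i j - delta_mx j i.
  by rewrite /wedge !mulmxA mulmxV// mul1mx -mulmxA trmx_inv mulVmx ?unitmx_tr// mulmx1.
have [M ME] : exists M : 'I_n -> 'I_n -> 'M[R]_n, forall k l, M k l = E *m op_of g T (wedge F k l) *m E^T.
  by eexists.
have Mdot i j k l : M k l i j = form_dot g (wedge F i j) (op_of g T (wedge F k l)).
  rewrite (form_dot_frame _ _ gs Eg) hatw -ME.
  under eq_bigr do under eq_bigr do rewrite mulrC.
  rewrite contract_wedge.
  have tM : two_form (M k l).
    by rewrite /two_form ME !trmx_mul trmxK two_form_op// mulNmx mulmxN mulmxA.
  by rewrite (two_form_antisym i j tM); field.
have wa i j : wedge F j i = (-1) *: wedge F i j.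
  by rewrite scaleN1r /wedge -mulNmx -mulmxN opprB.
pose L i j k l := M k l i j.
have L1 i j k l : L j i k l = - L i j k l.
  by rewrite /L !Mdot (wa i j) (form_dotC _ _ gs) (form_dotZ _ _ _ gs) (form_dotC _ _ gs) mulN1r.
have L2 i j k l : L i j l k = - L i j k l.
  by rewrite /L !Mdot (wa k l) (op_of_scale _ _ _ gs) (form_dotZ _ _ _ gs) mulN1r.
have L3 i j k l : L k l i j = L i j k l.
  by rewrite /L !Mdot (form_dot_op _ _ gs Tt) (form_dotC _ _ gs).
pose P := \matrix_(i, j) (\sum_k L k i k j - (\sum_k \sum_l L k l k l) / 4 * (i == j)%:R).
have Ps : P^T = P.
  apply/matrixP => i j; rewrite !mxE eq_sym; congr (_ - _).
  by apply: eq_bigr => k _; rewrite L3.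
have LP i j k l : L i j k l = (i == k)%:R * P j l + P i k * (j == l)%:R
    - P i l * (j == k)%:R - (i == l)%:R * P j k.
  by rewrite !mxE; exact: dim3_schouten.
clearbody P.
pose PP := F *m P *m F^T.
have PPs : PP^T = PP by rewrite /PP !trmx_mul trmxK Ps mulmxA.
have hatP : E *m PP *m E^T = P.
  by rewrite /PP !mulmxA mulmxV// mul1mx -mulmxA trmx_inv mulVmx ?unitmx_tr// mulmx1.
suff -> : T = kulkarni_nomizu g PP.
  by move=> a b c d; apply: weyl_kulkarni_nomizu; rewrite ?n3// posmx_unit.
apply: (operator_tensor_ext gs (posmx_unit gp) Tt (operator_tensor_kulkarni_nomizu gs PPs)) => v tv.
have vE : v = \sum_(p : 'I_n * 'I_n) (2^-1 * (E *m v *m E^T) p.1 p.2) *: wedge F p.1 p.2.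
  apply: (frame_conj_inj Eg); rewrite mulmx_sumr mulmx_suml.
  have th : two_form (E *m v *m E^T) by rewrite /two_form !trmx_mul trmxK tv mulNmx mulmxN mulmxA.
  move: (E *m v *m E^T) th => u tu.
  under eq_bigr do rewrite -scalemxAr -scalemxAl hatw.
  rewrite -(pair_big_dep xpredT (fun _ => xpredT) (fun i j => (2^-1 * u i j) *: (delta_mx i j - delta_mx j i))) /=.
  apply/matrixP => a b; rewrite summxE; under eq_bigr do rewrite summxE.
  have E1 i j : ((2^-1 * u i j) *: (delta_mx i j - delta_mx j i : 'M[R]_n)) a b =
    (2^-1 * u i j) * (delta_mx a b - delta_mx b a : 'M[R]_n) i j.
    by rewrite !mxE (eq_sym a i) (eq_sym b j) (eq_sym a j) (eq_sym b i) [(j == a) && _]andbC.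
  under eq_bigr do under eq_bigr do rewrite E1.
  by rewrite contract_wedge (two_form_antisym a b tu); field.
rewrite [in LHS]vE [in RHS]vE !op_of_sum//; apply: eq_bigr => -[k l] _ /=; congr (_ *: _).
apply: (frame_conj_inj Eg); rewrite (frame_op_kn gp Eg)//; last exact: two_form_wedge.
rewrite hatw hatP; apply/matrixP => i j.
rewrite -ME -[LHS]/(L i j k l) LP [RHS]mxE.
have E1 : ((delta_mx k l - delta_mx l k) *m P) i j = (i == k)%:R * P l j - (i == l)%:R * P k j.
  rewrite mulmxBl !mxE.
  have dP a b : \sum_j0 (delta_mx a b : 'M[R]_n) i j0 * P j0 j = (i == a)%:R * P b j.
    rewrite (bigD1 b)//= big1 ?addr0 => [|c cb]; first by rewrite mxE eqxx andbT.
    by rewrite mxE (negbTE cb) andbF mul0r.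
  by rewrite !dP.
have E2 : (P *m (delta_mx k l - delta_mx l k)) i j = P i k * (j == l)%:R - P i l * (j == k)%:R.
  rewrite mulmxBr !mxE.
  have dP a b : \sum_j0 P i j0 * (delta_mx a b : 'M[R]_n) j0 j = P i a * (j == b)%:R.
    rewrite (bigD1 a)//= big1 ?addr0 => [|c cb]; first by rewrite mxE eqxx.
    by rewrite mxE (negbTE cb) mulr0.
  by rewrite !dP.
rewrite E1 E2; have PE a b : P b a = P a b by rewrite -[in LHS]Ps mxE.
by rewrite (PE j l) (PE j k); ring.
Qed.
End ExpLog.

(** * Curvature of a metric connection *)

Lemma mx_entryE (V : pzRingType) m n :
  (forall (X Y : 'M[V]_(m, n)) i j, (X + Y) i j = X i j + Y i j) *
  (forall (X : 'M[V]_(m, n)) i j, (- X) i j = - X i j).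
Proof. by split=> *; rewrite mxE. Qed.

(** The hypothesis is contracted with the inverse of h in the indices b and d.
    With kap_c the trace of Q, this gives
    (n - 3) Q_akc = kap_c h_ak - kap_k h_ac; a second contraction gives
    (2 n - 4) kap = 0, hence Q = 0 when n > 3. *)
Lemma codazzi_algebra (R : realType) n (h : 'M[R]_n) (Q : 'I_n -> 'I_n -> 'I_n -> R) :
  (3 < n)%N -> h^T = h -> h \in unitmx -> (forall a k c, Q a c k = - Q a k c) ->
  (forall a b k c d, Q a k c * h b d + Q a c d * h b k + Q a d k * h b c
     - (Q b k c * h a d + Q b c d * h a k + Q b d k * h a c) = 0) ->
  forall a k c, Q a k c = 0.
Proof.
move=> n3 hs hu Qa H.
pose Hi := invmx h; have his : Hi^T = Hi by rewrite /Hi trmx_inv hs.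
have HiE p q : Hi p q = Hi q p by rewrite -[in LHS]his mxE.
have D1 d k : \sum_b Hi d b * h b k = (d == k)%:R.
  by have /matrixP/(_ d k) := mulVmx hu; rewrite !mxE.
have D2 a b : \sum_d h a d * Hi d b = (a == b)%:R.
  by have /matrixP/(_ a b) := mulmxV hu; rewrite !mxE.
have delta (f : 'I_n -> R) k : \sum_d f d * (d == k)%:R = f k.
  rewrite (bigD1 k)//= big1 ?addr0 => [|d dk]; first by rewrite eqxx mulr1.
  by rewrite (negbTE dk) mulr0.
pose kap c := \sum_b \sum_d Hi d b * Q b c d.
have tr : \sum_b \sum_d Hi d b * h b d = n%:R.
  rewrite exchange_big /= -[RHS](_ : \sum_(d < n) 1 = n%:R); last by rewrite sumr_const card_ord.
  by apply: eq_bigr => d _; rewrite D1 eqxx.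
have E1 a k c : n%:R * Q a k c + Q a c k + Q a c k - (Q a k c + kap c * h a k - kap k * h a c) = 0.
  transitivity (\sum_b \sum_d Hi d b * (Q a k c * h b d + Q a c d * h b k + Q a d k * h b c
     - (Q b k c * h a d + Q b c d * h a k + Q b d k * h a c))); last first.
    by rewrite big1// => b _; rewrite big1// => d _; rewrite H mulr0.
  have t1 : n%:R * Q a k c = \sum_b \sum_d Hi d b * (Q a k c * h b d).
    rewrite -tr mulr_suml; apply: eq_bigr => b _; rewrite mulr_suml.
    by apply: eq_bigr => d _; ring.
  have t2 (f : 'I_n -> R) j : f j = \sum_b \sum_d Hi d b * (f d * h b j).
    rewrite -[LHS]delta exchange_big /=; apply: eq_bigr => d _.
    by rewrite -D1 mulr_sumr; apply: eq_bigr => b _; ring.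
  have t4 : Q a k c = \sum_b \sum_d Hi d b * (Q b k c * h a d).
    rewrite -[LHS](delta (fun b => Q b k c)); apply: eq_bigr => b _.
    by rewrite eq_sym -D2 mulr_sumr; apply: eq_bigr => d _; ring.
  have t5 : kap c * h a k = \sum_b \sum_d Hi d b * (Q b c d * h a k).
    by rewrite /kap mulr_suml; apply: eq_bigr => b _; rewrite mulr_suml; apply: eq_bigr => d _; ring.
  have t6 : - (kap k * h a c) = \sum_b \sum_d Hi d b * (Q b d k * h a c).
    rewrite /kap mulr_suml -sumrN; apply: eq_bigr => b _; rewrite mulr_suml -sumrN.
    by apply: eq_bigr => d _; rewrite (Qa b k d); ring.
  rewrite [in X in X + _ + _ - _]t1 [X in _ + X + _ - _](t2 (fun d => Q a c d) k).
  rewrite [X in _ + _ + X - _](t2 (fun d => Q a d k) c) [X in _ - (X + _ - _)]t4 t5 t6.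
  rewrite -!big_split -sumrB; apply: eq_bigr => b _ /=.
  by rewrite -!big_split -sumrB; apply: eq_bigr => d _ /=; ring.
have kap0 k : kap k = 0.
  have : (2 * n%:R - 4) * kap k = 0.
    have : \sum_a \sum_c Hi c a * (n%:R * Q a k c + Q a c k + Q a c k
       - (Q a k c + kap c * h a k - kap k * h a c)) = 0.
      by rewrite big1// => a _; rewrite big1// => c _; rewrite E1 mulr0.
    have s1 : \sum_a \sum_c Hi c a * (kap c * h a k) = kap k.
      rewrite exchange_big -[RHS]delta; apply: eq_bigr => c _.
      by rewrite -D1 mulr_sumr; apply: eq_bigr => a _; ring.
    have s2 : \sum_a \sum_c Hi c a * (kap k * h a c) = kap k * n%:R.
      rewrite -tr mulr_sumr; apply: eq_bigr => a _; rewrite mulr_sumr.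
      by apply: eq_bigr => c _; ring.
    move=> H0; rewrite -[RHS]H0.
    have -> : (2 * n%:R - 4) * kap k = (n%:R - 3) * kap k - kap k + kap k * n%:R by ring.
    rewrite -[in X in _ - X + _]s1 -s2 {1}/kap mulr_sumr -sumrB -big_split; apply: eq_bigr => a _ /=.
    rewrite mulr_sumr -sumrB -big_split; apply: eq_bigr => c _ /=.
    by rewrite (Qa a k c); ring.
  move/eqP; rewrite mulf_eq0 => /orP[|/eqP//].
  have -> : 2 * n%:R - 4 = 2 * (n%:R - 2) :> R by ring.
  by rewrite mulf_eq0 pnatr_eq0 /= subr_eq0 eqr_nat => /eqP n2; rewrite n2 in n3.
move=> a k c; have := E1 a k c; rewrite !kap0 (Qa a k c) !mul0r.
have n3' : n%:R - 3 != 0 :> R by rewrite subr_eq0 eqr_nat gtn_eqF.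
move=> E; apply: (mulfI n3'); rewrite mulr0; move: E; lra.
Qed.

(** The identities of this part are proved for any symmetric connection G
    compatible with g; the Christoffel symbols enter only later.  In matrix
    form, with A_k the matrix of the G^e_kb, the curvature is
    F_cd = d_c A_d - d_d A_c + [A_c, A_d]. *)
Section Connection.
Variables (R : realType) (n : nat) (U : set 'rV[R]_n) (g : 'rV[R]_n -> 'M[R]_n).
Variable G : 'I_n -> 'I_n -> 'I_n -> 'rV[R]_n -> R.
Hypotheses (oU : open U) (symg : forall x a b, U x -> g x a b = g x b a).
Hypothesis sg : forall a b, smooth_on U (fun x => g x a b).
Hypothesis sG : forall c a b, smooth_on U (G c a b).
Hypothesis symG : forall c a b x, U x -> G c a b x = G c b a x.
Hypothesis compatG : forall k a b x, U x ->
  partial k (fun y => g y a b) x =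
  \sum_e G e k a x * g x e b + \sum_e g x a e * G e k b x.

Definition curvature (a b c d : 'I_n) : 'rV[R]_n -> R := fun x =>
  partial c (G a d b) x - partial d (G a c b) x
  + \sum_e (G a c e x * G e d b x - G a d e x * G e c b x).

Definition connection_mx k (x : 'rV[R]_n) : 'M[R]_n := \matrix_(e, b) G e k b x.
Definition connection_dmx l k (x : 'rV[R]_n) : 'M[R]_n := \matrix_(e, b) partial l (G e k b) x.
Definition curvature_mx c d (x : 'rV[R]_n) : 'M[R]_n := \matrix_(e, b) curvature e b c d x.

Local Notation A := connection_mx.
Local Notation dA := connection_dmx.
Local Notation F := curvature_mx.

Lemma connection_mxE k x e b : A k x e b = G e k b x.
Proof. by rewrite mxE. Qed.

Lemma connection_dmxE l k x e b : dA l k x e b = partial l (G e k b) x.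
Proof. by rewrite mxE. Qed.

Lemma curvature_mxE c d x :
  F c d x = dA c d x - dA d c x + (A c x *m A d x - A d x *m A c x).
Proof.
apply/matrixP => e b; rewrite !mxE /curvature; congr (_ + _).
by rewrite -sumrB; apply: eq_bigr => k _; rewrite !mxE.
Qed.

Lemma metric_compat_mx k x : U x ->
  \matrix_(a, b) partial k (fun y => g y a b) x = (A k x)^T *m g x + g x *m A k x.
Proof.
move=> Ux; apply/matrixP => a b; rewrite !mxE compatG//.
by congr (_ + _); apply: eq_bigr => e _; rewrite !mxE.
Qed.

Let diffG c a b x : U x -> differentiable (G c a b) x.
Proof. by move=> Ux; exact: smooth_on_differentiable (sG c a b) Ux. Qed.

Let diffg a b x : U x -> differentiable (fun y => g y a b) x.
Proof. by move=> Ux; exact: smooth_on_differentiable (sg a b) Ux. Qed.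

Lemma smooth_curvature a b c d : smooth_on U (curvature a b c d).
Proof.
apply: smooth_onD => //.
  by apply: smooth_onB => //; apply: smooth_on_partial; exact: sG.
by apply: smooth_on_sum => // e _; apply: smooth_onB => //; apply: smooth_onM => //; exact: sG.
Qed.

Lemma metric_partial2 c d x : U x ->
  \matrix_(a, b) partial c (partial d (fun y => g y a b)) x =
  (dA c d x)^T *m g x + (A d x)^T *m ((A c x)^T *m g x + g x *m A c x)
  + ((A c x)^T *m g x + g x *m A c x) *m A d x + g x *m dA c d x.
Proof.
move=> Ux; rewrite -!(metric_compat_mx _ Ux); apply/matrixP => a b; rewrite !mxE.
rewrite (@open_partial_eq _ _ c U (partial d (fun y => g y a b))
  (fun y => \sum_e G e d a y * g y e b + \sum_e g y a e * G e d b y)) //; last first.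
  by move=> y Uy; exact: compatG.
rewrite partialD; [|apply: differentiable_bigsum => e; apply: differentiableM; by [exact: diffG|exact: diffg]..].
rewrite !partial_sum; [|move=> e; apply: differentiableM; by [exact: diffG|exact: diffg]..].
have dM (P Q : 'rV[R]_n -> R) : differentiable P x -> differentiable Q x ->
  partial c (fun y => P y * Q y) x = partial c P x * Q x + P x * partial c Q x by exact: partialM.
rewrite -addrA; congr (_ + _).
  rewrite -big_split; apply: eq_bigr => e _; rewrite dM ?mxE//.
    exact: diffG.
  exact: diffg.
rewrite -big_split; apply: eq_bigr => e _; rewrite dM ?mxE//.
  exact: diffg.
exact: diffG.
Qed.

(** The metric is parallel and its second derivatives commute; their commutator is
    F^T g + g F. *)
Lemma curvature_mx_antisym c d x : U x -> (F c d x)^T *m g x = - (g x *m F c d x).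
Proof.
move=> Ux; have gs : (g x)^T = g x by apply/matrixP => a b; rewrite mxE symg.
have : \matrix_(a, b) partial c (partial d (fun y => g y a b)) x =
       \matrix_(a, b) partial d (partial c (fun y => g y a b)) x.
  apply: eq_mx => a b; exact: (@partialC R n c d U _ x oU (sg a b) Ux).
move=> H0; have := etrans (esym (metric_partial2 c d Ux)) (etrans H0 (metric_partial2 d c Ux)).
move=> {H0}; rewrite (curvature_mxE c d x).
move: (dA c d x) (dA d c x) (A c x) (A d x) => X Y P Q H.
apply/eqP; rewrite -subr_eq0 opprK; apply/eqP.
rewrite !(linearD, linearN) /= !trmx_mul.
move: H; rewrite !(mulmxDl, mulmxDr, mulmxN, mulNmx) !mulmxA => /matrixP H.
apply/matrixP => a b; have := H a b; rewrite !mx_entryE [X in _ -> _ = X]mxE.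
by lra.
Qed.

(** The second derivatives of A cancel in pairs, and the brackets by the Jacobi
    identity. *)
Lemma second_bianchi_mx k c d x : U x ->
  let dF k c d := \matrix_(e, b) partial k (fun y => F c d y e b) x in
  (dF k c d + (A k x *m F c d x - F c d x *m A k x))
  + (dF c d k + (A c x *m F d k x - F d k x *m A c x))
  + (dF d k c + (A d x *m F k c x - F k c x *m A d x)) = 0.
Proof.
move=> Ux dF.
pose ddA k l m := \matrix_(e, b) partial k (partial l (G e m b)) x.
have ddC i j l : ddA i j l = ddA j i l.
  by apply: eq_mx => e b; exact: (@partialC R n i j U _ x oU (sG e l b) Ux).
have dFE i j l : dF i j l = ddA i j l - ddA i l j
   + (dA i j x *m A l x + A j x *m dA i l x - (dA i l x *m A j x + A l x *m dA i j x)).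
  apply/matrixP => e b; rewrite !mxE.
  rewrite (_ : (fun y => F j l y e b) = (fun y => partial j (G e l b) y - partial l (G e j b) y
      + \sum_m (G e j m y * G m l b y - G e l m y * G m j b y))); last first.
    by apply/funext => y; rewrite mxE.
  have dp p q r s : differentiable (partial p (G q r s)) x.
    by apply: smooth_on_differentiable Ux; apply: smooth_on_partial; exact: sG.
  have dG p q r : differentiable (G p q r) x by exact: diffG.
  have dGG p q r p' q' r' : differentiable (fun y => G p q r y * G p' q' r' y) x.
    exact: differentiableM.
  rewrite partialD; [|exact: differentiableB|apply: differentiable_bigsum => m; exact: differentiableB].
  rewrite partialB// partial_sum; last by move=> m; exact: differentiableB.
  congr (_ + _).
  rewrite -!big_split -sumrB; apply: eq_bigr => m _ /=.
  have h1 p q r p' q' r' : partial i (fun y => G p q r y * G p' q' r' y) x =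
      partial i (G p q r) x * G p' q' r' x + G p q r x * partial i (G p' q' r') x.
    exact: partialM.
  rewrite partialB; [|exact: dGG..].
  by rewrite 2!h1 !connection_mxE !connection_dmxE.
rewrite !dFE !curvature_mxE (ddC c k d) (ddC d c k) (ddC d k c).
move: (ddA k c d) (ddA k d c) (ddA c d k) => D1 D2 D3 {ddC dFE}.
move: (dA k c x) (dA k d x) (dA c k x) (dA c d x) (dA d k x) (dA d c x) => P1 P2 P3 P4 P5 P6.
move: (A k x) (A c x) (A d x) => X Y Z.
rewrite !(mulmxDl, mulmxDr, mulmxN, mulNmx) !mulmxA.
apply/matrixP => a b; rewrite !mx_entryE [RHS]mxE.
by ring.
Qed.

Lemma first_bianchi b c d x : U x -> forall e,
  curvature e b c d x + curvature e c d b x + curvature e d b c x = 0.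
Proof.
move=> Ux e; rewrite /curvature.
have dC i a p q : partial i (G a p q) x = partial i (G a q p) x.
  by apply: (open_partial_eq _ oU) => // y; exact: symG.
rewrite (dC d e b c) (dC c e d b) (dC b e c d).
have E : \sum_k (G e c k x * G k d b x - G e d k x * G k c b x)
   + \sum_k (G e d k x * G k b c x - G e b k x * G k d c x)
   + \sum_k (G e b k x * G k c d x - G e c k x * G k b d x) = 0.
  rewrite -!big_split big1// => k _ /=.
  rewrite (symG k d b Ux) (symG k c b Ux) (symG k d c Ux).
  ring.
move: E; set s1 := \sum_k _; set s2 := \sum_k _; set s3 := \sum_k _ => E.
have -> : s1 = - s2 - s3 by move: E; lra.
ring.
Qed.

Definition low_curvature (a b c d : 'I_n) (x : 'rV[R]_n) : R := \sum_e g x a e * curvature e b c d x.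

(** The symmetry between the two pairs of indices follows from the antisymmetries
    and the four instances of the first Bianchi identity, as usual. *)
Lemma low_curvature_operator_tensor x : U x -> operator_tensor (fun a b c d => low_curvature a b c d x).
Proof.
move=> Ux.
have R2 a b c d : low_curvature a b d c x = - low_curvature a b c d x.
  rewrite /low_curvature -sumrN; apply: eq_bigr => e _; rewrite -mulrN; congr (_ * _).
  rewrite /curvature opprD opprB -sumrN; congr (_ + _); apply: eq_bigr => k _.
  by rewrite opprB.
have lowE a b c d : (g x *m F c d x) a b = low_curvature a b c d x.
  by rewrite mxE; apply: eq_bigr => e _; rewrite mxE.
have R1 a b c d : low_curvature b a c d x = - low_curvature a b c d x.
  have /matrixP/(_ a b) := curvature_mx_antisym c d Ux.
  rewrite [RHS]mxE lowE => <-; rewrite -lowE !mxE; apply: eq_bigr => e _.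
  by rewrite !mxE mulrC symg.
have R3 a b c d : low_curvature a b c d x + low_curvature a c d b x + low_curvature a d b c x = 0.
  rewrite /low_curvature -!big_split big1// => e _ /=.
  by rewrite -!mulrDr first_bianchi// mulr0.
split=> // a b c d.
have := R3 a b c d; have := R3 b c d a; have := R3 c d a b; have := R3 d a b c.
move: R1 R2; move: (fun a b c d => low_curvature a b c d x) => L R1 R2.
have := R2 a c d b; have := R2 b c d a; have := R1 b a c d; have := R1 c a b d.
have := R1 c b d a; have := R1 d a b c; have := R1 d b c a; have := R2 b d a c; have := R1 d c a b.
lra.
Qed.

Section Bianchi.
Variable h : 'rV[R]_n -> 'M[R]_n.
Hypothesis sh : forall a b, smooth_on U (fun x => h x a b).
Hypothesis gaussh : forall x a b c d, U x -> low_curvature a b c d x = gauss_tensor (h x) a b c d.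

Let diffh a b x : U x -> differentiable (fun y => h y a b) x.
Proof. by move=> Ux; exact: smooth_on_differentiable (sh a b) Ux. Qed.

(** The covariant derivative h_ac;k without the correction on the index c, which
    drops out of the alternation in k and c because the connection is
    symmetric. *)
Definition half_cov (k a c : 'I_n) (x : 'rV[R]_n) : R :=
  partial k (fun y => h y a c) x - \sum_e G e k a x * h x e c.

(** Leibniz rule; only the first pair of indices is corrected, since the corrections
    on the second pair cancel in the cyclic sum of the Bianchi identity. *)
Lemma partial_gauss_tensor k a b c d x : U x ->
  partial k (fun y => gauss_tensor (h y) a b c d) x
  - \sum_e G e k a x * gauss_tensor (h x) e b c d
  - \sum_e G e k b x * gauss_tensor (h x) a e c d =
  half_cov k a c x * h x b d + h x a c * half_cov k b d x
  - half_cov k a d x * h x b c - h x a d * half_cov k b c x.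
Proof.
move=> Ux; have dh p q := diffh p q Ux.
have dhh p q p' q' : differentiable (fun y => h y p q * h y p' q') x by exact: differentiableM.
rewrite (partialB k (dhh a c b d) (dhh a d b c)).
rewrite (partialM k (dh a c) (dh b d)) (partialM k (dh a d) (dh b c)) /half_cov.
have E1 : \sum_e G e k a x * gauss_tensor (h x) e b c d =
    (\sum_e G e k a x * h x e c) * h x b d - (\sum_e G e k a x * h x e d) * h x b c.
  by rewrite !mulr_suml -sumrB; apply: eq_bigr => e _; rewrite /gauss_tensor; ring.
have E2 : \sum_e G e k b x * gauss_tensor (h x) a e c d =
    h x a c * (\sum_e G e k b x * h x e d) - h x a d * (\sum_e G e k b x * h x e c).
  by rewrite !mulr_sumr -sumrB; apply: eq_bigr => e _; rewrite /gauss_tensor; ring.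
rewrite E1 E2.
move: (partial k _ x) (partial k _ x) (partial k _ x) (partial k _ x).
move: (\sum_e _) (\sum_e _) (\sum_e _) (\sum_e _) => *; ring.
Qed.

(** The second Bianchi identity multiplied by g, the lowering being covariant. *)
Lemma lowered_bianchi k c d x a b : U x ->
  let T k c d := partial k (fun y => gauss_tensor (h y) a b c d) x
    - \sum_e G e k a x * gauss_tensor (h x) e b c d
    - \sum_e G e k b x * gauss_tensor (h x) a e c d in
  T k c d + T c d k + T d k c = 0.
Proof.
move=> Ux T.
pose dF k c d := \matrix_(e, b) partial k (fun y => F c d y e b) x.
pose Rm c d := \matrix_(a, b) gauss_tensor (h x) a b c d.
pose dR k c d := \matrix_(a, b) partial k (fun y => gauss_tensor (h y) a b c d) x.
have lowE c' d' y p q : U y -> (g y *m F c' d' y) p q = gauss_tensor (h y) p q c' d'.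
  by move=> Uy; rewrite -gaussh// mxE; apply: eq_bigr => e _; rewrite mxE.
have RmE c' d' : Rm c' d' = g x *m F c' d' x.
  by apply/matrixP => p q; rewrite lowE// mxE.
have dRE k' c' d' : dR k' c' d' = ((A k' x)^T *m g x + g x *m A k' x) *m F c' d' x + g x *m dF k' c' d'.
  rewrite -metric_compat_mx//; apply/matrixP => p q; rewrite mxE.
  rewrite (@open_partial_eq _ _ k' U _ (fun y => \sum_e g y p e * F c' d' y e q) _ oU _ Ux); last first.
    by move=> y Uy; rewrite -lowE// mxE.
  have dFd e : differentiable (fun y => F c' d' y e q) x.
    apply: near_differentiable (smooth_on_differentiable (smooth_curvature e q c' d') Ux).
    by apply: filterE => y; rewrite mxE.
  have dg e : differentiable (fun y => g y p e) x by exact: diffg.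
  rewrite partial_sum; last by move=> e; exact: differentiableM.
  rewrite !mxE -big_split; apply: eq_bigr => e _.
  by rewrite (partialM k' (dg e) (dFd e)) !mxE.
have TE k' c' d' : T k' c' d' = (dR k' c' d' - (A k' x)^T *m Rm c' d' - Rm c' d' *m A k' x) a b.
  rewrite !mx_entryE /T [dR _ _ _ _ _]mxE; congr (_ - _ - _); rewrite mxE.
    by apply: eq_bigr => e _; rewrite !mxE.
  by apply: eq_bigr => e _; rewrite !mxE mulrC.
rewrite !TE !dRE !RmE -!mx_entryE.
have := congr1 (fun X => (g x *m X) a b) (second_bianchi_mx k c d Ux); rewrite mulmx0 [RHS]mxE => <-.
congr (fun_of_matrix _ a b).
rewrite -/(dF k c d) -/(dF c d k) -/(dF d k c).
move: (dF k c d) (dF c d k) (dF d k c) (F c d x) (F d k x) (F k c x) (A k x) (A c x) (A d x) (g x).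
move=> D1 D2 D3 F1 F2 F3 X Y Z g0; rewrite !(mulmxDl, mulmxDr, mulmxN, mulNmx) !mulmxA.
apply/matrixP => p q; rewrite !mx_entryE.
by ring.
Qed.

(** When n > 3 the Codazzi equation is the second Bianchi identity for the
    exterior square of h. *)
Lemma codazzi_of_gauss x : (3 < n)%N -> U x -> (h x)^T = h x -> h x \in unitmx ->
  forall k a c, half_cov k a c x = half_cov c a k x.
Proof.
move=> n3 Ux hs hu k a c; apply/eqP; rewrite -subr_eq0; apply/eqP.
pose Q a k c := half_cov k a c x - half_cov c a k x.
apply: (codazzi_algebra n3 hs hu (Q := Q)) => [a1 k1 c1|a1 b1 k1 c1 d1]; rewrite /Q.
  by move: half_cov => X; ring.
have := lowered_bianchi k1 c1 d1 a1 b1 Ux; cbv beta zeta.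
rewrite (partial_gauss_tensor k1 a1 b1 c1 d1 Ux) (partial_gauss_tensor c1 a1 b1 d1 k1 Ux).
rewrite (partial_gauss_tensor d1 a1 b1 k1 c1 Ux) => H.
by rewrite -[RHS]H; move: half_cov => X; ring.
Qed.
End Bianchi.

End Connection.

(** * The Levi-Civita connection *)

Section LeviCivita.
Variables (R : realType) (n : nat) (U : set 'rV[R]_n) (g : 'rV[R]_n -> 'M[R]_n).
Hypotheses (oU : open U) (gp : forall x, U x -> posmx (g x)).
Hypothesis sg : forall a b, smooth_on U (fun x => g x a b).

Local Notation G := (christoffel g).

Lemma metric_comp_sym x a b : U x -> g x a b = g x b a.
Proof. by move=> /gp[gs _]; rewrite -[in LHS]gs mxE. Qed.

Lemma partial_metric_sym i a b x : U x ->
  partial i (fun y => g y a b) x = partial i (fun y => g y b a) x.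
Proof. by move=> Ux; apply: (open_partial_eq _ oU) => // y; exact: metric_comp_sym. Qed.

Lemma smooth_invmetric a b : smooth_on U (fun x => invmx (g x) a b).
Proof. by apply: smooth_on_invmx => // x /gp /posmx_unit. Qed.

Lemma smooth_christoffel c a b : smooth_on U (G c a b).
Proof.
apply: smooth_onM => //; first exact: smooth_on_cst.
apply: smooth_on_sum => // d _; apply: smooth_onM => //; first exact: smooth_invmetric.
apply: smooth_onB => //; last exact: smooth_on_partial.
by apply: smooth_onD => //; exact: smooth_on_partial.
Qed.

Lemma christoffelC c a b x : U x -> G c a b x = G c b a x.
Proof.
move=> Ux; rewrite /christoffel; congr (_ * _); apply: eq_bigr => d _; congr (_ * _).
rewrite (partial_metric_sym a d b Ux) (partial_metric_sym b a d Ux).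
rewrite (partial_metric_sym d a b Ux); ring.
Qed.

Lemma lower_christoffel c a b x : U x ->
  \sum_e g x c e * G e a b x = 2^-1 *
    (partial a (fun y => g y c b) x + partial b (fun y => g y a c) x
     - partial c (fun y => g y a b) x).
Proof.
move=> Ux; rewrite /christoffel.
set D := fun d => partial a (fun y => g y d b) x + partial b (fun y => g y a d) x
     - partial d (fun y => g y a b) x.
under eq_bigr do rewrite mulrCA mulr_sumr.
rewrite -mulr_sumr; congr (_ * _); rewrite exchange_big /= -/(D c).
have gu := posmx_unit (gp Ux).
have E d : \sum_e g x c e * invmx (g x) e d = (c == d)%:R.
  by have /matrixP/(_ c d) := mulmxV gu; rewrite !mxE.
transitivity (\sum_d (c == d)%:R * D d).
  by apply: eq_bigr => d _; rewrite -E mulr_suml; apply: eq_bigr => e _; rewrite mulrA.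
rewrite (bigD1 c)//= big1 ?addr0 => [|d dc]; first by rewrite eqxx mul1r.
by rewrite eq_sym (negbTE dc) mul0r.
Qed.

Lemma metric_compat k a b x : U x ->
  partial k (fun y => g y a b) x =
  \sum_e G e k a x * g x e b + \sum_e g x a e * G e k b x.
Proof.
move=> Ux; have -> : \sum_e G e k a x * g x e b = \sum_e g x b e * G e k a x.
  by apply: eq_bigr => e _; rewrite mulrC metric_comp_sym.
rewrite !lower_christoffel//.
rewrite (partial_metric_sym k b a Ux) (partial_metric_sym a k b Ux) (partial_metric_sym b k a Ux).
by field.
Qed.

Lemma cov2_altE h a b c x : U x ->
  cov2_alt g h a b c x = 2^-1 * (half_cov G h c a b x - half_cov G h b a c x).
Proof.
move=> Ux; rewrite /cov2_alt /cov2 /half_cov; congr (_ * _).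
have -> : \sum_d G d c b x * h x a d = \sum_d G d b c x * h x a d.
  by apply: eq_bigr => d _; rewrite (@christoffelC d c b x Ux).
move: (\sum_d G d b c x * _) (\sum_d G d c a x * _) (\sum_d G d b a x * _).
by move: (partial c _ x) (partial b _ x) => X Y s1 s2 s3; ring.
Qed.

Lemma riemann_operator_tensor x : U x -> operator_tensor (riemann g x).
Proof.
move=> Ux.
exact: (low_curvature_operator_tensor oU metric_comp_sym sg smooth_christoffel christoffelC metric_compat Ux).
Qed.

Lemma cov2_alt_of_gauss (h : 'rV[R]_n -> 'M[R]_n) x : (3 < n)%N -> (forall a b, smooth_on U (fun x => h x a b)) ->
  (forall y, U y -> riemann g y = gauss_tensor (h y)) ->
  U x -> posmx (h x) -> forall a b c, cov2_alt g h a b c x = 0.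
Proof.
move=> n3 sh gh Ux hp a b c; rewrite cov2_altE//.
have gh' y p q r s : U y -> low_curvature g G p q r s y = gauss_tensor (h y) p q r s.
  by move=> Uy; rewrite -gh.
rewrite (codazzi_of_gauss oU sg smooth_christoffel metric_compat sh gh' n3 Ux hp.1 (posmx_unit hp)).
by rewrite subrr mulr0.
Qed.

End LeviCivita.

(** * A positive definite form as a function of its exterior square *)

Section SmoothRoot.
Variables (R : realType) (n : nat).

(** The value of h at x e_a + y e_b + z e_c. *)
Lemma posmx_quad3 (h : 'M[R]_n) a b c (x y z : R) : posmx h ->
  a != b -> a != c -> b != c -> ~~ [&& x == 0, y == 0 & z == 0] ->
  0 < x ^+ 2 * h a a + y ^+ 2 * h b b + z ^+ 2 * h c c
      + 2 * (x * y * h a b + x * z * h a c + y * z * h b c).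
Proof.
move=> [hs hp] ab ac bc xyz.
have hE p q : h p q = h q p by rewrite -[in LHS]hs mxE.
pose e p : 'rV[R]_n := delta_mx 0 p.
pose w := x *: e a + y *: e b + z *: e c.
have ehe p q : (e p *m h *m (e q)^T) 0 0 = h p q.
  by rewrite /e trmx_delta -colE -rowE !mxE.
have w0 : w != 0.
  apply: contra xyz => /eqP w0.
  have wE p : w 0 p = x * (p == a)%:R + y * (p == b)%:R + z * (p == c)%:R.
    by rewrite !mxE !eqxx.
  have := wE a; have := wE b; have := wE c; rewrite w0 !mxE !eqxx.
  rewrite (eq_sym c a) (eq_sym c b) (eq_sym b a) (negbTE ab) (negbTE ac) (negbTE bc) /=.
  by rewrite !mulr0 !mulr1 !add0r !addr0 => <- <- <-; rewrite eqxx.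
have := hp w w0; congr (_ < _).
have E : w *m h *m w^T = x ^+ 2 *: (e a *m h *m (e a)^T) + y ^+ 2 *: (e b *m h *m (e b)^T)
   + z ^+ 2 *: (e c *m h *m (e c)^T) + (x * y) *: (e a *m h *m (e b)^T) + (x * y) *: (e b *m h *m (e a)^T)
   + (x * z) *: (e a *m h *m (e c)^T) + (x * z) *: (e c *m h *m (e a)^T)
   + (y * z) *: (e b *m h *m (e c)^T) + (y * z) *: (e c *m h *m (e b)^T).
  rewrite /w !linearD !linearZ /= !(mulmxDl, mulmxDr, =^~ scalemxAl, =^~ scalemxAr, scalerDr, scalerA).
  by apply/matrixP => p q; rewrite !mxE; ring.
have scaleE (p : R) (Z : 'M[R]_1) : (p *: Z) 0 0 = p * Z 0 0 by rewrite mxE.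
by rewrite E !mx_entryE !scaleE !ehe (hE b a) (hE c a) (hE c b); ring.
Qed.

(** Three positive values of the form: h_cc, then h_cc times the lower 2 x 2 minor
    at h_cc e_b - h_bc e_c, then this minor times the determinant at the first row
    of the adjugate. *)
Lemma minor3_gt0 (h : 'M[R]_n) a b c : posmx h -> a != b -> a != c -> b != c ->
  0 < h a a * (h b b * h c c - h b c ^+ 2) - h a b * (h a b * h c c - h b c * h a c)
      + h a c * (h a b * h b c - h b b * h a c).
Proof.
move=> hp ab ac bc; set D := (X in 0 < X).
have Q3 x y z := @posmx_quad3 h a b c x y z hp ab ac bc.
have c0 : 0 < h c c.
  by have := Q3 0 0 1; rewrite oner_eq0 !andbF => /(_ isT); congr (_ < _); ring.
have s0 : 0 < h b b * h c c - h b c ^+ 2.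
  rewrite -(pmulr_lgt0 _ c0).
  have := Q3 0 (h c c) (- h b c); rewrite (gt_eqF c0) andbF => /(_ isT); congr (_ < _); ring.
rewrite -(pmulr_lgt0 _ s0).
have := Q3 (h b b * h c c - h b c ^+ 2) (- (h c c * h a b - h b c * h a c)) (- (h b b * h a c - h b c * h a b)).
by rewrite (gt_eqF s0) => /(_ isT); congr (_ < _); rewrite /D; ring.
Qed.

(** The components of the exterior square are the 2 x 2 minors of h.  The adjugate
    of the 3 x 3 block at a, b, c has entries in these minors; its determinant D
    is the square of the determinant of the block, and its own 2 x 2 minors are
    the entries of the block times that determinant. *)
Lemma root_of_gauss_tensor (h : 'M[R]_n) a b c : posmx h -> a != b -> a != c -> b != c ->
  let G := gauss_tensor h in
  let p := G a b a b in let q := G a c a c in let s := G b c b c in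
  let t := G a b a c in let u := G b a b c in let v := G c a c b in
  let D := s * (q * p - t ^+ 2) - v * (v * p + t * u) - u * (v * t + q * u) in
  [/\ 0 < D, h a a = (q * p - t ^+ 2) / Num.sqrt D
    & h a b = (v * p + t * u) / Num.sqrt D].
Proof.
move=> hp ab ac bc G p q s t u v D.
have d0 := minor3_gt0 hp ab ac bc; move: d0; set d := (X in 0 < X) => d0.
have hE i j : h i j = h j i by rewrite -[in LHS](hp.1) mxE.
have DE : D = d ^+ 2.
  by rewrite /D /p /q /s /t /u /v /G /gauss_tensor (hE b a) (hE c a) (hE c b) /d; ring.
rewrite DE sqrtr_sqr gtr0_norm// exprn_gt0//; split=> //; apply: (mulIf (lt0r_neq0 d0)).
  by rewrite divfK ?gt_eqF// /p /q /t /G /gauss_tensor ?(hE b a) ?(hE c a) ?(hE c b) /d; ring.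
by rewrite divfK ?gt_eqF// /v /p /t /u /G /gauss_tensor ?(hE b a) ?(hE c a) ?(hE c b) /d; ring.
Qed.

Lemma smooth_of_gauss (U : set 'rV[R]_n) (h : 'rV[R]_n -> 'M[R]_n) : (3 <= n)%N -> open U ->
  (forall x, U x -> posmx (h x)) ->
  (forall a b c d, smooth_on U (fun x => gauss_tensor (h x) a b c d)) ->
  forall a b, smooth_on U (fun x => h x a b).
Proof.
move=> n3 oU hp sG.
have other (r : seq 'I_n) : (size r < n)%N -> exists c, c \notin r.
  move=> rn; apply/existsP; rewrite -negb_forall; apply: contraL rn => /forallP H.
  rewrite -leqNgt -[X in (X <= _)%N]card_ord; apply: leq_trans (card_size r).
  by apply: subset_leq_card; apply/fintype.subsetP => c _; exact: H.
suff K a b c : a != b -> a != c -> b != c ->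
    smooth_on U (fun x => h x a a) /\ smooth_on U (fun x => h x a b).
  move=> a b; have [<-{b}|ab] := eqVneq a b.
    have [b] := other [:: a] (leq_trans (isT : 1 < 3)%N n3); rewrite inE => ba.
    have [c] := other [:: a; b] n3; rewrite !inE negb_or => /andP[ca cb].
    by have [] // := K a b c; rewrite eq_sym.
  have [c] := other [:: a; b] n3; rewrite !inE negb_or => /andP[ca cb].
  by have [] // := K a b c ab; rewrite eq_sym.
move=> ab ac bc.
pose G x := gauss_tensor (h x).
pose D x := G x b c b c * (G x a c a c * G x a b a b - G x a b a c ^+ 2)
  - G x c a c b * (G x c a c b * G x a b a b + G x a b a c * G x b a b c)
  - G x b a b c * (G x c a c b * G x a b a c + G x a c a c * G x b a b c).
have sD : smooth_on U D.
  do ! [exact: sG | apply: (smooth_onB oU) | apply: (smooth_onD oU) | apply: (smooth_onM oU)].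
have D0 x : U x -> 0 < D x by move=> /hp hx; case: (root_of_gauss_tensor hx ab ac bc).
have sDi : smooth_on U (fun x => (Num.sqrt (D x))^-1).
  apply: smooth_onV => // [x Ux|]; last exact: smooth_on_sqrt.
  by rewrite gt_eqF// sqrtr_gt0 D0.
split.
  apply: (smooth_on_ext oU (f := fun x => (G x a c a c * G x a b a b - G x a b a c ^+ 2) * (Num.sqrt (D x))^-1)).
    by move=> x /hp hx; case: (root_of_gauss_tensor hx ab ac bc).
  do ! [exact: sDi | exact: sG | apply: (smooth_onB oU) | apply: (smooth_onM oU)].
apply: (smooth_on_ext oU (f := fun x => (G x c a c b * G x a b a b + G x a b a c * G x b a b c) * (Num.sqrt (D x))^-1)).
  by move=> x /hp hx; case: (root_of_gauss_tensor hx ab ac bc).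
do ! [exact: sDi | exact: sG | apply: (smooth_onD oU) | apply: (smooth_onM oU)].
Qed.

End SmoothRoot.

(** * Gram matrices of the solutions of a linear system *)

Section GramMatrix.
Variables (R : realType) (n : nat).

Lemma open_norm_ball (x0 : 'rV[R]_n) r : open [set x : 'rV[R]_n | `|x - x0| < r].
Proof.
have -> : [set x : 'rV[R]_n | `|x - x0| < r] = ball x0 r.
  by apply/seteqP; split => x; rewrite -ball_normE /ball_ /= distrC.
exact: ball_open.
Qed.

Lemma big_option (I : finType) (F : option I -> R) :
  \sum_o F o = F None + \sum_i F (Some i).
Proof.
rewrite (bigD1 None)//=; congr (_ + _).
rewrite (reindex_omap (fun i : I => Some i) id) /=; last by case.
by apply: eq_bigl => i; rewrite eqxx.
Qed.

Lemma class_C_sum (I : Type) (s : seq I) k (U : set 'rV[R]_n) (F : I -> 'rV[R]_n -> R) :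
  open U -> (forall a, class_C k U (F a)) -> class_C k U (fun x => \sum_(a <- s) F a x).
Proof.
move=> oU CF; elim: s => [|a s IH].
  by rewrite (_ : (fun _ => _) = fun=> 0); [exact: class_C_cst|apply/funext => x; rewrite big_nil].
rewrite (_ : (fun _ => _) = fun x => F a x + \sum_(b <- s) F b x).
  exact: class_CD.
by apply/funext => x; rewrite big_cons.
Qed.

(** Bootstrap: the derivatives of the solutions are as regular as the solutions. *)
Lemma linear_system_smooth (I : finType) (U : set 'rV[R]_n) (B : 'I_n -> I -> I -> 'rV[R]_n -> R) w :
  open U -> (forall i a b, smooth_on U (B i a b)) ->
  (forall x a, U x -> differentiable (w a) x) ->
  (forall x i a, U x -> partial i (w a) x = \sum_b B i a b x * w b x) ->
  forall a, smooth_on U (w a).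
Proof.
move=> oU sB dw ew a; apply/smooth_on_class_C => k; elim: k a => [|k IH] a /=.
  by split=> // x; exact: dw.
split=> [x|i]; first exact: dw.
apply: (class_C_ext oU (f := fun x => \sum_b B i a b x * w b x)) => [x Ux|].
  by rewrite ew.
by apply: class_C_sum => // b; apply: class_CM => //; have /smooth_on_class_C := sB i a b.
Qed.

(** The difference between the Gram matrix of the w a and G0 satisfies a
    homogeneous linear system and vanishes at x0. *)
Lemma parallel_gram (I : finType) m (x0 : 'rV[R]_n) r0 (om : 'I_n -> I -> I -> 'rV[R]_n -> R)
    (w : 'I_m -> I -> 'rV[R]_n -> R) (G0 : I -> I -> 'rV[R]_n -> R) :
  0 < r0 -> (forall i a b, differentiable (om i a b) x0) ->
  (forall t a x, `|x - x0| < r0 -> differentiable (w t a) x) ->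
  (forall t i a x, `|x - x0| < r0 -> partial i (w t a) x = \sum_b om i a b x * w t b x) ->
  (forall a b x, `|x - x0| < r0 -> differentiable (G0 a b) x) ->
  (forall i a b x, `|x - x0| < r0 -> partial i (G0 a b) x =
     \sum_c om i a c x * G0 c b x + \sum_c om i b c x * G0 a c x) ->
  (forall a b, \sum_t w t a x0 * w t b x0 = G0 a b x0) ->
  exists2 r, 0 < r & forall x, `|x - x0| < r -> forall a b, \sum_t w t a x * w t b x = G0 a b x.
Proof.
move=> r00 dom dw ew dG eG init.
pose f (p : I * I) x := \sum_t w t p.1 x * w t p.2 x - G0 p.1 p.2 x.
pose m' i (p q : I * I) x := om i p.1 q.1 x * (q.2 == p.2)%:R + om i p.2 q.2 x * (q.1 == p.1)%:R.
have delta (h : I -> R) b : \sum_c h c * (c == b)%:R = h b.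
  rewrite (bigD1 b)//= big1 ?addr0 => [|d db]; first by rewrite eqxx mulr1.
  by rewrite (negbTE db) mulr0.
have dww t a b x : `|x - x0| < r0 -> differentiable (fun y => w t a y * w t b y) x.
  by move=> xr; apply: differentiableM; exact: dw.
have [||||r rp H] := @linear_system_unique R n _ f m' x0 r0 r00.
- move=> i p q; apply: differentiable_continuous; apply: differentiableD;
    by apply: differentiableM; [exact: dom|exact: differentiable_cst].
- move=> x p xr; apply: differentiableB; last exact: dG.
  by apply: differentiable_bigsum => t; exact: dww.
- move=> x i [a b] xr; rewrite /f /=.
  rewrite (@partialB R n i (fun y => \sum_t w t a y * w t b y)); last first.
  - exact: dG.
  - by apply: differentiable_bigsum => t; exact: dww.
  rewrite partial_sum; last by move=> t; exact: dww.
  rewrite eG//.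
  have -> : \sum_t partial i (fun y => w t a y * w t b y) x =
      \sum_c om i a c x * (\sum_t w t c x * w t b x) + \sum_c om i b c x * (\sum_t w t a x * w t c x).
    under [X in _ = X + _]eq_bigr do rewrite mulr_sumr.
    under [X in _ = _ + X]eq_bigr do rewrite mulr_sumr.
    rewrite exchange_big [X in _ = _ + X]exchange_big -big_split; apply: eq_bigr => t _ /=.
    rewrite partialM; [|exact: dw..]; rewrite !ew// mulr_suml mulr_sumr.
    by congr (_ + _); apply: eq_bigr => c _; ring.
  rewrite -(pair_bigA _ (fun c d => m' i (a, b) (c, d) x * (\sum_t w t c x * w t d x - G0 c d x))) /=.
  have -> : \sum_c \sum_d m' i (a, b) (c, d) x * (\sum_t w t c x * w t d x - G0 c d x) =
     \sum_c om i a c x * (\sum_t w t c x * w t b x - G0 c b x)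
     + \sum_d om i b d x * (\sum_t w t a x * w t d x - G0 a d x).
    under eq_bigr do under eq_bigr do rewrite /m' /= mulrDl.
    under eq_bigr do rewrite big_split.
    rewrite big_split /=; congr (_ + _).
      apply: eq_bigr => c _; rewrite -[RHS](delta (fun d => om i a c x * (\sum_t w t c x * w t d x - G0 c d x))).
      by apply: eq_bigr => d _; ring.
    rewrite exchange_big /=; apply: eq_bigr => d _.
    rewrite -[RHS](delta (fun c => om i b d x * (\sum_t w t c x * w t d x - G0 c d x))).
    by apply: eq_bigr => c _; ring.
  under [X in _ = X + _]eq_bigr do rewrite mulrBr.
  under [X in _ = _ + X]eq_bigr do rewrite mulrBr.
  by rewrite !sumrB; ring.
- by move=> [a b]; rewrite /f /= init subrr.
exists r => // x xr a b; have := H x (a, b) xr; rewrite /f /=.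
by move=> /eqP; rewrite subr_eq0 => /eqP.
Qed.
End GramMatrix.

(** * Solutions of the Gauss and Codazzi equations give immersions *)

Section Fundamental.
Variables (R : realType) (n : nat) (U : set 'rV[R]_n) (g h : 'rV[R]_n -> 'M[R]_n).
Variable G : 'I_n -> 'I_n -> 'I_n -> 'rV[R]_n -> R.
Hypotheses (oU : open U) (gp : forall x, U x -> posmx (g x)).
Hypothesis sg : forall a b, smooth_on U (fun x => g x a b).
Hypothesis sG : forall c a b, smooth_on U (G c a b).
Hypothesis symG : forall c a b x, U x -> G c a b x = G c b a x.
Hypothesis compatG : forall k a b x, U x ->
  partial k (fun y => g y a b) x =
  \sum_e G e k a x * g x e b + \sum_e g x a e * G e k b x.
Hypothesis sh : forall a b, smooth_on U (fun x => h x a b).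
Hypothesis symh : forall x a b, U x -> h x a b = h x b a.
Hypothesis gaussh : forall x a b c d, U x -> low_curvature g G a b c d x = gauss_tensor (h x) a b c d.
Hypothesis codazzih : forall k a c x, U x -> half_cov G h k a c x = half_cov G h c a k x.

Let symg x a b : U x -> g x a b = g x b a.
Proof. exact: (metric_comp_sym gp). Qed.

Let gi x := invmx (g x).

Let gigE x a b : U x -> \sum_e gi x a e * g x e b = (a == b)%:R.
Proof. by move=> Ux; have /matrixP/(_ a b) := mulVmx (posmx_unit (gp Ux)); rewrite !mxE. Qed.

Let ggiE x a b : U x -> \sum_e g x a e * gi x e b = (a == b)%:R.
Proof. by move=> Ux; have /matrixP/(_ a b) := mulmxV (posmx_unit (gp Ux)); rewrite !mxE. Qed.

Let deltal (f : 'I_n -> R) b : \sum_c (b == c)%:R * f c = f b.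
Proof.
rewrite (bigD1 b)//= big1 ?addr0 => [|d db]; first by rewrite eqxx mul1r.
by rewrite eq_sym (negbTE db) mul0r.
Qed.

(** The Weingarten map h^c_i. *)
Definition shape (c i : 'I_n) : 'rV[R]_n -> R := fun x => \sum_e gi x c e * h x e i.

Let sS c i : smooth_on U (shape c i).
Proof. by apply: smooth_on_sum => // e _; apply: smooth_onM => //; exact: (smooth_invmetric oU gp sg). Qed.

Lemma lower_shape a i x : U x -> \sum_c g x a c * shape c i x = h x a i.
Proof.
move=> Ux; rewrite -[RHS](deltal (fun e => h x e i)).
under eq_bigr do rewrite mulr_sumr.
rewrite exchange_big /=; apply: eq_bigr => e _; rewrite -(@ggiE x _ _ Ux) mulr_suml.
by apply: eq_bigr => c _; rewrite mulrA.
Qed.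

Lemma shape_symmetric i j x : U x ->
  \sum_c shape c i x * h x j c = \sum_c shape c j x * h x i c.
Proof.
move=> Ux; under eq_bigr do rewrite /shape mulr_suml.
under [RHS]eq_bigr do rewrite /shape mulr_suml.
rewrite exchange_big; apply: eq_bigr => e _; apply: eq_bigr => c _ /=.
have -> : gi x c e = gi x e c.
  by have [gs _] := gp Ux; rewrite /gi -[in LHS](invmx_sym gs) mxE.
by rewrite (symh e i Ux) (symh j c Ux); ring.
Qed.

(** The equations d_i X = E_i, d_i E_a = G^c_ia E_c + h_ia N, d_i N = - h^c_i E_c;
    the indices None, Some None and Some (Some a) stand for the position X, the
    normal N and the tangent vector E_a. *)
Definition frame_system (i : 'I_n) (a b : option (option 'I_n)) : 'rV[R]_n -> R :=
  match a, b with
  | None, Some (Some c) => fun=> (i == c)%:R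
  | Some (Some a), Some (Some c) => G c i a
  | Some (Some a), Some None => fun x => h x i a
  | Some None, Some (Some c) => fun x => - shape c i x
  | _, _ => fun=> 0
  end.

Lemma smooth_frame_system i a b : smooth_on U (frame_system i a b).
Proof.
by case: a b => [[a|]|] [[b|]|] //=; try exact: smooth_on_cst; exact: smooth_onN.
Qed.

(** The Gauss equation with the first index raised. *)
Lemma gauss_raised d a i j x : U x ->
  curvature G d a j i x = shape d j x * h x a i - shape d i x * h x a j.
Proof.
move=> Ux; rewrite -[LHS](deltal (fun e => curvature G e a j i x)).
under eq_bigr do rewrite -(@gigE x _ _ Ux) mulr_suml.
rewrite exchange_big /= /shape !mulr_suml -sumrB; apply: eq_bigr => e _.
have -> : \sum_c gi x d e * g x e c * curvature G c a j i x = gi x d e * gauss_tensor (h x) e a j i.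
  by rewrite -gaussh// /low_curvature mulr_sumr; apply: eq_bigr => c _; rewrite mulrA.
by rewrite /gauss_tensor; ring.
Qed.

Let diffG c a b x : U x -> differentiable (G c a b) x.
Proof. by move=> Ux; exact: smooth_on_differentiable (sG c a b) Ux. Qed.
Let diffg a b x : U x -> differentiable (fun y => g y a b) x.
Proof. by move=> Ux; exact: smooth_on_differentiable (sg a b) Ux. Qed.
Let diffS c i x : U x -> differentiable (shape c i) x.
Proof. by move=> Ux; exact: smooth_on_differentiable (@sS c i) Ux. Qed.

(** The covariant derivative of the Weingarten map, lowered. *)
Lemma codazzi_shape a i j x : U x ->
  \sum_d g x a d * (partial j (shape d i) x + \sum_c shape c i x * G d j c x) = half_cov G h j a i x.
Proof.
move=> Ux; rewrite /half_cov.
rewrite (@open_partial_eq R n j U (fun y => h y a i) (fun y => \sum_d g y a d * shape d i y) x oU _ Ux);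
  last by move=> y Uy; rewrite lower_shape.
rewrite partial_sum; last by move=> d; apply: differentiableM; [exact: diffg|exact: diffS].
have -> : \sum_d partial j (fun y => g y a d * shape d i y) x =
    \sum_d (\sum_e G e j a x * g x e d + \sum_e g x a e * G e j d x) * shape d i x
    + \sum_d g x a d * partial j (shape d i) x.
  rewrite -big_split; apply: eq_bigr => d _ /=; rewrite -compatG//.
  by rewrite (partialM j (diffg a d Ux) (@diffS d i x Ux)).
have -> : \sum_e G e j a x * h x e i = \sum_d (\sum_e G e j a x * g x e d) * shape d i x.
  under [RHS]eq_bigr do rewrite mulr_suml.
  rewrite exchange_big; apply: eq_bigr => e _ /=; rewrite -lower_shape// mulr_sumr.
  by apply: eq_bigr => d _; rewrite mulrA.
have -> : \sum_d g x a d * (partial j (shape d i) x + \sum_c shape c i x * G d j c x) =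
    \sum_d g x a d * partial j (shape d i) x + \sum_d (\sum_e g x a e * G e j d x) * shape d i x.
  under eq_bigr do rewrite mulrDr.
  rewrite big_split /=; congr (_ + _).
  under eq_bigr do rewrite mulr_sumr.
  rewrite exchange_big; apply: eq_bigr => d _ /=; rewrite mulr_suml.
  by apply: eq_bigr => e _; ring.
under [X in _ = X + _ - _]eq_bigr do rewrite mulrDl.
rewrite big_split /=.
by move: (\sum_d _) (\sum_d _) (\sum_d _) => *; ring.
Qed.

Lemma weingarten_symmetric d i j x : U x ->
  partial j (shape d i) x + \sum_c shape c i x * G d j c x =
  partial i (shape d j) x + \sum_c shape c j x * G d i c x.
Proof.
move=> Ux.
have K k l : partial k (shape d l) x + \sum_c shape c l x * G d k c x =
    \sum_a gi x d a * half_cov G h k a l x.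
  rewrite -[LHS](deltal (fun e => partial k (shape e l) x + \sum_c shape c l x * G e k c x)).
  under eq_bigr do rewrite -(@gigE x _ _ Ux) mulr_suml.
  rewrite exchange_big; apply: eq_bigr => a _ /=; rewrite -codazzi_shape// mulr_sumr.
  by apply: eq_bigr => e _; rewrite mulrA.
by rewrite !K; apply: eq_bigr => a _; rewrite codazzih.
Qed.

(** Integrability: the (E_a, E_d) component is the Gauss equation, (E_a, N) and
    (N, E_d) are the Codazzi equation, and the others express the symmetry of G,
    of h and of the shape operator. *)
Lemma frame_system_flat x i j a b : U x ->
  partial j (frame_system i a b) x + \sum_c frame_system i a c x * frame_system j c b x =
  partial i (frame_system j a b) x + \sum_c frame_system j a c x * frame_system i c b x.
Proof.
move=> Ux; rewrite !big_option.
case: a => [[a|]|]; case: b => [[d|]|] /=; rewrite ?partial_cst ?mul0r ?mulr0 ?add0r ?addr0.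
- have := gauss_raised d a i j Ux; rewrite /curvature => E.
  move: E; under [X in _ + X = _ -> _]eq_bigr do rewrite mulrC [X in _ - X]mulrC.
  rewrite sumrB (symh i a Ux) (symh j a Ux).
  move: (partial _ _ _) (partial _ _ _) (\sum_e _) (\sum_e _) => *; lra.
- have := codazzih j a i Ux; rewrite /half_cov.
  rewrite (@open_partial_eq R n j U (fun y => h y i a) (fun y => h y a i) x oU _ Ux); last by move=> y Uy; exact: symh.
  rewrite (@open_partial_eq R n i U (fun y => h y j a) (fun y => h y a j) x oU _ Ux); last by move=> y Uy; exact: symh.
  have E k l : \sum_e G e k a x * h x e l = \sum_c G c k a x * h x l c.
    by apply: eq_bigr => c _; rewrite (symh c l Ux).
  rewrite !E; move: (partial _ _ _) (partial _ _ _) (\sum_e _) (\sum_e _) => *; lra.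
- by under eq_bigr do rewrite mulr0; rewrite big1// ; under eq_bigr do rewrite mulr0; rewrite big1.
- have := weingarten_symmetric d i j Ux.
  rewrite (partialN j (@diffS d i x Ux)) (partialN i (@diffS d j x Ux)).
  have E k l : \sum_c - shape c k x * G d l c x = - \sum_c shape c k x * G d l c x.
    by rewrite -sumrN; apply: eq_bigr => c _; rewrite mulNr.
  rewrite !E; move: (partial _ _ _) (partial _ _ _) (\sum_e _) (\sum_e _) => *; lra.
- have := shape_symmetric i j Ux.
  have E k l : \sum_c - shape c k x * h x l c = - \sum_c shape c k x * h x l c.
    by rewrite -sumrN; apply: eq_bigr => c _; rewrite mulNr.
  by rewrite !E => ->.
- by rewrite !big1// => c _; rewrite mulr0.
- by rewrite !deltal symG.
- by rewrite !deltal symh.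
- by rewrite !big1// => c _; rewrite mulr0.
Qed.

(** One solution of the system is taken for each coordinate of R^(n+1), with
    initial values a linear frame of Gram matrix g at x0, in the first n
    coordinates, and the last basis vector as normal.  The Gram matrix of the
    frame stays equal to g, and the frame consists of the derivatives of the
    position. *)
Theorem local_immersion_exists x0 : U x0 -> exists2 r, 0 < r &
  (forall x, `|x - x0| < r -> U x) /\
  exists f : 'I_n.+1 -> 'rV[R]_n -> R,
  (forall t, smooth_on [set x | `|x - x0| < r] (f t)) /\
  forall x, `|x - x0| < r -> forall a b,
    \sum_t partial a (f t) x * partial b (f t) x = g x a b.
Proof.
move=> Ux0.
have [r1 r10 [r1U solve]] :=
  flat_system_solvable oU Ux0 smooth_frame_system frame_system_flat.
have [E Eg] := orthonormal_frame (gp Ux0); have [_ _ gE] := orthonormal_frame_inverse Eg.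
pose F := invmx E.
pose w0 (t : 'I_n.+1) (a : option (option 'I_n)) : R :=
  match a with
  | None => 0
  | Some None => if unlift ord_max t is Some k then 0 else 1
  | Some (Some a) => if unlift ord_max t is Some k then F a k else 0
  end.
have /choice[w wP] : forall t, exists w, (forall a, w a x0 = w0 t a) /\
    forall x, `|x - x0| < r1 -> forall a, differentiable (w a) x /\
    forall i, partial i (w a) x = \sum_b frame_system i a b x * w b x.
  by move=> t; exact: (solve (w0 t)).
have dw t a x : `|x - x0| < r1 -> differentiable (w t a) x.
  by move=> xr; case: ((wP t).2 x xr a).
have ew t i a x : `|x - x0| < r1 -> partial i (w t a) x = \sum_b frame_system i a b x * w t b x.
  by move=> xr; case: ((wP t).2 x xr a).
pose G0 (a b : option 'I_n) : 'rV[R]_n -> R :=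
  match a, b with
  | Some a, Some b => fun x => g x a b
  | None, None => fun=> 1
  | _, _ => fun=> 0
  end.
have [||||||r2 r20 gram] := @parallel_gram R n (option 'I_n) n.+1 x0 r1
  (fun i a b => frame_system i (Some a) (Some b)) (fun t a => w t (Some a)) G0 r10.
- by move=> i a b; exact: smooth_on_differentiable (smooth_frame_system _ _ _) Ux0.
- by move=> t a x; exact: dw.
- move=> t i a x xr; rewrite ew// big_option (_ : frame_system i (Some a) None x = 0) ?mul0r ?add0r//.
  by case: a.
- move=> [a|] [b|] x /r1U Ux /=; by [exact: diffg|exact: differentiable_cst].
- move=> i a b x /r1U Ux; rewrite !big_option.
  have E1 a' : \sum_c - shape c i x * g x c a' = - h x i a'.
    rewrite (symh i a' Ux) -lower_shape// -sumrN; apply: eq_bigr => c _.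
    by rewrite (symg c a' Ux); ring.
  have E2 a' : \sum_c - shape c i x * g x a' c = - h x i a'.
    by rewrite -E1; apply: eq_bigr => c _; rewrite (symg a' c Ux).
  case: a b => [a|] [b|] /=; rewrite ?partial_cst ?mul0r ?mulr0 ?mulr1 ?add0r ?addr0.
  + by rewrite compatG//; congr (_ + _); apply: eq_bigr => c _; rewrite mulrC.
  + by rewrite E2 big1 ?addr0 ?subrr// => c _; rewrite mulr0.
  + by rewrite E1 big1 ?add0r ?addr0 ?addNr// => c _; rewrite mulr0.
  + by rewrite !big1 ?addr0// => c _; rewrite mulr0.
- move=> a b; under eq_bigr do rewrite !(wP _).1.
  rewrite (bigD1_ord ord_max)//= unlift_none.
  under eq_bigr do rewrite liftK.
  case: a b => [a|] [b|] /=; rewrite ?mul0r ?mulr0 ?mulr1 ?add0r.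
  + by rewrite gE mxE; apply: eq_bigr => k _; rewrite [X in _ = _ * X]mxE.
  + by rewrite big1// => k _; rewrite mulr0.
  + by rewrite big1// => k _; rewrite mul0r.
  + by rewrite big1 ?addr0// => k _; rewrite mul0r.
pose r := Num.min r1 r2.
have rr1 x : `|x - x0| < r -> `|x - x0| < r1 by rewrite lt_min => /andP[].
have rr2 x : `|x - x0| < r -> `|x - x0| < r2 by rewrite lt_min => /andP[].
exists r; first by rewrite lt_min r10.
split=> [x /rr1/r1U//|].
exists (fun t => w t None); split=> [t|x xr a b].
  apply: (linear_system_smooth (B := frame_system)) => [|i a b|x a /rr1|x i a /rr1].
  - exact: open_norm_ball.
  - by apply: smooth_onS (smooth_frame_system i a b) => x /rr1/r1U.
  - exact: dw.
  - exact: ew.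
have pE t i : partial i (w t None) x = w t (Some (Some i)) x.
  rewrite ew; last exact: rr1.
  by rewrite !big_option /= mul0r add0r mul0r add0r deltal.
under eq_bigr do rewrite !pE.
by have := gram x (rr2 _ xr) (Some a) (Some b).
Qed.
End Fundamental.

Lemma local_immersion_of_gauss_codazzi (R : realType) n (U : set 'rV[R]_n)
    (g h : 'rV[R]_n -> 'M[R]_n) x0 :
  open U -> (forall x, U x -> posmx (g x)) ->
  (forall a b, smooth_on U (fun x => g x a b)) ->
  (forall a b, smooth_on U (fun x => h x a b)) ->
  (forall x, U x -> (h x)^T = h x) ->
  (forall x, U x -> riemann g x = gauss_tensor (h x)) ->
  (forall x, U x -> forall a b c, cov2_alt g h a b c x = 0) ->
  U x0 -> exists2 r, 0 < r &
  (forall x, `|x - x0| < r -> U x) /\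
  exists f : 'I_n.+1 -> 'rV[R]_n -> R,
  (forall t, smooth_on [set x | `|x - x0| < r] (f t)) /\
  forall x, `|x - x0| < r -> forall a b,
    \sum_t partial a (f t) x * partial b (f t) x = g x a b.
Proof.
move=> oU gp sg sh hs gh ch.
apply: (local_immersion_exists (h := h) oU gp sg (smooth_christoffel oU gp sg)) => //.
- by move=> c a b x; exact: (christoffelC oU gp).
- by move=> k a b x; exact: (metric_compat oU gp).
- by move=> x a b /hs hx; rewrite -[in LHS]hx mxE.
- by move=> x a b c d Ux; rewrite -gh.
- move=> k a c x Ux; have := ch x Ux a c k; rewrite (cov2_altE oU gp)// => /eqP.
  by rewrite mulf_eq0 invr_eq0 pnatr_eq0 /= subr_eq0 => /eqP.
Qed.

(** * The second fundamental form of an immersion *)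

Section Hypersurface.
Variables (R : realType) (n : nat) (U : set 'rV[R]_n) (g : 'rV[R]_n -> 'M[R]_n).
Variable G : 'I_n -> 'I_n -> 'I_n -> 'rV[R]_n -> R.
Variable f : 'I_n.+1 -> 'rV[R]_n -> R.
Hypotheses (oU : open U) (gp : forall x, U x -> posmx (g x)).
Hypothesis sg : forall a b, smooth_on U (fun x => g x a b).
Hypothesis sG : forall c a b, smooth_on U (G c a b).
Hypothesis symG : forall c a b x, U x -> G c a b x = G c b a x.
Hypothesis compatG : forall k a b x, U x ->
  partial k (fun y => g y a b) x =
  \sum_e G e k a x * g x e b + \sum_e g x a e * G e k b x.
Hypothesis lowerG : forall c a b x, U x -> \sum_e g x c e * G e a b x = 2^-1 *
    (partial a (fun y => g y c b) x + partial b (fun y => g y a c) x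
     - partial c (fun y => g y a b) x).
Hypothesis sf : forall t, smooth_on U (f t).
Hypothesis isom : forall x a b, U x ->
  \sum_t partial a (f t) x * partial b (f t) x = g x a b.

Let D a t := partial a (f t).
Let sD a t : smooth_on U (D a t). Proof. exact: smooth_on_partial. Qed.
Let sD2 a b t : smooth_on U (partial a (D b t)). Proof. exact: smooth_on_partial. Qed.
Let dD a t x : U x -> differentiable (D a t) x. Proof. exact: smooth_on_differentiable. Qed.
Let dD2 a b t x : U x -> differentiable (partial a (D b t)) x. Proof. exact: smooth_on_differentiable. Qed.
Let DC a b t x : U x -> partial a (D b t) x = partial b (D a t) x.
Proof. by move=> Ux; exact: (@partialC R n a b U (f t) x oU (sf t) Ux). Qed.

(** The Koszul formula: the tangential part of the second derivatives of f is the
    Levi-Civita connection of g. *)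
Lemma hessian_tangent a b c x : U x ->
  \sum_t partial a (D b t) x * D c t x = \sum_e g x c e * G e a b x.
Proof.
move=> Ux; rewrite lowerG//.
pose S a b c := \sum_t partial a (D b t) x * D c t x.
have SC p q r : S p q r = S q p r by apply: eq_bigr => t _; rewrite DC.
have dg p q r : partial p (fun y => g y q r) x = S p q r + S p r q.
  rewrite (@open_partial_eq R n p U _ (fun y => \sum_t D q t y * D r t y) x oU _ Ux); last first.
    by move=> y Uy; rewrite -isom.
  rewrite partial_sum; last by move=> t; apply: differentiableM; exact: dD.
  rewrite /S -big_split; apply: eq_bigr => t _ /=.
  by rewrite partialM; [rewrite [X in _ + X]mulrC|exact: dD..].
transitivity (2^-1 * (S a c b + S a b c + (S b a c + S b c a) - (S c a b + S c b a))).
  rewrite -/(S a b c); have := SC a c b; have := SC b c a; have := SC b a c.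
  by move: S {SC dg} => S -> -> ->; field.
by congr (_ * (_ + _ - _)); rewrite dg.
Qed.

(** The second fundamental form with values in the normal line, as a vector of
    R^(n+1); no normal has been chosen yet. *)
Definition second_form a b t : 'rV[R]_n -> R := fun x =>
  partial a (D b t) x - \sum_c G c a b x * D c t x.

Local Notation b2 := second_form.

Lemma second_formC a b t x : U x -> b2 a b t x = b2 b a t x.
Proof.
by move=> Ux; rewrite /b2 DC//; congr (_ - _); apply: eq_bigr => c _; rewrite symG.
Qed.

Lemma smooth_second_form a b t : smooth_on U (b2 a b t).
Proof.
apply: smooth_onB => //; apply: smooth_on_sum => // c _; apply: smooth_onM => //; exact: sG.
Qed.

Lemma second_form_normal a b c x : U x -> \sum_t b2 a b t x * D c t x = 0.
Proof.
move=> Ux; under eq_bigr do rewrite mulrBl.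
rewrite sumrB hessian_tangent//; apply/eqP; rewrite subr_eq0; apply/eqP.
under [RHS]eq_bigr do rewrite mulr_suml.
rewrite exchange_big; apply: eq_bigr => e _ /=.
by rewrite -isom// mulr_suml; apply: eq_bigr => t _; rewrite /D; ring.
Qed.

Lemma hessianE a b t x : partial a (D b t) x = b2 a b t x + \sum_c G c a b x * D c t x.
Proof. by rewrite /second_form subrK. Qed.

(** K differentiates [hessian_tangent] once more; the Gauss equation is the
    alternation of K in its first two indices, where the third derivatives of f
    cancel. *)
Lemma gauss_second_form a b c d x : U x ->
  low_curvature g G a b c d x =
  \sum_t b2 a c t x * b2 b d t x - \sum_t b2 a d t x * b2 b c t x.
Proof.
move=> Ux.
have K p q r s : \sum_t partial p (partial q (D r t)) x * D s t x =
    \sum_e g x s e * (partial p (G e q r) x + \sum_k G e p k x * G k q r x)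
    - \sum_t b2 p s t x * b2 q r t x.
  have H : partial p (fun y => \sum_t partial q (D r t) y * D s t y) x =
           partial p (fun y => \sum_e g y s e * G e q r y) x.
    by apply: (open_partial_eq _ oU) => // y Uy; exact: hessian_tangent.
  move: H; rewrite partial_sum; last first.
    by move=> t; apply: differentiableM; [exact: dD2|exact: dD].
  have dg i j : differentiable (fun y => g y i j) x by exact: smooth_on_differentiable (sg i j) Ux.
  have dG i j k : differentiable (G i j k) x by exact: smooth_on_differentiable (sG i j k) Ux.
  rewrite partial_sum; last by move=> e; exact: differentiableM.
  have -> : \sum_t partial p (fun y => partial q (D r t) y * D s t y) x =
      \sum_t partial p (partial q (D r t)) x * D s t x + \sum_t partial q (D r t) x * partial p (D s t) x.
    by rewrite -big_split; apply: eq_bigr => t _; rewrite partialM//; [exact: dD2|exact: dD].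
  have -> : \sum_e partial p (fun y => g y s e * G e q r y) x =
     \sum_e \sum_k G k p s x * g x k e * G e q r x + \sum_e \sum_k g x s k * G k p e x * G e q r x
     + \sum_e g x s e * partial p (G e q r) x.
    rewrite -!big_split; apply: eq_bigr => e _ /=.
    by rewrite (partialM p (dg s e) (dG e q r)) compatG// mulrDl !mulr_suml.
  have -> : \sum_t partial q (D r t) x * partial p (D s t) x =
      \sum_t b2 p s t x * b2 q r t x + \sum_e \sum_k G k p s x * g x k e * G e q r x.
    have -> : \sum_t partial q (D r t) x * partial p (D s t) x =
        \sum_t partial q (D r t) x * b2 p s t x + \sum_k G k p s x * (\sum_t partial q (D r t) x * D k t x).
      under [X in _ = _ + X]eq_bigr do rewrite mulr_sumr.
      rewrite exchange_big -big_split; apply: eq_bigr => t _ /=.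
      rewrite [X in _ * X]hessianE mulrDr; congr (_ + _).
      by rewrite mulr_sumr; apply: eq_bigr => k _; ring.
    congr (_ + _); last first.
      rewrite [RHS]exchange_big; apply: eq_bigr => k _ /=; rewrite hessian_tangent// mulr_sumr.
      by apply: eq_bigr => e _; ring.
    have -> : \sum_t partial q (D r t) x * b2 p s t x =
        \sum_t b2 p s t x * b2 q r t x + \sum_k G k q r x * (\sum_t b2 p s t x * D k t x).
      under [X in _ = _ + X]eq_bigr do rewrite mulr_sumr.
      rewrite exchange_big -big_split; apply: eq_bigr => t _ /=.
      rewrite [X in X * _]hessianE mulrDl; congr (_ + _); first by rewrite mulrC.
      by rewrite mulr_suml; apply: eq_bigr => k _; ring.
    by rewrite [X in _ + X]big1 ?addr0// => k _; rewrite second_form_normal// mulr0.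
  have -> : \sum_e g x s e * (partial p (G e q r) x + \sum_k G e p k x * G k q r x) =
      \sum_e g x s e * partial p (G e q r) x + \sum_e \sum_k g x s k * G k p e x * G e q r x.
    under eq_bigr do rewrite mulrDr.
    rewrite big_split /=; congr (_ + _); rewrite [RHS]exchange_big; apply: eq_bigr => e _ /=.
    by rewrite mulr_sumr; apply: eq_bigr => k _; ring.
  move: (\sum_t _) (\sum_t _) (\sum_e _) (\sum_e _) (\sum_e _) => *; lra.
have : \sum_t partial c (partial d (D b t)) x * D a t x = \sum_t partial d (partial c (D b t)) x * D a t x.
  by apply: eq_bigr => t _; rewrite (@partialC R n c d U (D b t) x oU (@sD b t) Ux).
move=> H; have := etrans (esym (K c d b a)) (etrans H (K d c b a)); move=> {H K}.
have -> : low_curvature g G a b c d x =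
   \sum_e g x a e * (partial c (G e d b) x + \sum_k G e c k x * G k d b x)
   - \sum_e g x a e * (partial d (G e c b) x + \sum_k G e d k x * G k c b x).
  rewrite /low_curvature /curvature -sumrB; apply: eq_bigr => e _.
  rewrite sumrB.
  by move: (partial _ _ _) (partial _ _ _) (\sum_k _) (\sum_k _) => *; ring.
have BC p q t : b2 p q t x = b2 q p t x by exact: second_formC.
move: BC; move: second_form => B BC.
have -> : \sum_t B a c t x * B b d t x = \sum_t B c a t x * B d b t x.
  by apply: eq_bigr => t _; rewrite (BC a c) (BC b d).
have -> : \sum_t B a d t x * B b c t x = \sum_t B d a t x * B c b t x.
  by apply: eq_bigr => t _; rewrite (BC a d) (BC b c).
move: (\sum_e _) (\sum_e _) (\sum_t _) (\sum_t _) => *; lra.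
Qed.

Definition jacobian (x : 'rV[R]_n) : 'M[R]_(n, n.+1) := \matrix_(a, t) D a t x.

(** The Jacobian matrix has rank n, as its Gram matrix is g, so its orthogonal
    complement is a line. *)
Lemma unit_normal x : U x -> exists nu : 'rV[R]_n.+1,
  [/\ \sum_t nu 0 t * nu 0 t = 1, forall a, \sum_t nu 0 t * D a t x = 0
    & forall v : 'rV[R]_n.+1, (forall a, \sum_t v 0 t * D a t x = 0) -> exists k, v = k *: nu].
Proof.
move=> Ux; pose J := jacobian x.
have JJ : J *m J^T = g x.
  by apply/matrixP => a b; rewrite !mxE -isom//; apply: eq_bigr => t _; rewrite !mxE.
have rJ : \rank J = n.
  by apply/eqP/row_freeP; exists (J^T *m invmx (g x)); rewrite mulmxA JJ mulmxV// (posmx_unit (gp Ux)).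
have rK : \rank (kermx J^T) = 1%N by rewrite mxrank_ker mxrank_tr rJ subSnn.
have /rowV0Pn[nu nuK nu0] : kermx J^T != 0 by rewrite -mxrank_eq0 rK.
have tangE (v : 'rV[R]_n.+1) a : \sum_t v 0 t * D a t x = (v *m J^T) 0 a.
  by rewrite mxE; apply: eq_bigr => t _; rewrite !mxE.
pose s := sqnorm nu; have s0 : 0 < s by rewrite lt_def sqnorm_eq0 nu0 sqnorm_ge0.
exists ((Num.sqrt s)^-1 *: nu); split.
- under eq_bigr do rewrite !mxE.
  have -> : \sum_t (Num.sqrt s)^-1 * nu 0 t * ((Num.sqrt s)^-1 * nu 0 t) = (Num.sqrt s)^-1 ^+ 2 * s.
    by rewrite /s /sqnorm mulr_sumr; apply: eq_bigr => t _; ring.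
  by rewrite exprVn sqr_sqrtr ?ltW// mulVf// gt_eqF.
- by move=> a; rewrite tangE -scalemxAl (sub_kermxP nuK) scaler0 mxE.
- move=> v hv; have vK : (v <= kermx J^T)%MS.
    by apply/sub_kermxP/rowP => a; rewrite -tangE hv mxE.
  have nuE : (kermx J^T <= nu)%MS by rewrite -(geq_leqif (mxrank_leqif_sup nuK)) rK rank_rV nu0.
  have /sub_rVP[k ->] := submx_trans vK nuE.
  exists (k * Num.sqrt s); rewrite scalerA mulfK// gt_eqF// sqrtr_gt0//.
Qed.

Variable o : 'I_n.
Hypothesis n1 : (1 < n)%N.
Hypothesis posG : forall x, U x -> op_posdef (g x) (fun a b c d => low_curvature g G a b c d x).

Definition normal_sq : 'rV[R]_n -> R := fun x => \sum_t b2 o o t x * b2 o o t x.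
(** The normal is read off one component of the second fundamental form, which
    cannot vanish; this makes it smooth and fixes its sign so that the form is
    positive definite. *)
Definition normal t : 'rV[R]_n -> R := fun x => b2 o o t x / Num.sqrt (normal_sq x).
(** The scalar second fundamental form relative to [normal]. *)
Definition height : 'rV[R]_n -> 'M[R]_n := fun x => \matrix_(a, b) \sum_t b2 a b t x * normal t x.

(** Relative to an arbitrary unit normal nu at x, the scalar second fundamental
    form h0 is definite by the Gauss equation; e is its sign. *)
Lemma height_spec x : U x ->
  [/\ 0 < normal_sq x, posmx (height x), forall a b t, b2 a b t x = height x a b * normal t x,
      \sum_t normal t x * normal t x = 1
    & forall a b c d, low_curvature g G a b c d x = gauss_tensor (height x) a b c d].
Proof.
move=> Ux; have [nu [nu1 nuD nuP]] := unit_normal Ux.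
have /choice[k kE] : forall p : 'I_n * 'I_n, exists k, forall t, b2 p.1 p.2 t x = k * nu 0 t.
  move=> [a b]; have [|k /rowP kE] := nuP (\row_t b2 a b t x).
    by move=> c; rewrite -[RHS](second_form_normal a b c Ux); apply: eq_bigr => t _; rewrite mxE.
  by exists k => t; have := kE t; rewrite !mxE.
pose h0 : 'M[R]_n := \matrix_(a, b) k (a, b).
have b0 a b t : b2 a b t x = h0 a b * nu 0 t by rewrite mxE -kE.
have bb a b c d : \sum_t b2 a b t x * b2 c d t x = h0 a b * h0 c d.
  rewrite -[RHS]mulr1 -nu1 mulr_sumr; apply: eq_bigr => t _.
  by rewrite !b0; ring.
have h0s : h0^T = h0.
  apply/matrixP => a b; rewrite mxE -[LHS]mulr1 -[RHS]mulr1 -nu1 !mulr_sumr.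
  by apply: eq_bigr => t _; rewrite !mulrA -!b0 second_formC.
have G0 a b c d : low_curvature g G a b c d x = gauss_tensor h0 a b c d.
  by rewrite (gauss_second_form a b c d Ux) !bb.
have [e [e1 ee heo]] : exists e : R, [/\ posmx (e *: h0), e * e = 1 & 0 < e * h0 o o].
  have oo (h' : 'M[R]_n) : posmx h' -> 0 < h' o o.
    move=> [_ hp]; have := hp (delta_mx 0 o); rewrite trmx_delta -colE -rowE !mxE.
    by apply; apply/eqP => /rowP/(_ o); rewrite !mxE !eqxx => /eqP; rewrite oner_eq0.
  have Tp : op_posdef (g x) (gauss_tensor h0).
    by have := posG Ux; congr op_posdef; do 4 (apply/funext => ?); exact: G0.
  have [p|p] := gauss_definite n1 (gp Ux) h0s Tp; [exists 1|exists (-1)].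
    by rewrite scale1r !mul1r; split=> //; exact: oo.
  by rewrite scaleN1r mulrNN mulr1 mulN1r; split=> //; have := oo _ p; rewrite mxE.
have sqE : normal_sq x = h0 o o ^+ 2 by rewrite /normal_sq bb.
have hoo0 : h0 o o != 0 by apply: contraTneq heo => ->; rewrite mulr0 ltxx.
have sq0 : 0 < normal_sq x by rewrite sqE lt_def sqrf_eq0 hoo0 sqr_ge0.
have sqrtE : Num.sqrt (normal_sq x) = e * h0 o o.
  have -> : normal_sq x = (e * h0 o o) ^+ 2 by rewrite sqE exprMn (expr2 e) ee mul1r.
  by rewrite sqrtr_sqr gtr0_norm.
have e0 : e != 0 by apply/eqP => e0; move/eqP: ee; rewrite e0 mulr0 eq_sym oner_eq0.
have NE t : normal t x = e * nu 0 t.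
  rewrite /normal b0 sqrtE invfM; have -> : e^-1 = e by apply: (mulfI e0); rewrite divff.
  by field.
have hE : height x = e *: h0.
  apply/matrixP => a b; rewrite !mxE; have -> : k (a, b) = h0 a b by rewrite mxE.
  rewrite -[RHS]mulr1 -nu1 mulr_sumr; apply: eq_bigr => t _.
  by rewrite b0 NE; ring.
have hE' a b : height x a b = e * h0 a b by rewrite hE [LHS]mxE.
split=> //; first by rewrite hE.
- move=> a b t; rewrite NE b0 hE'.
  by rewrite mulrACA ee mul1r.
- rewrite -nu1; apply: eq_bigr => t _; rewrite NE mulrACA ee mul1r//.
- move=> a b c d; rewrite G0 /gauss_tensor !hE'.
  by rewrite mulrACA ee mul1r mulrACA ee mul1r.
Qed.

Lemma smooth_normal t : smooth_on U (normal t).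
Proof.
apply: smooth_onM => //; first exact: smooth_second_form.
have sq : smooth_on U normal_sq.
  by apply: smooth_on_sum => // s _; apply: smooth_onM => //; exact: smooth_second_form.
apply: smooth_onV => // [x Ux|]; last first.
  by apply: smooth_on_sqrt => // x Ux; case: (height_spec Ux).
by rewrite gt_eqF// sqrtr_gt0; case: (height_spec Ux).
Qed.

(** With h_qr = d_q d_r f . N, the derivative d_p h_qr contains d_p d_q d_r f . N,
    which is symmetric in all indices, and d_q d_r f . d_p N, where
    d_e f . d_p N = - h_pe. *)
Lemma height_codazzi k a c x : U x -> half_cov G height k a c x = half_cov G height c a k x.
Proof.
move=> Ux.
have dN t : differentiable (normal t) x by exact: smooth_on_differentiable (smooth_normal t) Ux.
have ND y p : U y -> \sum_t normal t y * D p t y = 0.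
  move=> Uy; have [s0 _ _ _ _] := height_spec Uy.
  transitivity ((Num.sqrt (normal_sq y))^-1 * \sum_t b2 o o t y * D p t y).
    by rewrite mulr_sumr; apply: eq_bigr => t _; rewrite /normal; ring.
  by rewrite second_form_normal// mulr0.
have GND y p q : U y -> \sum_e G e p q y * (\sum_t normal t y * D e t y) = 0.
  by move=> Uy; rewrite big1// => e _; rewrite ND// mulr0.
have hs p q : height x p q = height x q p.
  by have [_ [hs _] _ _ _] := height_spec Ux; rewrite -[in LHS]hs mxE.
have bN y p q : U y -> \sum_t partial p (D q t) y * normal t y = height y p q.
  move=> Uy; rewrite [RHS]mxE -[RHS]addr0 -[X in _ = _ + X](GND y p q Uy).
  under [X in _ = _ + X]eq_bigr do rewrite mulr_sumr.
  rewrite exchange_big -big_split; apply: eq_bigr => t _ /=.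
  by rewrite hessianE mulrDl; congr (_ + _); rewrite mulr_suml; apply: eq_bigr => e _; ring.
have NdN p : \sum_t normal t x * partial p (normal t) x = 0.
  have : partial p (fun y => \sum_t normal t y * normal t y) x = 0.
    rewrite -[RHS](partial_cst p 1 x); apply: (open_partial_eq _ oU) => // y Uy.
    by have [] := height_spec Uy.
  rewrite partial_sum; last by move=> t; exact: differentiableM.
  have -> : \sum_t partial p (fun y => normal t y * normal t y) x = 2 * \sum_t normal t x * partial p (normal t) x.
    by rewrite mulr_sumr; apply: eq_bigr => t _; rewrite partialM//; ring.
  by move=> /eqP; rewrite mulf_eq0 pnatr_eq0 /= => /eqP.
have DdN p q : \sum_t D q t x * partial p (normal t) x = - height x p q.
  have : partial p (fun y => \sum_t normal t y * D q t y) x = 0.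
    by rewrite -[RHS](partial_cst p 0 x); apply: (open_partial_eq _ oU) => // y Uy; exact: ND.
  rewrite partial_sum; last by move=> t; apply: differentiableM => //; exact: dD.
  have -> : \sum_t partial p (fun y => normal t y * D q t y) x =
      \sum_t D q t x * partial p (normal t) x + \sum_t partial p (D q t) x * normal t x.
    rewrite -big_split; apply: eq_bigr => t _ /=; rewrite partialM//; last exact: dD.
    by rewrite mulrC [X in _ + X]mulrC.
  by rewrite (bN x p q Ux) => /eqP; rewrite addr_eq0 => /eqP.
have K p q r : partial p (fun y => height y q r) x =
    \sum_t partial p (partial q (D r t)) x * normal t x - \sum_e G e q r x * height x p e.
  rewrite (@open_partial_eq R n p U _ (fun y => \sum_t partial q (D r t) y * normal t y) x oU _ Ux); last first.
    by move=> y Uy; rewrite bN.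
  rewrite partial_sum; last by move=> t; apply: differentiableM => //; exact: dD2.
  have -> : \sum_t partial p (fun y => partial q (D r t) y * normal t y) x =
      \sum_t partial p (partial q (D r t)) x * normal t x + \sum_t partial q (D r t) x * partial p (normal t) x.
    by rewrite -big_split; apply: eq_bigr => t _; rewrite partialM//; exact: dD2.
  congr (_ + _); rewrite -sumrN.
  have -> : \sum_t partial q (D r t) x * partial p (normal t) x =
     height x q r * (\sum_t normal t x * partial p (normal t) x)
     + \sum_e G e q r x * (\sum_t D e t x * partial p (normal t) x).
    rewrite mulr_sumr; under [X in _ = _ + X]eq_bigr do rewrite mulr_sumr.
    rewrite exchange_big -big_split; apply: eq_bigr => t _ /=.
    have [_ _ bE _ _] := height_spec Ux.
    rewrite [X in X * _]hessianE bE mulrDl mulrA; congr (_ + _); rewrite mulr_suml.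
    by apply: eq_bigr => e _; rewrite mulrA.
  by rewrite NdN mulr0 add0r; apply: eq_bigr => e _; rewrite DdN mulrN.
have D3 : \sum_t partial k (partial a (D c t)) x * normal t x = \sum_t partial c (partial a (D k t)) x * normal t x.
  have swap p q r t : partial p (partial q (D r t)) x = partial p (partial r (D q t)) x.
    exact: (@open_partial_eq R n p U _ _ x oU (fun y Uy => @DC q r t y Uy) Ux).
  apply: eq_bigr => t _; apply: (congr1 (fun z => z * normal t x)).
  have H := @partialC R n k c U (D a t) x oU (@sD a t) Ux.
  move: (swap k a c t) (swap c k a t) H => {K swap bN DdN NdN} e1 e2 H.
  refine (@etrans _ _ _ _ e1 (@etrans _ _ _ _ H e2)).
have [T TE] : exists T, forall p q r, \sum_t partial p (partial q (D r t)) x * normal t x = T p q r.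
  by eexists => p q r; reflexivity.
have DT : T k a c = T c a k by rewrite -(TE k a c) -(TE c a k).
have HE p q r : half_cov G height p q r x =
    T p q r - \sum_e G e q r x * height x p e - \sum_e G e p q x * height x e r.
  by rewrite /half_cov K TE.
have E p q : \sum_e G e a p x * height x q e = \sum_e G e p a x * height x e q.
  by apply: eq_bigr => e _; rewrite (symG e a p Ux) hs.
by rewrite (HE k a c) (HE c a k) (E c k) (E k c) DT addrAC.
Qed.
End Hypersurface.

Theorem gauss_codazzi_of_local_immersion (R : realType) n (U : set 'rV[R]_n)
    (g : 'rV[R]_n -> 'M[R]_n) (f : 'I_n.+1 -> 'rV[R]_n -> R) :
  (1 < n)%N -> open U -> (forall x, U x -> posmx (g x)) ->
  (forall a b, smooth_on U (fun x => g x a b)) ->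
  (forall x, U x -> op_posdef (g x) (riemann g x)) ->
  (forall t, smooth_on U (f t)) ->
  (forall x a b, U x -> \sum_t partial a (f t) x * partial b (f t) x = g x a b) ->
  exists h : 'rV[R]_n -> 'M[R]_n, forall x, U x ->
  [/\ posmx (h x), riemann g x = gauss_tensor (h x)
    & forall a b c, cov2_alt g h a b c x = 0].
Proof.
move=> n1 oU gp sg posR sf isom; pose o := Ordinal (ltnW n1).
have sG := smooth_christoffel oU gp sg.
have symG c a b x : U x -> christoffel g c a b x = christoffel g c b a x.
  by exact: (christoffelC oU gp).
have cG := metric_compat oU gp; have lG := lower_christoffel gp.
exists (height (christoffel g) f o) => x Ux.
have [_ hp _ _ gh] := height_spec oU gp sg sG symG cG lG sf isom o n1 posR Ux.
split=> // [|a b c].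
  by do 4 (apply/funext => ?); exact: gh.
rewrite (cov2_altE oU gp)//.
rewrite (height_codazzi oU gp sg sG symG cG lG sf isom o n1 posR c a b Ux).
by rewrite subrr mulr0.
Qed.

(** * From charts to the manifold *)

Lemma open_chart_im (R : realType) n (M : topologicalType) (c : chart R n M) (W : set M) :
  open W -> open (chart_im c `&` chart_inv c @^-1` W).
Proof.
move=> oW; rewrite openE => x [cx Wx]; apply: filterI.
  by apply: open_nbhs_nbhs; split=> //; exact: chart_im_open.
by apply: (chart_inv_cont cx); apply: open_nbhs_nbhs; split.
Qed.

Lemma open_chart_dom (R : realType) n (M : topologicalType) (c : chart R n M) (V : set 'rV[R]_n) :
  open V -> open (chart_dom c `&` chart_map c @^-1` V).
Proof.
move=> oV; rewrite openE => p [cp Vp]; apply: filterI.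
  by apply: open_nbhs_nbhs; split=> //; exact: chart_dom_open.
by apply: (chart_map_cont cp); apply: open_nbhs_nbhs; split.
Qed.

Lemma cov2_alt_ext (R : realType) n (g S T : 'rV[R]_n -> 'M[R]_n) (U : set 'rV[R]_n) x :
  open U -> (forall y, U y -> S y = T y) -> U x ->
  forall a b c, cov2_alt g S a b c x = cov2_alt g T a b c x.
Proof.
move=> oU ST Ux.
have E k p q : partial k (fun y => S y p q) x = partial k (fun y => T y p q) x.
  by apply: (open_partial_eq _ oU _ Ux) => y Uy; rewrite ST.
have E2 a b c : cov2 g S a b c x = cov2 g T a b c x by rewrite /cov2 (ST x Ux) E.
by move=> a b c; rewrite /cov2_alt (E2 a b c) (E2 a c b).
Qed.

Section Global.
Variables (R : realType) (n : nat) (M : manifold R n) (g : metric M).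
Hypothesis n3 : (3 <= n)%N.
Hypothesis posR : positive_curvature_operator g.

Lemma metric_posmx i x : chart_im (atlas i) x -> posmx (g i x).
Proof. by move=> cx; split; [exact: (Defs.metric_sym g cx)|exact: (metric_posdef g cx)]. Qed.

Lemma gauss_codazzi_of_immersion i x : local_isometric_immersion g n.+1 ->
  chart_im (atlas i) x ->
  (forall a b c, cov2_alt (g i) (expPstar g i) a b c x = 0) /\
  (forall a b c d, Cstar g i x a b c d = 0).
Proof.
move=> imm cx; have [W [oW Wx [u [su iu]]]] := imm (chart_inv (atlas i) x).
pose U := chart_im (atlas i) `&` chart_inv (atlas i) @^-1` W.
have oU : open U by exact: open_chart_im.
have gp y : U y -> posmx (g i y) by move=> [+ _]; exact: metric_posmx.
have [||||h hP] := @gauss_codazzi_of_local_immersion R n U (g i)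
   (fun t => u t \o chart_inv (atlas i)) (ltnW n3) oU gp.
- by move=> a b; apply: smooth_onS (@metric_smooth _ _ _ g i a b) => y [].
- by move=> y [cy _]; exact: posR.
- by move=> t; exact: su.
- by move=> y a b [cy Wy]; exact: iu.
have logE y : U y -> exists2 P, P^T = P & Rstar g i y = kulkarni_nomizu (g i y) P /\
    exp_lower (g i y) P = h y.
  move=> Uy; have [hp RE _] := hP y Uy; rewrite /Rstar RE.
  apply: op_log_gauss => //; first exact: gp.
  by rewrite -RE; exact: posR Uy.1.
have Ux : U x by [].
split=> [a b c|a b c d].
  rewrite (@cov2_alt_ext _ _ _ _ h U)//; first by have [_ _] := hP x Ux.
  move=> y Uy; have [P Ps [LE PE]] := logE y Uy.
  have [gs _] := gp y Uy.
  by rewrite /expPstar /Pstar LE schouten_kulkarni_nomizu// posmx_unit//; exact: gp.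
have [P Ps [LE _]] := logE x Ux; have [gs _] := gp x Ux.
by rewrite /Cstar LE weyl_kulkarni_nomizu// posmx_unit//; exact: gp.
Qed.

(** The local immersion is built in one chart around p; its coordinates composed
    with the chart are smooth fields in all charts because the transition maps are
    smooth, and the metric equation is transported by the chain rule. *)
Lemma immersion_of_gauss_codazzi :
  (forall i x, chart_im (atlas i) x -> forall a b c d, Cstar g i x a b c d = 0) ->
  (n = 3%N -> forall i x, chart_im (atlas i) x ->
     forall a b c, cov2_alt (g i) (expPstar g i) a b c x = 0) ->
  local_isometric_immersion g n.+1.
Proof.
move=> C0 cod p; have [i ip] := atlas_cover p.
pose c := atlas i; pose U := chart_im c; pose x0 := chart_map c p.
have oU : open U by exact: chart_im_open.
have Ux0 : U x0 by exact: chart_map_im.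
have gp x : U x -> posmx (g i x) by exact: metric_posmx.
have sg a b : smooth_on U (fun x => g i x a b) by exact: metric_smooth.
have hP x : U x -> posmx (expPstar g i x) /\ riemann (g i) x = gauss_tensor (expPstar g i x).
  move=> Ux; apply: gauss_of_weyl_eq0 => //; first exact: gp.
  - exact: (riemann_operator_tensor oU gp sg).
  - exact: posR.
  - exact: C0.
have sh : forall a b, smooth_on U (fun x => expPstar g i x a b).
  apply: smooth_of_gauss => // [x /hP[]//|a b c' d].
  apply: (smooth_on_ext oU (f := fun x => riemann (g i) x a b c' d)) => [x /hP[_ ->]//|].
  apply: smooth_on_sum => // e _; apply: smooth_onM => //.
  exact: (smooth_curvature oU (smooth_christoffel oU gp sg)).
have ch x : U x -> forall a b c, cov2_alt (g i) (expPstar g i) a b c x = 0.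
  move=> Ux; move: n3; rewrite leq_eqVlt => /orP[/eqP n3'|n4]; first exact: cod.
  apply: (cov2_alt_of_gauss oU gp sg n4 sh) => //; first by move=> y /hP[].
  by have [] := hP x Ux.
have [x Ux|x Ux|r r0 [rU [f [sf isom]]]] :=
    local_immersion_of_gauss_codazzi oU gp sg sh _ _ ch Ux0.
- by have [[]] := hP x Ux.
- by have [] := hP x Ux.
pose V := [set x : 'rV[R]_n | `|x - x0| < r].
pose W := chart_dom c `&` chart_map c @^-1` V.
have oW : open W by apply: open_chart_dom; exact: open_norm_ball.
exists W; split=> //; first by split=> //; rewrite /V /= subrr normr0.
have sT j k : smooth_on (chart_im (atlas j) `&` chart_inv (atlas j) @^-1` W)
    (fun x => transition (atlas j) c x 0 k).
  by apply: smooth_onS (@atlas_compat _ _ M j i k) => x [cx [dx _]].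
exists (fun t => f t \o chart_map c); split=> [t j|j x cx Wx a b].
  apply: (@smooth_on_comp _ _ _ _ V (f t) (transition (atlas j) c)) => //.
  - exact: open_chart_im.
  - by move=> x [_ []].
have Vx : V (transition (atlas j) c x) by case: Wx.
have pE t d : partial d ((f t \o chart_map c) \o chart_inv (atlas j)) x =
    \sum_k partial k (f t) (transition (atlas j) c x)
           * partial d (fun z => transition (atlas j) c z 0 k) x.
  apply: (@partial_comp _ _ _ d (f t) (transition (atlas j) c)) => [k|].
    by apply: smooth_on_differentiable (sT j k) _.
  exact: smooth_on_differentiable (sf t) Vx.
under eq_bigr do rewrite !pE.
have ov : overlap (atlas j) (atlas i) x by split=> //; case: Wx.
rewrite (metric_transf g ov a b) /=.
transitivity (\sum_t \sum_k \sum_l partial a (fun z => transition (atlas j) c z 0 k) x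
    * partial b (fun z => transition (atlas j) c z 0 l) x
    * (partial k (f t) (transition (atlas j) c x) * partial l (f t) (transition (atlas j) c x))).
  apply: eq_bigr => t _; rewrite mulr_suml; apply: eq_bigr => k _.
  by rewrite mulr_sumr; apply: eq_bigr => l _; ring.
rewrite exchange_big; apply: eq_bigr => k _; rewrite exchange_big; apply: eq_bigr => l _ /=.
by rewrite -isom// mulr_sumr.
Qed.

End Global.

Theorem theorem5p1 (R : realType) (n : nat) (hn : (3 <= n)%N)
    (M : manifold R n) (g : metric M)
    (hpos : positive_curvature_operator g) :
  local_isometric_immersion g n.+1 <->
  ((n = 3%N -> forall (i : atlas_index M) (x : 'rV[R]_n),
      chart_im (atlas i) x ->
      forall a b c : 'I_n, cov2_alt (g i) (expPstar g i) a b c x = 0) /\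
   ((3 < n)%N -> forall (i : atlas_index M) (x : 'rV[R]_n),
      chart_im (atlas i) x ->
      forall a b c d : 'I_n, Cstar g i x a b c d = 0)).
Proof.
split=> [imm|[cod weyl0]].
  by split=> _ i x cx; have [] := gauss_codazzi_of_immersion hn hpos imm cx.
apply: immersion_of_gauss_codazzi => // i x cx a b c d.
move: (hn); rewrite leq_eqVlt => /orP[/eqP n3|n4]; last exact: weyl0.
have gp : posmx (g i x) := metric_posmx g cx.
have Tt : operator_tensor (riemann (g i) x).
  apply: (@riemann_operator_tensor R n (chart_im (atlas i))) => //.
  - exact: chart_im_open.
  - by move=> y; exact: metric_posmx.
  - by move=> *; exact: metric_smooth.
exact: (weyl_dim3 (esym n3) gp (op_logP gp Tt (hpos i x cx)).1).
Qed.
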